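(* Let a WIFS satisfy the $\Phi$-FNC for an iteration rule $\Phi$, and let $\mathcal L$ be an irreducible loop class of its transition graph $\mathcal G$. Then $f_{\mathcal L}=\tau_{\mathcal L}^*$.
   Context: Setting. A weighted iterated function system (WIFS) $(S_i,p_i)_{i\in\mathcal I}$ consists of a finite index set $\mathcal I$, maps $S_i(x)=r_ix+d_i$ on $\mathbb R$ with $0<|r_i|<1$, and probabilities $p_i>0$ with $\sum_i p_i=1$. Its self-similar set $K$ is the unique nonempty compact set with $K=\bigcup_i S_i(K)$ and its self-similar measure $\mu$ is the unique Borel probability measure with $\mu(E)=\sum_i p_i\,\mu(S_i^{-1}(E))$. Standing assumptions: $K$ is not a singleton and its convex hull is $[0,1]$. For a finite word $\sigma=\sigma_1\cdots\sigma_n$ over $\mathcal I$ (the set of all finite words, including the empty word, is $\mathcal I^*$) put $S_\sigma=S_{\sigma_1}\circ\cdots\circ S_{\sigma_n}$, $p_\sigma=p_{\sigma_1}\cdots p_{\sigma_n}$ (identity and $1$ for the empty word). For a map $f$, $f\mu:=\mu\circ f^{-1}$. Iteration rules and net intervals. Fix a total order on the affine bijections $x\mapsto ax+b$ ($a\ne0$) of $\mathbb R$. For a closed interval $J$ let $T_J(x)=rx+c$ ($r>0$) be the map with $T_J([0,1])=J$. An iteration rule $\Phi$ assigns to each finite strictly increasing tuple $v=(f_1,\dots,f_m)$ of such maps a tuple $\Phi(v)=(\mathcal C_1,\dots,\mathcal C_m)$ of finite subsets of $\mathcal I^*$ such that for each $i$ and all large $n$ every word of length $n$ has a unique prefix in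 $\mathcal C_i$. Children of a pair $(\Delta,v)$, $\Delta=[a,b]$: let $\mathcal Y=\{T_\Delta\circ f_i\circ S_\tau:1\le i\le m,\tau\in\mathcal C_i\}$ and list $\{a,b\}\cup\{g(z):g\in\mathcal Y,z\in\{0,1\},g(z)\in\Delta\}$ as $a=y_1<\dots<y_{k+1}=b$; the children are the pairs $(\Delta',v')$ with $\Delta'=[y_j,y_{j+1}]$, $(y_j,y_{j+1})\cap K\ne\emptyset$, and $v'$ the increasing tuple of the distinct maps $T_{\Delta'}^{-1}\circ g$, $g\in\mathcal Y$, $g(K)\cap(y_j,y_{j+1})\ne\emptyset$. Let $\mathcal N_0=\{([0,1],(\mathrm{id}))\}$ and $\mathcal N_{n+1}$ the set of children of members of $\mathcal N_n$; for $(\Delta,v)\in\mathcal N_n$, $\Delta$ is a net interval of level $n$ with neighbour set $v$. $\Phi$ must also satisfy: (i) $\max\{r\,\mathrm{diam}\Delta:(\Delta,v)\in\mathcal N_n,(x\mapsto rx+c)\in v\}\to0$; (ii) if $f_1\neq f_2$ lie in a neighbour set then $f_1\circ S_\sigma\ne f_2$ for all $\sigma\in\mathcal I^*$. (Convention: a pair whose only child has the same interval is replaced by that child, so every net interval has at least two children.) Transition graph. Children, their neighbour sets, relative positions and diameter ratios depend only on $v$. The transition graph $\mathcal G$ has as vertices the neighbour sets occurring, root $v_{\mathrm{root}}=(\mathrm{id})$, and one edge $e$ from $v$ to $v'$ for each child $(\Delta',v')$ of a pair $(\Delta,v)$ (distinguished by the relative position of $\Delta'$ in $\Delta$), with weight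 $W(e)=\mathrm{diam}\Delta'/\mathrm{diam}\Delta$ and transition matrix $T(e)$: for $v=(f_1,\dots,f_m)$, $v'=(g_1,\dots,g_n)$, $\Phi(v)=(\mathcal C_1,\dots,\mathcal C_m)$, $T(e)_{i,j}=\frac{f_i\mu((0,1))}{g_j\mu((0,1))}\sum p_\omega$ over $\omega\in\mathcal C_i$ with $T_\Delta\circ f_i\circ S_\omega=T_{\Delta'}\circ g_j$. For a path $\eta=(e_1,\dots,e_n)$, $W(\eta)=\prod W(e_k)$, $T(\eta)=T(e_1)\cdots T(e_n)$, $\|A\|$ = sum of entries. $\Omega^n,\Omega^*,\Omega^\infty$ are the rooted paths (starting at $v_{\mathrm{root}}$) of length $n$, finite, infinite. Each $\eta\in\Omega^n$ corresponds bijectively to a net interval $\pi(\eta)$ of level $n$, with $W(\eta)=\mathrm{diam}\,\pi(\eta)$; $\rho(\eta):=\mu(\pi(\eta))=\|T(\eta)\|$. For $\gamma\in\Omega^\infty$, $\gamma|n$ is its length-$n$ prefix. The WIFS satisfies the $\Phi$-FNC if $\mathcal G$ is finite. Loop classes and spectra. A loop class is an induced subgraph $\mathcal L$ of $\mathcal G$ that is strongly connected, has at least one edge, and is maximal with these properties. $\mathcal L$ is irreducible if there are a finite set $\mathcal H$ of paths and $C\ge1$ such that for all finite paths $\eta_1,\eta_2$ in $\mathcal L$ there is $\gamma\in\mathcal H$ with $\eta_1\gamma\eta_2$ a path and $C^{-1}\|T(\eta_1)\|\|T(\eta_2)\|\le\|T(\eta_1\gamma\eta_2)\|\le C\|T(\eta_1)\|\|T(\eta_2)\|$.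 $\Omega^\infty_{\mathcal L}$ is the set of $\gamma\in\Omega^\infty$ all but finitely many of whose edges lie in $\mathcal L$. $\mathcal F(t)$ is the set of $(e_1,\dots,e_n)\in\Omega^*$ with $W(e_1\cdots e_n)\le t<W(e_1\cdots e_{n-1})$. For $\zeta\in\Omega^*$ ending at a vertex of $\mathcal L$, $\mathcal F_{\mathcal L,\zeta}(t)$ is the set of $\eta\in\mathcal F(t)$ of the form $\zeta\eta'$ with all edges of $\eta'$ in $\mathcal L$, and $\tau_{\mathcal L}(q)=\lim_{t\to0}\log\sum_{\eta\in\mathcal F_{\mathcal L,\zeta}(t)}\rho(\eta)^q/\log t$ (the limit exists and is independent of $\zeta$). Equip $\Omega^\infty$ with the metric $d(\gamma_1,\gamma_2)=\inf\{W(\eta):\eta$ a common prefix of $\gamma_1,\gamma_2\}$; for $\gamma\in\Omega^\infty$, $\dim_{\mathrm{loc}}(\rho,\gamma)=\lim_n\log\rho(\gamma|n)/\log W(\gamma|n)$ when it exists. $f_{\mathcal L}(\alpha)$ is the Hausdorff dimension (w.r.t. $d$) of the set of $\gamma\in\Omega^\infty_{\mathcal L}$ having $\zeta$ as prefix with $\dim_{\mathrm{loc}}(\rho,\gamma)=\alpha$ (independent of $\zeta$; $\dim_H\emptyset=-\infty$). Concave conjugate: $g^*(\alpha)=\inf_{q\in\mathbb R}(\alpha q-g(q))$. *)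

(* Defs.v *)
From HB Require Import structures.
From mathcomp Require Import all_boot all_order all_algebra.
From mathcomp Require Import all_classical all_reals all_analysis.
Import Order.TTheory GRing.Theory Num.Theory numFieldNormedType.Exports.

Set Implicit Arguments.
Unset Strict Implicit.
Unset Printing Implicit Defensive.

Local Open Scope classical_set_scope.
Local Open Scope ring_scope.

(* Closed intervals [a, b] are represented by pairs (a, b).            *)
Section Affine.
Variable R : realType.
Definition aff := (R * R)%type.
Definition app (f : aff) (x : R) : R := f.1 * x + f.2.
Definition comp (f g : aff) : aff := (f.1 * g.1, f.1 * g.2 + f.2).
Definition aff_id : aff := (1, 0).
Definition aff_inv (f : aff) : aff := (f.1^-1, - (f.2 / f.1)).
(* T_J : the increasing affine map with T_J([0,1]) = J *)
Definition Tint (J : R * R) : aff := (J.2 - J.1, J.1).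
Definition width (J : R * R) : R := J.2 - J.1.
Definition image_int (J : R * R) (J' : R * R) : R * R :=
  (app (Tint J) J'.1, app (Tint J) J'.2).

Definition strict_total_order (lt : rel aff) : Prop :=
  [/\ irreflexive lt, transitive lt & forall f g, f != g -> lt f g \/ lt g f].

Definition hdiam (X : Type) (dist : X -> X -> R) (U : set X) : \bar R :=
  ereal_sup [set z | exists x y, U x /\ U y /\ z = (dist x y)%:E].

Definition cover_term (X : Type) (dist : X -> X -> R) (s : R) (U : set X)
  : \bar R :=
  if pselect (U = set0) then 0%E else ((fine (hdiam dist U)) `^ s)%:E.

Definition hausdorff_content (X : Type) (dist : X -> X -> R) (s delta : R)
  (E : set X) : \bar R :=
  ereal_inf [set z | exists U : nat -> set X,
     [/\ E `<=` \bigcup_k U k,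
         (forall k, (hdiam dist (U k) <= delta%:E)%E) &
         z = (\sum_(k <oo) cover_term dist s (U k))%E]].

Definition hausdorff_measure (X : Type) (dist : X -> X -> R) (s : R)
  (E : set X) : \bar R :=
  ereal_sup [set hausdorff_content dist s delta E | delta in [set delta | 0 < delta]].

Definition hausdorff_dim (X : Type) (dist : X -> X -> R) (E : set X) : \bar R :=
  if pselect (E = set0) then -oo%E
  else ereal_inf [set s%:E | s in [set s | 0 <= s /\ hausdorff_measure dist s E = 0%E]].

Definition concave_conj (g : R -> R) (alpha : R) : \bar R :=
  ereal_inf [set (alpha * q - g q)%:E | q in [set: R]].

End Affine.

Section WIFS.
Variable R : realType.
Variable I : finType.
Variables (r d p : I -> R).
Variable K : set R.
Variable mu : set R -> \bar R.
Variable ltA : rel (aff R).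
Variable Phi : seq (aff R) -> seq (seq (seq I)).

Definition Smap (i : I) : aff R := (r i, d i).
Definition Sw (s : seq I) : aff R := foldr (fun i f => comp (Smap i) f) (aff_id R) s.
Definition pw (s : seq I) : R := \prod_(i <- s) p i.

Definition pair_t := ((R * R) * seq (aff R))%type.

Definition inY (D : R * R) (v : seq (aff R)) (g : aff R) : Prop :=
  exists i, (i < size v)%N /\
    exists2 tau, tau \in nth [::] (Phi v) i &
      g = comp (Tint D) (comp (nth (aff_id R) v i) (Sw tau)).

Definition cutpt (D : R * R) (v : seq (aff R)) (y : R) : Prop :=
  y = D.1 \/ y = D.2 \/
  exists g z, [/\ inY D v g, (z = 0 \/ z = 1), D.1 <= app g z <= D.2 & y = app g z].

Definition raw_child (x y : pair_t) : Prop :=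
  let D := x.1 in let v := x.2 in let D' := y.1 in let v' := y.2 in
  [/\ cutpt D v D'.1, cutpt D v D'.2, D'.1 < D'.2 &
      (forall z, cutpt D v z -> ~ (D'.1 < z < D'.2))] /\
  [/\ (exists2 k, K k & D'.1 < k < D'.2),
      sorted ltA v' &
      (forall h, h \in v' <->
         exists g, [/\ inY D v g,
                      (exists2 k, K k & D'.1 < app g k < D'.2) &
                      h = comp (aff_inv (Tint D')) g])].

Definition triv (x y : pair_t) : Prop :=
  [/\ raw_child x y, y.1 = x.1 & forall z, raw_child x z -> z = y].

Definition normal (x : pair_t) : Prop := ~ exists y, triv x y.

Fixpoint triv_chain (x : pair_t) (c : seq pair_t) : Prop :=
  match c with
  | [::] => normal x
  | y :: c' => triv x y /\ triv_chain y c'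
  end.

(* a (convention-adjusted) child of x is last x c where step x c *)
Definition step (x : pair_t) (c : seq pair_t) : Prop :=
  exists y c', c = y :: c' /\ raw_child x y /\ triv_chain y c'.

Definition root_pair : pair_t := ((0, 1), [:: aff_id R]).

Inductive net : nat -> pair_t -> Prop :=
| net0 c : triv_chain root_pair c -> net 0 (last root_pair c)
| netS n x c : net n x -> step x c -> net n.+1 (last x c).

Definition iteration_rule : Prop :=
  [/\ (forall v : seq (aff R), sorted ltA v -> all (fun f => f.1 != 0) v ->
        size (Phi v) = size v /\
        forall i, (i < size v)%N ->
          uniq (nth [::] (Phi v) i) /\
          exists N, forall n, (N <= n)%N -> forall w : seq I, size w = n ->
            exists! s, s \in nth [::] (Phi v) i /\ take (size s) w = s),
      (forall eps, 0 < eps -> exists N, forall n, (N <= n)%N ->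
         forall D v f, net n (D, v) -> f \in v -> `|f.1| * width D < eps) &
      (forall n D v f1 f2, net n (D, v) -> f1 \in v -> f2 \in v -> f1 != f2 ->
         forall s, comp f1 (Sw s) != f2)].

Definition is_vertex (v : seq (aff R)) : Prop := exists n D, net n (D, v).

(* edge = (source, relative position of child, chain of neighbour sets) *)
Definition edge := (seq (aff R) * (R * R) * seq (seq (aff R)))%type.
Definition esrc (e : edge) : seq (aff R) := e.1.1.
Definition epos (e : edge) : R * R := e.1.2.
Definition echain (e : edge) : seq (seq (aff R)) := e.2.
Definition etgt (e : edge) : seq (aff R) := last e.1.1 e.2.

Definition is_edge (e : edge) : Prop :=
  exists n D c, [/\ net n (D, esrc e), step (D, esrc e) c &
     c = [seq (image_int D (epos e), w) | w <- echain e]].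

Definition edge_weight (e : edge) : R := width (epos e).

Definition mat := nat -> nat -> R.
Definition idm : mat := fun i j => (i == j)%:R.
Definition mulm (n : nat) (A B : mat) : mat :=
  fun i j => \sum_(k < n) A i k * B k j.

Definition fmu (f : aff R) : R := fine (mu [set x | 0 < app f x < 1]).

(* one-step transition matrix from v to v' with child at relative pos J *)
Definition rawM (v : seq (aff R)) (J : R * R) (v' : seq (aff R)) : mat :=
  fun i j =>
    fmu (nth (aff_id R) v i) / fmu (nth (aff_id R) v' j) *
    \sum_(w <- nth [::] (Phi v) i |
            comp (nth (aff_id R) v i) (Sw w) == comp (Tint J) (nth (aff_id R) v' j))
       pw w.

Fixpoint trivM (w : seq (aff R)) (c : seq (seq (aff R))) : mat :=
  match c with
  | [::] => idm
  | w' :: c' => mulm (size w') (rawM w (0, 1) w') (trivM w' c')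
  end.

Definition edgeM (e : edge) : mat :=
  match echain e with
  | [::] => idm
  | w :: c => mulm (size w) (rawM (esrc e) (epos e) w) (trivM w c)
  end.

Definition pathM (es : seq edge) : mat :=
  foldr (fun e M => mulm (size (etgt e)) (edgeM e) M) idm es.

Definition pnorm (e0 : edge) (es : seq edge) : R :=
  \sum_(i < size (esrc e0)) \sum_(j < size (etgt (last e0 es)))
     pathM (e0 :: es) i j.

Definition is_path (es : seq edge) : Prop :=
  (forall e, e \in es -> is_edge e) /\
  match es with
  | [::] => True
  | e0 :: es' => path (fun e e' => etgt e == esrc e') e0 es'
  end.

Definition is_root (v : seq (aff R)) : Prop := net 0 ((0, 1), v).

Definition rooted (es : seq edge) : Prop :=
  is_path es /\ forall e0 es', es = e0 :: es' -> is_root (esrc e0).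

Definition ends_at (es : seq edge) (u : seq (aff R)) : Prop :=
  match es with
  | [::] => is_root u
  | e0 :: es' => etgt (last e0 es') = u
  end.

Definition pint (es : seq edge) : R * R :=
  foldl (fun J e => image_int J (epos e)) (0, 1) es.
Definition Wt (es : seq edge) : R := width (pint es).
Definition rho (es : seq edge) : R :=
  fine (mu [set x | (pint es).1 <= x <= (pint es).2]).

Definition FNC : Prop := finite_set is_vertex /\ finite_set is_edge.

(* loop classes: given by their vertex set Lv (induced subgraph) *)
Definition inL (Lv : set (seq (aff R))) (e : edge) : Prop :=
  [/\ is_edge e, Lv (esrc e) & Lv (etgt e)].

Definition pathL (Lv : set (seq (aff R))) (es : seq edge) : Prop :=
  is_path es /\ forall e, e \in es -> inL Lv e.

Definition connects (es : seq edge) (u w : seq (aff R)) : Prop :=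
  match es with
  | [::] => u = w
  | e0 :: es' => esrc e0 = u /\ etgt (last e0 es') = w
  end.

Definition strongly_connected (Lv : set (seq (aff R))) : Prop :=
  forall u w, Lv u -> Lv w -> exists es, pathL Lv es /\ connects es u w.

Definition loop_cand (Lv : set (seq (aff R))) : Prop :=
  [/\ Lv `<=` is_vertex, strongly_connected Lv & exists e, inL Lv e].

Definition loop_class (Lv : set (seq (aff R))) : Prop :=
  loop_cand Lv /\ forall Lv', Lv `<=` Lv' -> loop_cand Lv' -> Lv' = Lv.

Definition irreducible (Lv : set (seq (aff R))) : Prop :=
  exists (H : seq (seq edge)) (C : R),
    [/\ 1 <= C, (forall g, g \in H -> is_path g) &
     forall e1 es1 e2 es2, pathL Lv (e1 :: es1) -> pathL Lv (e2 :: es2) ->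
       exists2 g, g \in H &
         is_path ((e1 :: es1) ++ g ++ (e2 :: es2)) /\
         let n1 := pnorm e1 es1 in let n2 := pnorm e2 es2 in
         let n := pnorm e1 (es1 ++ g ++ e2 :: es2) in
         C^-1 * n1 * n2 <= n <= C * n1 * n2].

Definition inF (t : R) (es : seq edge) : Prop :=
  [/\ rooted es, (0 < size es)%N & Wt es <= t < Wt (take (size es).-1 es)].

Definition inFL (Lv : set (seq (aff R))) (zeta : seq edge) (t : R)
  (es : seq edge) : Prop :=
  inF t es /\ exists es', es = zeta ++ es' /\ forall e, e \in es' -> inL Lv e.

Definition sumFL (Lv : set (seq (aff R))) (zeta : seq edge) (q t : R) : \bar R :=
  (\esum_(es in inFL Lv zeta t) ((rho es) `^ q)%:E)%E.

Definition rooted_inf (g : nat -> edge) : Prop :=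
  [/\ forall n, is_edge (g n), forall n, etgt (g n) = esrc (g n.+1)
    & is_root (esrc (g 0%N))].

Definition prefix (g : nat -> edge) (n : nat) : seq edge := mkseq g n.

Definition in_OmegaL (Lv : set (seq (aff R))) (g : nat -> edge) : Prop :=
  rooted_inf g /\ exists N, forall k, (N <= k)%N -> inL Lv (g k).

Definition pdist (g1 g2 : nat -> edge) : R :=
  inf [set Wt (prefix g1 n) | n in [set n | prefix g1 n = prefix g2 n]].

Definition has_locdim (g : nat -> edge) (alpha : R) : Prop :=
  (ln (rho (prefix g n)) / ln (Wt (prefix g n))) @[n --> \oo] --> alpha.

Definition fL (Lv : set (seq (aff R))) (zeta : seq edge) (alpha : R) : \bar R :=
  hausdorff_dim pdist
    [set g | [/\ in_OmegaL Lv g, prefix g (size zeta) = zeta & has_locdim g alpha]].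

(* the quantity whose limit as t -> 0+ defines tau_L(q) *)
Definition tau_approx (Lv : set (seq (aff R))) (zeta : seq edge) (q t : R) : R :=
  ln (fine (sumFL Lv zeta q t)) / ln t.

Definition adm_prefix (Lv : set (seq (aff R))) (zeta : seq edge) : Prop :=
  rooted zeta /\ exists2 u, Lv u & ends_at zeta u.

End WIFS.

(* Main.v *)
(* Since the transition matrices are nonnegative with no zero column, rho(zeta eta) is comparable
   to the norm of T(eta), and everything becomes symbolic: paths eta in the loop class with length
   -ln W(eta) and cost -ln rho(zeta eta), irreducibility saying that two paths can be joined at
   bounded error.  Write Y_q(x) for the sum of rho^q over the paths stopped at length x.
   - Joining gives Y_q(x) Y_q(y) <= C Y_q(x+y+c) for every real q, whence tau by Fekete's lemma.
     For q < 0 the stopped path is a prefix of a joined path and an extension of another one, so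
     that its cost is controlled on both sides.
   - Upper bound: the stopped paths with cost/length near alpha cover the level set and are
     counted by Y_q.
   - Lower bound: by pigeonhole, for every q many stopped paths have nearly the same cost a l,
     at least exp(l (q a - tau q - eps)) of them.  As q increases along a fine grid the slope a
     crosses alpha, and mixing the two types of blocks at the crossing gives blocks of slope alpha
     and entropy at least tau^*(alpha), even where tau is not differentiable.  Concatenating them
     with slowly growing block lengths yields a Cantor set of points of local dimension alpha; a
     counting argument on the tree replaces the mass distribution principle. *)
Require Import Defs.
From HB Require Import structures.
From mathcomp Require Import all_boot all_order all_algebra.
From mathcomp Require Import all_classical all_reals all_analysis.
From mathcomp Require Import measurable_realfun.
From mathcomp Require Import ring lra zify.
Import Order.TTheory GRing.Theory Num.Theory numFieldNormedType.Exports.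

Local Open Scope classical_set_scope.
Local Open Scope ring_scope.

Set Implicit Arguments.
Unset Strict Implicit.
Unset Printing Implicit Defensive.

(** The symbolic half sees only edges, lengths, a cost [nc] that is additive up to a constant under
    joining, and a finite list of connectors; the measure half supplies these data, and the two meet
    in [multifractal]. Three obstacles shape the measure half. [mu] is given only by its
    self-similarity equation, whereas neighbours are selected by meeting [K] and [rho] uses closed
    intervals: so [mu] is first shown to live on [K], to charge every neighbourhood of a point of
    [K], and to have no atoms. An edge is witnessed at some net interval, in general not at the one
    that a path has reached: so the decomposition [Inv] is transported between intervals with the
    same neighbour set. The connectors of irreducibility are arbitrary paths of the graph:
    maximality of the loop class puts them inside it. The value [-oo] for the empty set also needs
    an argument: a nonempty level set forces a nonnegative conjugate, and a finite conjugate forces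
    a nonempty level set. *)

Section Fekete.
Variable R : realType.

(** Shifting the argument by [c] makes [h] superadditive, which is why the slope is the supremum of
    [h x / (x + c)]. The linear bound on [h] takes the place of regularity in the real variable: it
    controls the remainder left after removing copies of a nearly optimal step. *)
Lemma fekete (h : R -> R) (c A : R) : 0 <= c ->
  (forall x y, 0 < x -> 0 < y -> h x + h y <= h (x + y + c)) ->
  (forall x, 1 <= x -> `|h x| <= A * x) ->
  exists S, forall eps, 0 < eps -> exists X, forall x, X <= x -> `|h x - S * x| <= eps * x.
Proof.
move=> c0 sup hA.
have A0 : 0 <= A by have := hA 1 (lexx _); rewrite mulr1; apply: le_trans.
pose E := [set h x / (x + c) | x in [set x | 1 <= x]].
have Eub : has_ubound E.
  exists A => _ [x /= x1 <-]; rewrite ler_pdivrMr; last lra.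
  have := hA x x1; rewrite ler_norml => /andP[_]; nra.
have E0 : E !=set0 by exists (h 1 / (1 + c)), 1 => /=.
pose S := reals.sup E; exists S => e e0.
have hSup : forall x, 1 <= x -> h x <= S * (x + c).
  move=> x x1; rewrite -ler_pdivrMr; last lra.
  by apply: ub_le_sup => //; exists x.
have [_ [x0 /= x01 <-] hx0] : exists2 z, E z & S - e / 2 < z.
  by apply: sup_adherent => //; lra.
pose L := x0 + c; have L0 : 0 < L by rewrite /L; lra.
have hn : forall n y, 0 < y -> h y + n%:R * h x0 <= h (y + n%:R * L).
  elim=> [|n IH] y y0; first by rewrite !mul0r !addr0.
  have := sup (y + n%:R * L) x0; have := IH y y0.
  have -> : y + n%:R * L + x0 + c = y + n.+1%:R * L by rewrite -natr1 /L; ring.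
  have nL0 : 0 <= n%:R * L by rewrite mulr_ge0 // ltW.
  have : 0 < y + n%:R * L by lra.
  by rewrite -natr1 => h1 h2 /(_ h1 ltac:(lra)); lra.
have Le : (S - e / 2) * L <= h x0.
  by move: hx0; rewrite ltr_pdivlMr // => /ltW.
pose B := A * (1 + L) + (1 + L) * `|S - e / 2|.
have B0 : 0 <= B by rewrite /B addr_ge0 // mulr_ge0 //; lra.
exists (1 + L + 2 * B / e + `|S| * c / e) => z zX.
have Bz0 : 0 <= 2 * B / e by rewrite divr_ge0 ?mulr_ge0 // ltW.
have Sz0 : 0 <= `|S| * c / e by rewrite divr_ge0 ?mulr_ge0 // ltW.
have [z1 zB' zS'] : [/\ 1 + L <= z, 2 * B / e <= z & `|S| * c / e <= z].
  by move: L0 zX Bz0 Sz0; clearbody L B; move: (2 * B / e) (_ * c / e) => b s; split; lra.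
have zB : 2 * B <= e * z by rewrite [leRHS]mulrC -ler_pdivrMr.
have zS : `|S| * c <= e * z by rewrite [leRHS]mulrC -ler_pdivrMr.
have Sc : S * c <= `|S| * c by rewrite ler_wpM2r // ler_norm.
have hz : h z <= S * (z + c) by apply: hSup; lra.
(* Flooring [(z - 1) / L] keeps the remainder [y] in [[1, 1 + L]], where [hA] applies. *)
pose n := Num.truncn ((z - 1) / L).
pose y := z - n%:R * L.
have y1 : 1 <= y.
  have : n%:R <= (z - 1) / L by rewrite /n truncn_le divr_ge0 ?ltW //; lra.
  by rewrite ler_pdivlMr // /y; lra.
have y2 : y <= 1 + L.
  have := truncnS_gt ((z - 1) / L); rewrite -/n ltr_pdivrMr // -natr1 /y; lra.
have := hn n y; rewrite subrK => /(_ ltac:(lra)) hzy.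
have := hA y y1; rewrite ler_norml => /andP[hy _].
have nL : n%:R * ((S - e / 2) * L) <= n%:R * h x0 by rewrite ler_wpM2l.
have E1 : n%:R * ((S - e / 2) * L) = (z - y) * (S - e / 2) by rewrite /y; ring.
have yS : y * (S - e / 2) <= (1 + L) * `|S - e / 2|.
  apply: le_trans (ler_norm _) _; rewrite normrM ler_wpM2r // ger0_norm //; lra.
have Ay : A * y <= A * (1 + L) by rewrite ler_wpM2l.
by rewrite ler_norml; apply/andP; split; rewrite /B in zB; clearbody y n; lra.
Qed.

End Fekete.

(** * Slowly increasing block types *)

Section Schedule.
Variable R : realType.

Lemma slow_schedule (l : nat -> R) : (forall s, 1 <= l s) ->
  exists sg : nat -> nat, forall e, 0 < e -> exists K, forall k, (K <= k)%N ->
    l (sg k) <= e * \sum_(j < k) l (sg j) /\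
    \sum_(j < k) l (sg j) * (sg j).+1%:R^-1 <= e * \sum_(j < k) l (sg j).
Proof.
move=> l1.
have l0 s : 0 < l s by exact: lt_le_trans (l1 s).
pose sg k := (\max_(s < k.+1 | (l s * s.+1%:R <= k%:R)%R) s)%N.
exists sg => e e0; pose S k := \sum_(j < k) l (sg j).
have kS k : k%:R <= S k.
  rewrite -[k in k%:R]card_ord -sumr_const; apply: ler_sum => j _; exact: l1.
have sg_ge s : exists K, forall k, (K <= k)%N -> (s <= sg k)%N.
  exists (s + (Num.truncn (l s * s.+1%:R)).+1)%N => k Kk.
  have sk : (s < k.+1)%N by lia.
  apply: (@leq_bigmax_cond _ (fun s : 'I_k.+1 => l s * s.+1%:R <= k%:R) _ (Ordinal sk)).
  apply/ltW/(lt_le_trans (truncnS_gt _)); rewrite ler_nat.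
  by apply: leq_trans Kk; rewrite leq_addl.
(* The maximum defining [sg k] ranges over a nonempty set only when type [0] is admissible, hence
   the threshold [K0]. *)
have [K0 hK0] : exists K, forall k, (K <= k)%N -> l (sg k) * (sg k).+1%:R <= k%:R.
  exists (Num.truncn (l 0%N)).+1 => k Kk.
  have [|s ls] := @eq_bigmax_cond _ (fun s : 'I_k.+1 => l s * s.+1%:R <= k%:R)
     (fun s => nat_of_ord s).
    apply/card_gt0P; exists ord0; rewrite unfold_in /= mulr1.
    apply/ltW/(lt_le_trans (truncnS_gt _)); by rewrite ler_nat.
  by move=> E; have -> : sg k = s; [exact: E|exact: ls].
pose N := (Num.truncn (2 / e)).
have Ne n : (N <= n)%N -> n.+1%:R^-1 <= e / 2.
  move=> Nn; rewrite invf_ple ?posrE ?divr_gt0 ?ltr0n // invf_div.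
  by apply/ltW/(lt_le_trans (truncnS_gt _)); rewrite ler_nat.
have [K1 hK1] := sg_ge N.
pose K2 := maxn K0 K1.
have S0 k : 0 <= S k by apply: le_trans (kS k).
exists (K2 + (Num.truncn (2 * S K2 / e)).+1)%N => k Kk.
have K0k : (K0 <= k)%N by apply: leq_trans Kk; rewrite /K2; lia.
have K1k : (K1 <= k)%N by apply: leq_trans Kk; rewrite /K2; lia.
split.
  have := hK0 k K0k; rewrite -ler_pdivlMr ?ltr0n // => /le_trans; apply.
  apply: (@le_trans _ _ (k%:R * (e / 2))); first by rewrite ler_wpM2l // Ne // hK1.
  have := kS k; have : 0 <= (k%:R : R) by []; rewrite -/(S k); nra.
(* Blocks before [K2] are charged in full, later ones at rate [e / 2]; the fixed initial part is
   then absorbed by the growth of [S]. *)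
have step n : \sum_(j < K2 + n) l (sg j) * (sg j).+1%:R^-1 <= S K2 + e / 2 * S (K2 + n)%N.
  elim: n => [|n IH].
    rewrite addn0; apply: (@le_trans _ _ (S K2)).
      by apply: ler_sum => j _; rewrite ler_piMr ?(ltW (l0 _)) // invf_le1 ?ltr0n // ler1n.
    by rewrite lerDl mulr_ge0 // divr_ge0 // ltW.
  rewrite addnS /S !big_ord_recr /= -/(S _) -/(S _) mulrDr addrA.
  apply: lerD IH _; rewrite mulrC ler_wpM2r ?(ltW (l0 _)) //.
  by apply/Ne/hK1; rewrite /K2; lia.
have -> : k = (K2 + (k - K2))%N by rewrite subnKC //; lia.
apply: le_trans (step _) _; rewrite subnKC; last by lia.
have : 2 * S K2 / e <= k%:R.
  apply/ltW/(lt_le_trans (truncnS_gt _)); rewrite ler_nat.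
  by apply: leq_trans Kk; rewrite leq_addl.
rewrite ler_pdivrMr // => h; have kSe : k%:R * e <= S k * e by rewrite ler_wpM2r // ltW.
by rewrite -/(S k); move: (S k) (S K2) h kSe => x y; lra.
Qed.

End Schedule.

(** * Branches of a tree that avoid a light cover *)

Section TreeCover.
Variables (R : realType) (N : eqType) (ch : nat -> N -> seq N) (M : nat -> nat).
Variables (Rch : nat -> N -> Prop) (meets : nat -> N -> Prop) (ki : nat -> nat) (s0 : N).
Hypothesis M0 : forall k, (0 < M k)%N.
Hypothesis Rch0 : Rch 0 s0.
Hypothesis RchS : forall k s s', Rch k s -> s' \in ch k s -> Rch k.+1 s'.
Hypothesis chP : forall k s, Rch k s -> size (ch k s) = M k /\ uniq (ch k s).
Hypothesis meets_up : forall i k s s', Rch k s -> s' \in ch k s -> meets i s' -> meets i s.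
Hypothesis meets_one : forall i k s a b, Rch k s -> (k < ki i)%N ->
  a \in ch k s -> b \in ch k s -> meets i a -> meets i b -> a = b.

Definition mass k : R := \prod_(j < k) (M j)%:R^-1.

(** Each cover element [i] that meets [s] is charged the uniform mass of one node of level [ki i],
    the level down to which it cannot meet two siblings. *)
Let T s : \bar R := (\sum_(i <oo) (if `[< meets i s >] then mass (ki i) else 0)%:E)%E.

Lemma mass_gt0 k : 0 < mass k.
Proof. by apply: prodr_gt0 => j _; rewrite invr_gt0 ltr0n. Qed.

Lemma massS k : (M k)%:R * mass k.+1 = mass k.
Proof.
by rewrite /mass big_ord_recr /= mulrC divfK // pnatr_eq0 -lt0n.
Qed.

Lemma mass_le k k' : (k <= k')%N -> mass k' <= mass k.
Proof.
move=> /subnKC <-; elim: (k' - k)%N => [|n IH]; first by rewrite addn0.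
apply: le_trans IH; rewrite -[leRHS]massS addnS ler_peMl ?(ltW (mass_gt0 _)) //.
by rewrite ler1n.
Qed.

Let term_ge0 s i : (0 <= (if `[< meets i s >] then mass (ki i) else 0)%:E :> \bar R)%E.
Proof. by rewrite lee_fin; case: asboolP => // _; exact: ltW (mass_gt0 _). Qed.

(** An element with [ki i <= k] weighs at least [mass k] on its own, too much for a node with
    [T s < mass k]. *)
Let meets_late i k s : (T s < (mass k)%:E)%E -> meets i s -> (k < ki i)%N.
Proof.
move=> Ts ms; rewrite ltnNge; apply/negP => /mass_le h.
have : ((mass (ki i))%:E <= T s)%E.
  rewrite /T; apply: le_trans (nneseries_lim_ge i.+1 (fun n _ _ => term_ge0 s n)).
  rewrite big_nat_recr //=; case: asboolP => // _; by rewrite leeDr // sume_ge0.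
by move=> h2; have := le_lt_trans h2 Ts; rewrite lte_fin ltNge h.
Qed.

(* A cover of total mass below 1 misses a branch: at each node some child receives
   less cover mass than its own mass. *)
Lemma tree_cover : (\sum_(i <oo) (mass (ki i))%:E < 1%:E)%E ->
  exists b : nat -> N, [/\ b 0%N = s0, forall k, b k.+1 \in ch k (b k) &
    forall i, ~ meets i (b (ki i))].
Proof.
move=> tot.
pose Inv k s := Rch k s /\ (T s < (mass k)%:E)%E.
have inv0 : Inv 0%N s0.
  split=> //; apply: le_lt_trans (_ : _ <= _)%E _; last first.
    by rewrite /mass big_ord0; exact: tot.
  apply: lee_nneseries => i *; first exact: term_ge0.
  by rewrite lee_fin; case: asboolP => // _; exact: ltW (mass_gt0 _).
have invS k s : Inv k s -> exists2 s', s' \in ch k s & Inv k.+1 s'.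
  move=> [rs Ts]; have [szc uc] := chP rs; apply: contrapT => nex.
  have big s' : s' \in ch k s -> ((mass k.+1)%:E <= T s')%E.
    move=> s'c; rewrite leNgt; apply/negP => lt; apply: nex; exists s' => //.
    by split=> //; apply: RchS s'c.
  have : ((mass k)%:E <= \sum_(s' <- ch k s) T s')%E.
    have -> : mass k = \sum_(s' <- ch k s) mass k.+1.
      by rewrite -massS -szc big_const_seq count_predT iter_addr_0 mulr_natl.
    by rewrite -sumEFin [leLHS]big_seq [leRHS]big_seq; apply: lee_sum => s' /big.
  (* A cover element meeting [s] meets at most one child of it, so the values of [T] at the children
     add up to at most [T s], which is below [mass k]. *)
  rewrite leNgt => /negP; apply; apply: le_lt_trans _ (Ts).
  rewrite /T -nneseries_sum; last by move=> s' i _; exact: term_ge0.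
  apply: lee_nneseries => [i _ _|i _]; first by apply: sume_ge0 => *; exact: term_ge0.
  rewrite sumEFin lee_fin; case: (asboolP (meets i s)) => ms.
    have late := meets_late Ts ms.
    have [[c cc mc]|nc] := pselect (exists2 c, c \in ch k s & meets i c); last first.
      rewrite big_seq big1 ?(ltW (mass_gt0 _)) // => c cc.
      by case: asboolP => // mc; exfalso; apply: nc; exists c.
    rewrite (big_rem c cc) /=; case: asboolP => // _.
    rewrite big_seq big1 ?addr0 // => c' c'c; case: asboolP => // mc'.
    move: c'c; rewrite mem_rem_uniq // inE => /andP[/eqP ne c'c].
    by exfalso; apply: ne; exact: (meets_one rs late).
  rewrite big_seq big1 // => c cc; case: asboolP => // mc.
  by exfalso; apply: ms; exact: (meets_up rs cc mc).
have /choice[f fP] : forall p : nat * N, exists s', Inv p.1 p.2 ->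
    s' \in ch p.1 p.2 /\ Inv p.1.+1 s'.
  move=> [k s]; have [/invS[s' h1 h2]|] := pselect (Inv k s); last by exists s.
  by exists s'.
pose b := fix b k := if k is k'.+1 then f (k', b k') else s0.
have invb k : Inv k (b k) by elim: k => //= k /(fP (k, _))[].
exists b; split=> // [k|i mi]; first by have [] := fP (k, b k) (invb k).
by have [_ /meets_late/(_ mi)] := invb (ki i); rewrite ltnn.
Qed.

End TreeCover.

(** * Words, lengths and stopped paths *)

Section ListSums.
Variable R : realType.

Lemma ler_sum_sub (B : eqType) (s t : seq B) (h : B -> R) :
  uniq s -> {subset s <= t} -> (forall b, 0 <= h b) ->
  \sum_(b <- s) h b <= \sum_(b <- t) h b.
Proof.
move=> us st h0; elim: s t us st => [|b s IH] t /=.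
  by move=> _ _; rewrite big_nil sumr_ge0.
move=> /andP[bs us] st; rewrite big_cons.
have bt : b \in t by apply: st; rewrite mem_head.
rewrite (big_rem b bt) /= lerD2l; apply: IH => // x xs.
have xt : x \in t by apply: st; rewrite inE xs orbT.
have xb : x != b by apply: contraNneq bs => <-.
by move: xt; rewrite (perm_mem (perm_to_rem bt)) inE (negPf xb).
Qed.

Lemma ler_sum_inj (A B : eqType) (s : seq A) (t : seq B) (f : A -> B)
  (g : A -> R) (h : B -> R) :
  uniq s -> {in s &, injective f} -> (forall a, a \in s -> f a \in t) ->
  (forall a, a \in s -> g a <= h (f a)) -> (forall b, 0 <= h b) ->
  \sum_(a <- s) g a <= \sum_(b <- t) h b.
Proof.
move=> us fi st gh h0; apply: (@le_trans _ _ (\sum_(b <- map f s) h b)).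
  by rewrite big_map [leLHS]big_seq [leRHS]big_seq; apply: ler_sum => a; apply: gh.
apply: ler_sum_sub => //; first by rewrite map_inj_in_uniq.
by move=> b /mapP[a aS ->]; apply: st.
Qed.

Lemma sum_pairs_dep (A B : eqType) (r : seq A) (t : A -> seq B) (h : B -> R) :
  \sum_(a <- r) \sum_(b <- t a) h b =
  \sum_(z <- [seq (a, b) | a <- r, b <- t a]) h z.2.
Proof. by rewrite big_allpairs_dep. Qed.

Fixpoint words (T : eqType) (E : seq T) (n : nat) : seq (seq T) :=
  if n is n'.+1 then [::] :: [seq e :: s | e <- E, s <- words E n'] else [:: [::]].

Lemma mem_words (T : eqType) (E : seq T) n s :
  (s \in words E n) = all (mem E) s && (size s <= n)%N.
Proof.
elim: n s => [|n IH] [|e s] //=.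
  by rewrite inE ltn0 andbF.
rewrite inE /=; apply/allpairsP/idP.
  by move=> [[a b] /= [aE]]; rewrite IH => /andP[b1 b2] [-> ->]; rewrite aE b1.
by case/andP=> /andP[eE sE] sn; exists (e, s); split=> //=; rewrite IH sE.
Qed.

Lemma uniq_words (T : eqType) (E : seq T) n : uniq E -> uniq (words E n).
Proof.
move=> uE; elim: n => [|n IH] //=; apply/andP; split.
  by apply/negP => /allpairsP[[a b] /= []].
by apply: allpairs_uniq => // -[a b] [a' b'] _ _ /= [-> ->].
Qed.

Lemma size_words (T : eqType) (E : seq T) n :
  (size (words E n) <= (size E).+1 ^ n)%N.
Proof.
elim: n => [|n IH] //=; rewrite size_allpairs expnS mulSn.
by rewrite -add1n leq_add ?expn_gt0 // leq_mul2l IH orbT.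
Qed.

Lemma pigeonhole_sum (B : eqType) (t : seq B) (h : B -> R) (M : R) :
  (0 < size t)%N -> M * (size t)%:R <= \sum_(b <- t) h b ->
  exists2 b, b \in t & M <= h b.
Proof.
move=> t0 H; apply: contrapT => nex.
have : \sum_(b <- t) h b < \sum_(b <- t) M.
  rewrite [ltLHS]big_seq [ltRHS]big_seq; case: t t0 {H} nex => // b t _ nex.
  apply: ltr_sum => [|i it]; first by apply/hasP; exists b; rewrite ?mem_head.
  by rewrite ltNge; apply/negP => Mh; apply: nex; exists i.
rewrite big_const_seq count_predT iter_addr_0 -mulr_natr => /(le_lt_trans H).
by rewrite ltxx.
Qed.

End ListSums.

Section Paths.
Variables (R : realType) (T V : eqType) (src tgt : T -> V) (EL : seq T).
Variables (lw : T -> R) (lmin lmax : R) (VL : V -> Prop).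
Hypothesis lmin0 : 0 < lmin.
Hypothesis lwP : forall e, e \in EL -> lmin <= lw e <= lmax.
Hypothesis uEL : uniq EL.
Hypothesis VLtgt : forall e, e \in EL -> VL (tgt e).
Hypothesis VLout : forall u, VL u -> exists2 e, e \in EL & src e = u.

Definition len (s : seq T) : R := \sum_(e <- s) lw e.
Fixpoint lpath (u : V) (s : seq T) : bool :=
  if s is e :: s' then [&& e \in EL, src e == u & lpath (tgt e) s'] else true.
Definition lend (u : V) (s : seq T) : V := last u (map tgt s).

Lemma len_cat s1 s2 : len (s1 ++ s2) = len s1 + len s2.
Proof. by rewrite /len big_cat. Qed.

Lemma lpath_cat u s1 s2 : lpath u (s1 ++ s2) = lpath u s1 && lpath (lend u s1) s2.
Proof. by elim: s1 u => //= e s IH u; rewrite IH /lend /= !andbA. Qed.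

Lemma lpath_EL u s : lpath u s -> all (mem EL) s.
Proof. by elim: s u => //= e s IH u /and3P[-> _ /IH]. Qed.

Lemma lend_VL u s : VL u -> lpath u s -> VL (lend u s).
Proof.
elim: s u => //= e s IH u uV /and3P[eE _ ps].
by apply: (IH (tgt e)) => //; apply: VLtgt.
Qed.

Lemma len_ge s : all (mem EL) s -> lmin * (size s)%:R <= len s.
Proof.
elim: s => [|e s IH] /=; first by rewrite /len big_nil mulr0.
move=> /andP[/lwP/andP[e1 _] /IH sl]; rewrite /len big_cons -/(len s).
rewrite -natr1; lra.
Qed.

Lemma len_le s : all (mem EL) s -> len s <= lmax * (size s)%:R.
Proof.
elim: s => [|e s IH] /=; first by rewrite /len big_nil mulr0.
move=> /andP[/lwP/andP[_ e1] /IH sl]; rewrite /len big_cons -/(len s).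
rewrite -natr1; lra.
Qed.

Lemma len_ge0 s : all (mem EL) s -> 0 <= len s.
Proof. by move=> /len_ge; apply: le_trans; rewrite mulr_ge0 // ltW. Qed.

(** Logarithmic form of the stopping rule [inF] for the part of a path that follows [zeta]; the
    threshold will be [x = - ln t - len zeta]. The strict inequality excludes the empty path. *)
Definition Fin (u : V) (x : R) (s : seq T) : bool :=
  lpath u s && (len (take (size s).-1 s) < x <= len s).

Lemma Fin_path u x s : Fin u x s -> lpath u s.
Proof. by case/andP. Qed.

Lemma Fin_ge u x s : Fin u x s -> x <= len s.
Proof. by case/and3P. Qed.

Lemma Fin_neq0 u x s : Fin u x s -> s <> [::].
Proof. by move=> /and3P[_ + +] s0; rewrite s0 /= => /lt_le_trans h /h; rewrite ltxx. Qed.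

Lemma len_belast s : s <> [::] -> all (mem EL) s ->
  len s <= len (take (size s).-1 s) + lmax.
Proof.
case/lastP: s => // s e _; rewrite all_rcons => /andP[eE sE].
rewrite size_rcons -cats1 take_size_cat // len_cat lerD2l /len big_seq1.
by have /andP[] := lwP eE.
Qed.

Lemma Fin_le u x s : Fin u x s -> len s <= x + lmax.
Proof.
move=> Fs; have := len_belast (Fin_neq0 Fs) (lpath_EL (Fin_path Fs)).
case/and3P: Fs => _ h _; lra.
Qed.

Lemma Fin_cut u x s : lpath u s -> 0 < x <= len s ->
  exists s1 s2, s = s1 ++ s2 /\ Fin u x s1.
Proof.
elim/last_ind: s => [|s e IH].
  by move=> _; rewrite /len big_nil => /andP[/lt_le_trans h /h]; rewrite ltxx.
move=> ps /andP[x0 xl]; have [xs|xs] := leP x (len s).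
  have ps' : lpath u s by move: ps; rewrite -cats1 lpath_cat => /andP[].
  have [|s1 [s2 [-> F1]]] := IH ps'; first by rewrite x0.
  by exists s1, (rcons s2 e); rewrite rcons_cat.
exists (rcons s e), [::]; rewrite cats0; split=> //.
by rewrite /Fin ps xl size_rcons /= -cats1 take_size_cat // xs.
Qed.

Lemma cat_prefix (s1 t1 s2 t2 : seq T) : s1 ++ t1 = s2 ++ t2 ->
  (size s1 <= size s2)%N -> exists t, s2 = s1 ++ t.
Proof.
move=> E le; exists (drop (size s1) s2).
have <- : take (size s1) s2 = s1.
  by rewrite -(takel_cat t2) // -E take_size_cat.
by rewrite size_takel ?cat_take_drop // size_take_min; lia.
Qed.

(** Stopped paths are prefix-free, since a proper extension has reached length [x] before its last
    edge. This is what allows concatenations to be decoded. *)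
Lemma Fin_uniq u x s1 s2 t1 t2 : Fin u x s1 -> Fin u x s2 ->
  s1 ++ t1 = s2 ++ t2 -> s1 = s2.
Proof.
wlog le : s1 s2 t1 t2 / (size s1 <= size s2)%N.
  move=> H F1 F2 E; have [le|/ltnW le] := leqP (size s1) (size s2).
    exact: (H _ _ _ _ le F1 F2 E).
  by apply/esym; apply: (H _ _ _ _ le F2 F1 (esym E)).
move=> F1 F2 E; have [t E2] := cat_prefix E le.
case/lastP: t E2 => [|t e] E2; first by rewrite cats0 in E2.
exfalso; case/and3P: F2 => p2 + _; rewrite E2 -cats1 catA size_cat /= addn1 /=.
rewrite take_size_cat // len_cat => lt.
have : all (mem EL) t.
  move: (lpath_EL p2); rewrite E2 -cats1 !all_cat; by case/and3P.
move=> /len_ge0 t0; case/and3P: F1 => _ _; lra.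
Qed.

Lemma len_prefix_lt u s1 s2 t1 t2 : lpath u (s1 ++ t1) -> s1 ++ t1 = s2 ++ t2 ->
  len s1 < len s2 -> exists t, s2 = s1 ++ t.
Proof.
move=> ps E lt; apply: (cat_prefix E).
have [//|/ltnW le] := leqP; have [t E2] := cat_prefix (esym E) le.
have : all (mem EL) t by move: (lpath_EL ps); rewrite E2 !all_cat => /andP[/andP[]].
by move=> /len_ge0; move: lt; rewrite E2 len_cat; lra.
Qed.

Lemma path_extend u s (x : R) : VL u -> lpath u s ->
  exists t, lpath u (s ++ t) /\ x <= len (s ++ t).
Proof.
move=> uV ps.
have [n nx] : exists n : nat, x <= lmin * n%:R.
  exists (Num.truncn (`|x| / lmin)).+1.
  have := truncnS_gt (`|x| / lmin); rewrite ltr_pdivrMr // mulrC => /ltW.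
  by apply: le_trans; rewrite ler_norm.
have [t [pt st]] : exists t, lpath u (s ++ t) /\ (n <= size t)%N.
  elim: n {nx} => [|n [t [pt st]]]; first by exists [::]; rewrite cats0.
  have [e eE se] := VLout (lend_VL uV pt).
  exists (rcons t e); rewrite size_rcons ltnS st -cats1 catA lpath_cat pt /=.
  by rewrite eE se eqxx.
exists t; split=> //; apply: (le_trans nx).
apply: le_trans (len_ge (lpath_EL pt)).
by apply: ler_wpM2l; [exact: ltW|rewrite ler_nat size_cat; lia].
Qed.

(** All edges but the last have total length below [x], and each has length at least [lmin]; this
    bounds the number of edges, so that [F] can be an explicit finite list. *)
Definition maxsize (x : R) : nat := (Num.truncn (x / lmin)).+2.

Definition F (u : V) (x : R) : seq (seq T) :=
  [seq s <- words EL (maxsize x) | Fin u x s].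

Lemma Fin_size u x s : Fin u x s -> (size s <= maxsize x)%N.
Proof.
move=> Fs; have := Fin_neq0 Fs; move: Fs; case/lastP: s => // s e.
rewrite /Fin size_rcons /= -cats1 take_size_cat // => /and3P[/lpath_EL].
rewrite all_cat => /andP[/len_ge sl _] sx _ _.
have xl : (size s)%:R < x / lmin by rewrite ltr_pdivlMr // mulrC (le_lt_trans sl).
rewrite /maxsize ltnS; apply/ltnW; rewrite -(ltr_nat R).
exact: lt_trans xl (truncnS_gt _).
Qed.

Lemma mem_F u x s : (s \in F u x) = Fin u x s.
Proof.
rewrite mem_filter mem_words; case Fs: (Fin u x s) => //.
by rewrite (lpath_EL (Fin_path Fs)) (Fin_size Fs).
Qed.

Lemma uniq_F u x : uniq (F u x).
Proof. by rewrite filter_uniq // uniq_words. Qed.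

Lemma Fin_exists u x : VL u -> 0 < x -> exists s, Fin u x s.
Proof.
move=> uV x0; have [t [/= pt xt]] := @path_extend u [::] x uV isT.
have xt' : 0 < x <= len t by rewrite x0.
by have [s [_ [_ Fs]]] := Fin_cut pt xt'; exists s.
Qed.

(** * Pressure *)

Variables (nc : seq T -> R) (H : seq (seq T)) (CH : R).
Hypothesis irr : forall u v s1 s2, VL u -> VL v -> lpath u s1 -> lpath v s2 ->
  s1 <> [::] -> s2 <> [::] -> exists2 g, g \in H &
    lpath u (s1 ++ g ++ s2) /\ `|nc (s1 ++ g ++ s2) - nc s1 - nc s2| <= CH.

(* [c s] stands for [- ln (rho (zeta ++ s))] with [zeta] a rooted path ending at [u]. *)
Record base (u : V) (c : seq T -> R) : Prop := Base {
  base_VL : VL u;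
  base_cmp : exists C, forall s, lpath u s -> s <> [::] -> `|c s - nc s| <= C;
  base_ge0 : forall s, lpath u s -> 0 <= c s;
  base_mono : forall s t, lpath u (s ++ t) -> c s <= c (s ++ t);
  base_lin : exists B, forall s, lpath u s -> c s <= B * ((size s)%:R + 1) }.

Definition Y (u : V) (c : seq T -> R) (q x : R) : R :=
  \sum_(s <- F u x) expR (- (q * c s)).

Lemma lmax_ge0 u : VL u -> 0 <= lmax.
Proof. by move=> /VLout[e /lwP/andP[a b] _]; move: lmin0; lra. Qed.

Lemma len_H_bound : exists2 LH, 0 <= LH &
  forall g, g \in H -> len g <= LH.
Proof.
exists (\sum_(g <- H) `|len g|); first exact: sumr_ge0.
move=> g gH; rewrite (big_rem g gH) /=.
have : 0 <= \sum_(y <- rem g H) `|len y| by exact: sumr_ge0.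
by have := ler_norm (len g); lra.
Qed.

(** Costs relative to different prefixes differ from [nc] by bounded amounts, so irreducibility
    passes to them. Allowing two bases at once is what makes the pressure independent of the
    prefix. *)
Lemma base_join u1 c1 u2 c2 : base u1 c1 -> base u2 c2 ->
  exists2 C, 0 <= C & forall s1 s2, lpath u1 s1 -> lpath u2 s2 ->
    s1 <> [::] -> s2 <> [::] -> exists2 g, g \in H &
    lpath u1 (s1 ++ g ++ s2) /\ `|c1 (s1 ++ g ++ s2) - c1 s1 - c2 s2| <= C.
Proof.
move=> b1 b2; have [C1 h1] := base_cmp b1; have [C2 h2] := base_cmp b2.
exists (`|C1| + `|C1| + `|C2| + `|CH|).
  by rewrite !addr_ge0.
move=> s1 s2 p1 p2 n1 n2.
have [g gH [pg hg]] := irr (base_VL b1) (base_VL b2) p1 p2 n1 n2.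
exists g => //; split=> //.
have ng : s1 ++ g ++ s2 <> [::] by case: (s1) n1.
move: (h1 _ p1 n1) (h2 _ p2 n2) (h1 _ pg ng) hg.
move: (ler_norm C1) (ler_norm C2) (ler_norm CH).
rewrite !ler_norml; lra.
Qed.

(** The map from pairs to stopped paths forgets only the connector. Once this is known,
    prefix-freeness recovers both factors, so the loss is bounded by the number of connectors. *)
Lemma supermult u1 c1 u2 c2 q : base u1 c1 -> base u2 c2 ->
  exists K k, 0 <= k /\ forall x y, 0 < x -> 0 < y ->
    Y u1 c1 q x * Y u2 c2 q y <= expR K * Y u1 c1 q (x + y + k).
Proof.
move=> b1 b2; have [C C0 hC] := base_join b1 b2.
have [C' C'0 hC'] := base_join b1 b1.
have [LH LH0 hLH] := len_H_bound.
have lm0 := lmax_ge0 (base_VL b1).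
(* Two overshoots of at most [lmax] and one connector of length at most [LH] keep the joined path
   strictly shorter than [x + y + k]. *)
pose k := 2 * lmax + LH + 1.
have k0 : 0 < k by rewrite /k; lra.
(* A fixed tail of length at least [k]: appended to a joined path it brings the length to
   [x + y + k] or beyond, at bounded extra cost. *)
have [th [/= pth kth]] := @path_extend u1 [::] k (base_VL b1) isT.
have nth : th <> [::] by move=> th0; move: kth k0; rewrite th0 /len big_nil; lra.
have cth0 := base_ge0 b1 pth.
pose K1 := C + C' + c1 th.
exists (`|q| * K1 + ln (size H).+1%:R), k; split; first exact: ltW.
move=> x y x0 y0.
pose A := [seq (a, b) | a <- F u1 x, b <- F u2 y].
have HA : forall p, exists z : seq T * seq T, p \in A ->
    [/\ z.1 \in F u1 (x + y + k), z.2 \in H,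
        exists t, z.1 = p.1 ++ z.2 ++ p.2 ++ t &
        `|c1 z.1 - c1 p.1 - c2 p.2| <= K1].
  move=> [s1 s2]; have [pA|npA] := boolP ((s1, s2) \in A); last by exists ([::], [::]).
  have /allpairsP[[a b] /= [aF bF [e1 e2]]] := pA; subst a b.
  rewrite !mem_F in aF bF.
  have [p1 p2] := (Fin_path aF, Fin_path bF).
  have [n1 n2] := (Fin_neq0 aF, Fin_neq0 bF).
  have [g gH [pg hg]] := hC _ _ p1 p2 n1 n2.
  have ng : s1 ++ g ++ s2 <> [::] by case: (s1) n1.
  have [g' gH' [pg' hg']] := hC' _ _ pg pth ng nth.
  have lg := hLH _ gH.
  have Eg : len (s1 ++ g ++ s2) < x + y + k.
    rewrite !len_cat; have := Fin_le aF; have := Fin_le bF; rewrite /k; lra.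
  have lg'0 : 0 <= len g'.
    by apply: len_ge0; move: (lpath_EL pg'); rewrite !all_cat => /and3P[_ ->].
  have lg0 : 0 <= len g.
    by apply: len_ge0; move: (lpath_EL pg); rewrite !all_cat => /and3P[_ ->].
  have lw' : 0 < x + y + k <= len ((s1 ++ g ++ s2) ++ g' ++ th).
    rewrite !len_cat; have := Fin_ge aF; have := Fin_ge bF.
    by move: x0 y0 k0 kth lg0 lg'0; lra.
  have [om [t [E Fo]]] := Fin_cut pg' lw'.
  have [|t' Et'] := @len_prefix_lt u1 _ _ _ _ pg' E.
    by apply: lt_le_trans Eg _; apply: Fin_ge Fo.
  exists (om, g) => _; split=> //=.
  - by rewrite mem_F.
  - by exists t'; rewrite Et' -!catA.
  - have po := Fin_path Fo.
    have m1 : c1 (s1 ++ g ++ s2) <= c1 om.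
      by rewrite Et'; apply: (base_mono b1); rewrite -Et'.
    have m2 : c1 om <= c1 ((s1 ++ g ++ s2) ++ g' ++ th).
      by rewrite E; apply: (base_mono b1); rewrite -E.
    by move: hg hg' m1 m2 C0 C'0; rewrite /K1 !ler_norml; lra.
have [f fP] := choice HA.
pose h := fun z : seq T * seq T => expR (`|q| * K1) * expR (- (q * c1 z.1)).
have -> : Y u1 c1 q x * Y u2 c2 q y =
    \sum_(p <- A) expR (- (q * c1 p.1)) * expR (- (q * c2 p.2)).
  rewrite /Y /A mulr_suml big_allpairs_dep /=; apply: eq_bigr => a _.
  by rewrite mulr_sumr.
apply: (@le_trans _ _ (\sum_(z <- [seq (a, b) | a <- F u1 (x + y + k), b <- H]) h z)).
  apply: (@ler_sum_inj _ _ _ _ _ f).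
  - by apply: allpairs_uniq; [exact: uniq_F|exact: uniq_F|move=> [a b] [a' b']].
  (* Cutting the common word at [x] determines [s1]; after removal of the common connector, cutting
     the rest at [y] determines [s2]. *)
  - move=> [s1 s2] [s1' s2'] p1 p2 ef.
    have [_ _ [t Et] _] := fP _ p1; have [_ _ [t' Et'] _] := fP _ p2.
    move: Et' Et; rewrite -ef => -> /= Et.
    case/allpairsP: p1 => [[a b] /= [aF bF [e1 e2]]]; subst a b.
    case/allpairsP: p2 => [[a b] /= [aF' bF' [e1 e2]]]; subst a b.
    rewrite !mem_F in aF bF aF' bF'.
    have e1 := Fin_uniq aF' aF Et; subst s1'.
    move/(congr1 (drop (size s1))): Et; rewrite !drop_size_cat //.
    move/(congr1 (drop (size (f (s1, s2)).2))); rewrite !drop_size_cat // => Et.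
    by rewrite (Fin_uniq bF' bF Et).
  - move=> a /fP[h1 h2 _ _]; apply/allpairsP; exists (f a); split=> //.
    by case: (f a).
  - move=> a /fP[_ _ _ h4]; rewrite /h -!expRD ler_expR.
    have : `|q * (c1 (f a).1 - c1 a.1 - c2 a.2)| <= `|q| * K1.
      by rewrite normrM ler_wpM2l.
    by rewrite ler_norml; lra.
  - by move=> b; rewrite /h mulr_ge0 ?expR_ge0.
rewrite big_allpairs_dep /h /= expRD lnK ?posrE ?ltr0n // /Y mulr_sumr.
apply: ler_sum => s _; rewrite big_const_seq count_predT iter_addr_0.
by rewrite -[leLHS]mulr_natr mulrAC ler_wpM2r ?expR_ge0 // ler_wpM2l ?expR_ge0 // ler_nat.
Qed.

Lemma Y_gt0 u c q x : base u c -> 0 < x -> 0 < Y u c q x.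
Proof.
move=> b x0; have [s Fs] := Fin_exists (base_VL b) x0.
have sF : s \in F u x by rewrite mem_F.
rewrite /Y (big_rem s sF) /= ltr_pwDl ?expR_gt0 // sumr_ge0 //.
Qed.

Lemma size_F u x : (size (F u x) <= (size EL).+1 ^ maxsize x)%N.
Proof.
apply: leq_trans (size_words EL (maxsize x)).
by rewrite uniq_leq_size ?uniq_F // => s; rewrite mem_filter => /andP[].
Qed.

Lemma maxsize_le x : 1 <= x -> (maxsize x)%:R + 1 <= (lmin^-1 + 3) * x.
Proof.
move=> x1; rewrite /maxsize -!natr1.
have xl : 0 <= x / lmin by rewrite divr_ge0 // ltW //; lra.
have : (Num.truncn (x / lmin))%:R <= x / lmin by rewrite truncn_le.
by rewrite mulrDl [lmin^-1 * x]mulrC; lra.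
Qed.

Lemma cost_F_le u c : base u c -> exists2 B, 0 <= B &
  forall x s, 1 <= x -> Fin u x s -> 0 <= c s <= B * x.
Proof.
move=> b; have [B hB] := base_lin b.
exists (`|B| * (lmin^-1 + 3)); first by rewrite mulr_ge0 // addr_ge0 // invr_ge0 ltW.
move=> x s x1 Fs; have ps := Fin_path Fs.
rewrite (base_ge0 b ps) /=; apply: le_trans (hB _ ps) _.
apply: (@le_trans _ _ (`|B| * ((size s)%:R + 1))).
  by rewrite ler_wpM2r ?ler_norm // addr_ge0.
rewrite -mulrA ler_wpM2l //; apply: le_trans (maxsize_le x1).
by rewrite lerD2r ler_nat; apply: Fin_size Fs.
Qed.

(** There are at most exponentially many stopped paths and their costs are at most linear in [x];
    for the lower bound a single path is enough. *)
Lemma lnY_bound u c q : base u c -> exists A, forall x, 1 <= x ->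
  `|ln (Y u c q x)| <= A * x.
Proof.
move=> b; have [B B0 hB] := cost_F_le b.
pose L := ln (size EL).+1%:R : R.
have L0 : 0 <= L by rewrite ln_ge0 // ler1n.
have li : 0 <= lmin^-1 + 3 by rewrite addr_ge0 // invr_ge0 ltW.
exists (L * (lmin^-1 + 3) + `|q| * B) => x x1.
have x0 : 0 < x by lra.
have Y0 := Y_gt0 q b x0.
have qc s : Fin u x s -> `|- (q * c s)| <= `|q| * B * x.
  move=> Fs; rewrite normrN normrM -mulrA ler_wpM2l //.
  by have /andP[c0] := hB x s x1 Fs; rewrite ger0_norm.
have Lx0 : 0 <= L * (lmin^-1 + 3) * x by rewrite !mulr_ge0 // ltW.
rewrite ler_norml mulrDl; apply/andP; split.
  have [s Fs] := Fin_exists (base_VL b) x0.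
  have sF : s \in F u x by rewrite mem_F.
  apply: (@le_trans _ _ (- (q * c s))).
    by have := qc s Fs; rewrite ler_norml; lra.
  rewrite -ler_expR lnK ?posrE // /Y (big_rem s sF) /= lerDl sumr_ge0 // => *.
rewrite -ler_expR lnK ?posrE //.
apply: (@le_trans _ _ (\sum_(s <- F u x) expR (`|q| * B * x))).
  rewrite /Y big_seq [leRHS]big_seq; apply: ler_sum => s; rewrite mem_F => /qc.
  by rewrite ler_expR; apply: le_trans (ler_norm _).
rewrite big_const_seq count_predT iter_addr_0 -[leLHS]mulr_natr expRD mulrC.
rewrite ler_wpM2r ?expR_ge0 //.
apply: (@le_trans _ _ (((size EL).+1 ^ maxsize x)%:R)).
  by rewrite ler_nat size_F.
rewrite natrX -[X in X ^+ _]lnK ?posrE ?ltr0n // -expRM_natl ler_expR -/L.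
rewrite [leRHS]mulrAC -[leRHS]mulrA mulrC ler_wpM2l //.
by have := maxsize_le x1; rewrite [_ * x]mulrC mulrC; lra.
Qed.

(* [tau q] is minus the exponential growth rate of [Y _ _ q], which
   supermultiplicativity makes independent of the base. *)
Lemma pressure : exists tau : R -> R, forall u c, base u c -> forall q eps, 0 < eps ->
  exists X, forall x, X <= x -> `|ln (Y u c q x) + tau q * x| <= eps * x.
Proof.
have lnsup u1 c1 u2 c2 q : base u1 c1 -> base u2 c2 ->
    exists K k, 0 <= k /\ forall x y, 0 < x -> 0 < y ->
    ln (Y u1 c1 q x) + ln (Y u2 c2 q y) <= K + ln (Y u1 c1 q (x + y + k)).
  move=> b1 b2; have [K [k [k0 h]]] := supermult q b1 b2.
  exists K, k; split=> // x y x0 y0.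
  have Y1 := Y_gt0 q b1 x0; have Y2 := Y_gt0 q b2 y0.
  have Y3 : 0 < Y u1 c1 q (x + y + k) by apply: Y_gt0 => //; lra.
  rewrite -lnM ?posrE // -[K]expRK -lnM ?posrE ?expR_gt0 //.
  by rewrite ler_ln ?posrE ?mulr_gt0 ?expR_gt0 // h.
have lim1 u c q : base u c -> exists S, forall eps, 0 < eps -> exists X, forall x,
    X <= x -> `|ln (Y u c q x) - S * x| <= eps * x.
  move=> b; have [K [k [k0 h]]] := lnsup _ _ _ _ q b b.
  have [A hA] := lnY_bound q b.
  (* Subtracting [K] absorbs the multiplicative constant and gives exact superadditivity with gap
     [k]. *)
  have [||S hS] := @fekete R (fun x => ln (Y u c q x) - K) k (A + `|K|) k0.
  - by move=> x y x0 y0; have := h x y x0 y0; lra.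
  - move=> x x1; apply: le_trans (ler_normB _ _) _; rewrite mulrDl lerD ?hA //.
    by rewrite ler_peMr.
  exists S => e e0; have [X hX] := hS (e / 2) ltac:(lra).
  exists (Num.max X (2 * `|K| / e)) => x; rewrite ge_max => /andP[/hX].
  rewrite ler_pdivrMr // !ler_norml; have := ler_norm K; have := ler_norm (- K).
  rewrite normrN; lra.
(* Length [1] over the first base and a large length over the second compare the two growth rates;
   exchanging the roles gives equality. *)
have le1 u1 c1 u2 c2 q S1 S2 : base u1 c1 -> base u2 c2 ->
  (forall eps, 0 < eps -> exists X, forall x, X <= x -> `|ln (Y u1 c1 q x) - S1 * x| <= eps * x) ->
  (forall eps, 0 < eps -> exists X, forall x, X <= x -> `|ln (Y u2 c2 q x) - S2 * x| <= eps * x) ->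
  S2 <= S1.
  move=> b1 b2 h1 h2; apply/ler_addgt0Pr => e e0.
  have [X1 hX1] := h1 (e / 3) ltac:(lra).
  have [X2 hX2] := h2 (e / 3) ltac:(lra).
  have [K [k [k0 h]]] := lnsup _ _ _ _ q b1 b2.
  pose Z := ln (Y u1 c1 q 1).
  pose B := `|K| + `|Z| + (`|S1| + e) * (1 + k).
  pose y := 1 + `|X1| + `|X2| + 3 * B / e.
  have B0 : 0 <= B by rewrite /B !addr_ge0 // mulr_ge0 // ?addr_ge0 //; lra.
  have Be0 : 0 <= 3 * B / e by rewrite divr_ge0 ?mulr_ge0 // ltW.
  have [n1 n2] := (normr_ge0 X1, normr_ge0 X2).
  have [y1 y2 y3 y4] : [/\ 1 <= y, X2 <= y, X1 <= 1 + y + k & 3 * B / e <= y].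
    have := ler_norm X1; have := ler_norm X2.
    by rewrite /y; move: (3 * B / e) Be0 => b b0; split; lra.
  have := h 1 y ltac:(lra) ltac:(lra); have := hX1 _ y3; have := hX2 _ y2.
  rewrite !ler_norml -/Z.
  move: y4; rewrite ler_pdivrMr // => yB.
  have : S1 * (1 + k) <= `|S1| * (1 + k) by rewrite ler_wpM2r ?ler_norm //; lra.
  have := ler_norm K; have := ler_norm (- Z); rewrite normrN.
  move: yB; rewrite /B; clearbody Z y => *.
  have : y * (S2 - S1 - e) <= 0 by nra.
  rewrite pmulr_rle0; lra.
have /choice[tau htau] : forall q, exists t, forall u c, base u c -> forall eps, 0 < eps ->
    exists X, forall x, X <= x -> `|ln (Y u c q x) + t * x| <= eps * x.
  move=> q; have [[u [c b]]|nb] := pselect (exists u c, base u c); last first.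
    by exists 0 => u c b; exfalso; apply: nb; exists u, c.
  have [S hS] := lim1 u c q b; exists (- S) => u' c' b'.
  have [S' hS'] := lim1 u' c' q b'.
  have -> : S = S'.
    by apply/eqP; rewrite eq_le (le1 u' c' u c q) // (le1 u c u' c' q).
  by move=> e /hS'[X hX]; exists X => x /hX; rewrite mulNr.
by exists tau => u c b q; apply: htau.
Qed.

(** * Blocks of prescribed cost *)

Variable tau : R -> R.
Hypothesis tauP : forall u c, base u c -> forall q eps, 0 < eps ->
  exists X, forall x, X <= x -> `|ln (Y u c q x) + tau q * x| <= eps * x.

Variables (u : V) (c : seq T -> R).
Hypothesis bP : base u c.

Lemma cost_class (L : R) : (forall x s, 1 <= x -> Fin u x s -> 0 <= c s <= L * x) ->
  forall q e, 0 < e -> exists2 X, 1 <= X & forall l, X <= l -> exists a A,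
    [/\ 0 <= a <= L, uniq A, {subset A <= F u l},
        forall s, s \in A -> `|c s - a * l| <= e * l &
        (0 < size A)%N /\ l * (q * a - tau q - e) <= ln (size A)%:R].
Proof.
move=> hL q e e0.
have L0 : 0 <= L.
  have [s Fs] := Fin_exists (base_VL bP) (@ltr01 R).
  by have := hL 1 s (lexx _) Fs; rewrite mulr1 => /andP[]; apply: le_trans.
(* Inside a cost class of width [d * l] the exponent [q * c s] varies by at most [e / 2 * l]. The
   remaining half of the error is shared by the pressure and by [ln J], where the number [J] of
   classes does not depend on [l]. *)
pose d := e / (2 * (1 + `|q|)).
have q1 : 0 < 1 + `|q| by rewrite ltr_wpDr.
have d0 : 0 < d by rewrite divr_gt0 // mulr_gt0.
have qd : `|q| * d <= e / 2.
  have -> : e / 2 = (1 + `|q|) * d by rewrite /d; field; rewrite gt_eqF.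
  by rewrite ler_wpM2r ?ltW //; lra.
have de : d <= e.
  have -> : e = 2 * (1 + `|q|) * d by rewrite /d; field; rewrite gt_eqF.
  rewrite ler_peMl ?ltW //; have := normr_ge0 q; lra.
pose J := (Num.truncn (L / d)).+1.
have [X hX] := tauP bP q (ltac:(lra) : 0 < e / 4).
exists (Num.max 1 (Num.max X (4 * ln J%:R / e))); first by rewrite le_max lexx.
move=> l; rewrite !ge_max => /and3P[l1 /hX hl lJ].
have l0 : 0 < l by lra.
have dl0 : 0 < d * l by rewrite mulr_gt0.
pose j s := Num.truncn (c s / (d * l)).
have jP s : Fin u l s -> (j s)%:R * (d * l) <= c s < ((j s)%:R + 1) * (d * l).
  move=> Fs; have /andP[c0 _] := hL l s l1 Fs.
  have cd : 0 <= c s / (d * l) by rewrite divr_ge0 // ltW.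
  rewrite -ler_pdivlMr // -ltr_pdivrMr //.
  by rewrite /j truncn_le cd /= natr1 truncnS_gt.
have jJ s : Fin u l s -> (j s < J)%N.
  move=> Fs; rewrite /J ltnS /j le_truncn //.
  rewrite ler_pdivrMr // mulrA divfK ?gt_eqF //.
  by have /andP[] := hL l s l1 Fs.
pose Aj i := [seq s <- F u l | j s == i].
have YJ : Y u c q l <= \sum_(i <- iota 0 J) \sum_(s <- Aj i) expR (- (q * c s)).
  rewrite sum_pairs_dep.
  rewrite /Y; apply: (@ler_sum_inj _ _ _ _ _ (fun s => (j s, s))).
  - exact: uniq_F.
  - by move=> s s' _ _ [].
  - move=> s sF; apply/allpairsPdep; exists (j s), s; split=> //.
      by rewrite mem_iota /= jJ // -mem_F.
    by rewrite mem_filter eqxx.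
  - by [].
  - by move=> z; exact: expR_ge0.
have Y0 := Y_gt0 q bP l0.
have [||i iJ hi] := @pigeonhole_sum R _ (iota 0 J)
    (fun i => \sum_(s <- Aj i) expR (- (q * c s))) (Y u c q l / J%:R).
- by rewrite size_iota.
- by rewrite size_iota divfK ?pnatr_eq0.
have AF : {subset Aj i <= F u l} by move=> s; rewrite mem_filter => /andP[].
have cA s : s \in Aj i -> i%:R * (d * l) <= c s < (i%:R + 1) * (d * l).
  by rewrite mem_filter mem_F => /andP[/eqP <-] /jP.
have sA : (0 < size (Aj i))%N.
  rewrite lt0n; apply: contraTneq hi => /size0nil ->.
  by rewrite big_nil -ltNge divr_gt0 // ltr0n.
exists (i%:R * d), (Aj i); split.
- have [s sA'] : exists s, s \in Aj i.
    by case: (Aj i) sA => // s A _; exists s; rewrite mem_head.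
  apply/andP; split; first by apply: mulr_ge0 => //; exact: ltW.
  rewrite -(ler_pM2r l0) -mulrA.
  have /andP[h1 _] := cA s sA'; apply: (le_trans h1).
  by have := AF s sA'; rewrite mem_F => /(hL l s l1)/andP[].
- by rewrite filter_uniq // uniq_F.
- exact: AF.
- move=> s /cA; rewrite mulrDl mul1r => h.
  have del : d * l <= e * l by rewrite ler_wpM2r // ltW.
  move: h del dl0; rewrite -mulrA ler_norml; move: (d * l) (e * l) => x y.
  by move: (_ * x) => z; lra.
- split=> //.
  have h2 : \sum_(s <- Aj i) expR (- (q * c s)) <=
      (size (Aj i))%:R * expR (`|q| * d * l - q * (i%:R * d) * l).
    apply: (@le_trans _ _ (\sum_(s <- Aj i) expR (`|q| * d * l - q * (i%:R * d) * l))).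
      rewrite big_seq [leRHS]big_seq; apply: ler_sum => s /cA h.
      rewrite ler_expR.
      have : `|q * (c s - i%:R * d * l)| <= `|q| * d * l.
        rewrite normrM -[leRHS]mulrA ler_wpM2l // ler_norml -mulrA.
        by move: h dl0; rewrite mulrDl mul1r; move: (d * l) => y; move: (_ * y) => x; lra.
      by rewrite ler_norml; lra.
    by rewrite big_const_seq count_predT iter_addr_0 -[leLHS]mulr_natl.
  have h3 := le_trans hi h2.
  have J0 : 0 < J%:R :> R by rewrite ltr0n.
  have h4 : ln (Y u c q l / J%:R) <=
     ln ((size (Aj i))%:R * expR (`|q| * d * l - q * (i%:R * d) * l)).
    rewrite ler_ln ?posrE //; first exact: divr_gt0.
    by rewrite mulr_gt0 ?ltr0n ?expR_gt0.
  move: h4; rewrite ln_div ?posrE // lnM ?posrE ?ltr0n ?expR_gt0 // expRK.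
  move: lJ; rewrite ler_pdivrMr // => lJ.
  move: hl; rewrite ler_norml => /andP[hl _] h4.
  have : `|q| * d * l <= e / 2 * l by rewrite ler_wpM2r // ltW.
  by move: (ln J%:R) (ln (size (Aj i))%:R) lJ h4 => lnJ lnA lJ h4; clearbody d; lra.
Qed.

(** Uniformity over all starting paths is what allows extensions to be iterated. The prefix-free
    condition makes their cylinders disjoint and, through [dist_sep], separated. *)
Definition ext (M : nat) (l1 l2 x1 x2 : R) : Prop :=
  forall s, lpath u s -> s <> [::] -> exists cs : seq (seq T),
    [/\ size cs = M, uniq cs,
        forall s', s' \in cs -> [/\ exists t, s' = s ++ t, lpath u s',
          l1 <= len s' - len s <= l2 & x1 <= c s' - c s <= x2] &
        forall a b t, a \in cs -> b \in cs -> b = a ++ t -> a = b].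

(** If two words of the second generation are comparable, their parents are prefixes of one word,
    hence comparable and so equal; prefix-freeness is thus inherited. *)
Lemma ext_comp M M' l1 l2 x1 x2 l1' l2' x1' x2' :
  ext M l1 l2 x1 x2 -> ext M' l1' l2' x1' x2' ->
  ext (M * M') (l1 + l1') (l2 + l2') (x1 + x1') (x2 + x2').
Proof.
move=> E E' s ps ns; have [cs [szc uc hc incc]] := E s ps ns.
have /choice[f fP] : forall s1, exists ds : seq (seq T), s1 \in cs ->
    [/\ size ds = M', uniq ds,
        forall s', s' \in ds -> [/\ exists t, s' = s1 ++ t, lpath u s',
          l1' <= len s' - len s1 <= l2' & x1' <= c s' - c s1 <= x2'] &
        forall a b t, a \in ds -> b \in ds -> b = a ++ t -> a = b].
  move=> s1.
  have [s1c|] := boolP (s1 \in cs); last by exists [::].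
  have [[t Es1] ps1 _ _] := hc s1 s1c.
  have [|ds dsP] := E' s1 ps1; first by rewrite Es1; case: (s) ns.
  by exists ds.
have key a b t a1 b1 : a1 \in cs -> b1 \in cs -> a \in f a1 -> b \in f b1 ->
    b = a ++ t -> a1 = b1 /\ a = b.
  move=> a1c b1c af bf Eb.
  have [_ _ /(_ a af)[[ta Ea] _ _ _] _] := fP _ a1c.
  have [_ _ /(_ b bf)[[tb Eb'] _ _ _] _] := fP _ b1c.
  have e1 : a1 = b1.
    have E1 : a1 ++ (ta ++ t) = b1 ++ tb by rewrite -Eb' Eb Ea catA.
    have [le|/ltnW le] := leqP (size a1) (size b1).
      by have [t' E2] := cat_prefix E1 le; apply: (incc _ _ t').
    by have [t' E2] := cat_prefix (esym E1) le; apply/esym/(incc _ _ t').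
  split=> //; subst b1; have [_ _ _ incf] := fP _ a1c.
  by apply: (incf _ _ t).
exists [seq s2 | s1 <- cs, s2 <- f s1]; split.
- have -> : size [seq s2 | s1 <- cs, s2 <- f s1] = sumn [seq M' | _ <- cs].
    by rewrite size_allpairs_dep; congr sumn; apply/eq_in_map => s1 /fP[].
  by rewrite -szc; elim: (cs) => //= _ s0 ->; rewrite mulSn.
- apply: allpairs_uniq_dep => //; first by move=> s1 /fP[].
  move=> [a1 a] [b1 b] /allpairsPdep[x [y [xc yf [-> ->]]]].
  move=> /allpairsPdep[x' [y' [xc' yf' [-> ->]]]] /= e.
  by have [-> ->] := key y y' [::] _ _ xc xc' yf yf' (esym (etrans (cats0 _) e)).
- move=> s2 /allpairsPdep[s1 [y [s1c yf ->]]].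
  have [[t Et] p1 h1 h2] := hc _ s1c; have [_ _ /(_ y yf)[[t' Et'] p2 h3 h4] _] := fP _ s1c.
  split=> //; first by exists (t ++ t'); rewrite catA -Et.
  + by lra.
  + by lra.
- move=> a b t /allpairsPdep[a1 [y [a1c yf ->]]] /allpairsPdep[b1 [z [b1c zf ->]]] e.
  by have [] := key _ _ _ _ _ a1c b1c yf zf e.
Qed.

Lemma ext_iter M l1 l2 x1 x2 n : ext M l1 l2 x1 x2 ->
  ext (M ^ n) (n%:R * l1) (n%:R * l2) (n%:R * x1) (n%:R * x2).
Proof.
move=> E; elim: n => [|n IH].
  rewrite expn0 !mul0r => s ps ns; exists [:: s]; split=> //.
    move=> s'; rewrite inE => /eqP ->; rewrite !subrr lexx; split=> //.
    by exists [::]; rewrite cats0.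
  by move=> a b t; rewrite !inE => /eqP -> /eqP ->.
by rewrite expnS -nat1r !mulrDl !mul1r; apply: ext_comp.
Qed.

Lemma ext_le M l1 l2 x1 x2 l1' l2' x1' x2' :
  l1' <= l1 -> l2 <= l2' -> x1' <= x1 -> x2 <= x2' ->
  ext M l1 l2 x1 x2 -> ext M l1' l2' x1' x2'.
Proof.
move=> h1 h2 h3 h4 E s ps ns; have [cs [h5 h6 h7 h8]] := E s ps ns.
exists cs; split=> // s' /h7[e1 e2 e3 e4]; split=> //; lra.
Qed.

(** The connector placed after [s] depends on the appended word, which may destroy prefix-freeness.
    Keeping only words that share one frequent connector restores it, and costs a bounded factor. *)
Lemma ext_class : exists2 C, 0 <= C & forall l A (x1 x2 : R),
  uniq A -> {subset A <= F u l} -> (0 < size A)%N ->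
  (forall s, s \in A -> x1 <= c s <= x2) ->
  exists M, [/\ (0 < M <= size A)%N, ext M l (l + C) (x1 - C) (x2 + C) &
     ln (size A)%:R - C <= ln M%:R].
Proof.
have [C0 C00 hC] := base_join bP bP.
have [LH LH0 hLH] := len_H_bound.
have lm0 := lmax_ge0 (base_VL bP).
pose h := (size H).+1.
have lnh : 0 <= ln (2 * h)%:R :> R by rewrite ln_ge0 // ler1n.
exists (C0 + (LH + lmax) + ln (2 * h)%:R); first by rewrite !addr_ge0.
move=> l A x1 x2 uA AF A0 hA.
(* The number of extensions must be the same for every [s], while the frequent connector is not. [M]
   is a size that some connector class always attains; [take M] discards the surplus. *)
pose M := maxn 1 (size A %/ h).
have MA : (size A <= 2 * h * M)%N.
  have := ltn_ceil (size A) (isT : (0 < h)%N); rewrite /M => lt.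
  by apply: (leq_trans (ltnW lt)); rewrite [(2 * h)%N]mulnC -mulnA mulnC leq_mul2l; lia.
exists M; split.
- by rewrite /M leq_max /= geq_max A0 leq_div.
- move=> s ps ns.
  have /choice[f fP] : forall a, exists g, a \in A -> g \in H /\
      (lpath u (s ++ g ++ a) /\ `|c (s ++ g ++ a) - c s - c a| <= C0).
    move=> a.
    have [aA|] := boolP (a \in A); last by exists [::].
    have := AF _ aA; rewrite mem_F => Fa.
    have [g gH gP] := hC _ _ ps (Fin_path Fa) ns (Fin_neq0 Fa).
    by exists g.
  have H0 : (0 < size H)%N.
    by case: A A0 fP {uA AF hA M MA} => // a A _ /(_ a (mem_head _ _))[]; case: (H).
  have HA : (size A)%:R <= \sum_(g <- H) (size [seq a <- A | f a == g])%:R :> R.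
    have sumE (r : seq (seq T)) : (size r)%:R = \sum_(a <- r) 1 :> R.
      by rewrite big_const_seq count_predT iter_addr_0.
    rewrite sumE; under [leRHS]eq_bigr do rewrite sumE.
    rewrite sum_pairs_dep.
    apply: (@ler_sum_inj _ _ _ _ _ (fun a => (f a, a))) => //.
      by move=> a a' _ _ [].
    move=> a aA; apply/allpairsPdep; exists (f a), a; split=> //.
      by have [] := fP a aA.
    by rewrite mem_filter eqxx.
  have [|g gH hg] := @pigeonhole_sum R _ H (fun g => (size [seq a <- A | f a == g])%:R)
      ((size A)%:R / (size H)%:R) H0.
    by rewrite divfK // pnatr_eq0 -lt0n.
  pose B := [seq a <- A | f a == g].
  have MB : (M <= size B)%N.
    rewrite /M geq_max; apply/andP; split.
      by rewrite -(ltr0n R); apply: lt_le_trans hg; rewrite divr_gt0 // ltr0n.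
    rewrite -(ler_nat R); apply: le_trans hg.
    rewrite ler_pdivlMr ?ltr0n // -natrM ler_nat.
    by apply: leq_trans (leq_divM _ h); rewrite leq_mul2l leqnSn orbT.
  exists (take M [seq s ++ g ++ a | a <- B]).
  have mB s' : s' \in take M [seq s ++ g ++ a | a <- B] ->
      exists a, [/\ a \in A, f a = g & s' = s ++ g ++ a].
    move=> /mem_take/mapP[a]; rewrite mem_filter => /andP[/eqP fa aA] ->.
    by exists a.
  split.
  + by rewrite size_takel // size_map.
  + apply: take_uniq; rewrite map_inj_in_uniq ?filter_uniq // => a a' _ _.
    move/(congr1 (drop (size s))); rewrite !drop_size_cat //.
    by move/(congr1 (drop (size g))); rewrite !drop_size_cat.
  + move=> s' /mB[a [aA fa ->]]; have [_] := fP a aA; rewrite fa => -[pg hg'].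
    split=> //; first by exists (g ++ a).
      have := AF _ aA; rewrite mem_F => Fa.
      have := Fin_ge Fa; have := Fin_le Fa; have := hLH _ gH.
      have : 0 <= len g.
        by apply: len_ge0; move: (lpath_EL pg); rewrite !all_cat => /and3P[_ ->].
      by rewrite !len_cat; move: C00 lnh lm0; lra.
    by move: hg' (hA a aA) C00 lnh lm0 LH0; rewrite ler_norml; lra.
  + move=> s1 s2 t /mB[a [aA fa ->]] /mB[a' [aA' fa' ->]].
    rewrite -!catA => /(congr1 (drop (size s))); rewrite !drop_size_cat //.
    move/(congr1 (drop (size g))); rewrite !drop_size_cat // => E.
    have := AF _ aA; have := AF _ aA'; rewrite !mem_F => F1 F2.
    by rewrite (@Fin_uniq u l a a' t [::]) // cats0.
- have M0 : (0 < M)%N by rewrite /M leq_max.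
  have : ln (size A)%:R <= ln (2 * h * M)%:R :> R.
    by rewrite ler_ln ?posrE ?ltr0n ?muln_gt0 ?M0 // ler_nat.
  rewrite natrM lnM ?posrE ?ltr0n // ; lra.
Qed.

(** The bounds [L] on the slope and [B] on the entropy are uniform in [q]; they confine the search
    for a crossing slope to a bounded range of [q]. *)
Lemma ext_pressure : exists L B : R, forall q e, 0 < e -> exists2 X, 1 <= X &
  forall l, X <= l -> exists a M, [/\ 0 <= a <= L, (0 < M)%N,
    ext M l (l * (1 + e)) (l * (a - e)) (l * (a + e)) &
    l * (q * a - tau q - e) <= ln M%:R <= l * B].
Proof.
have [L L0 hL] := cost_F_le bP.
have [C C0 hC] := ext_class.
pose B := ln (size EL).+1%:R * (lmin^-1 + 3) : R.
exists L, B => q e e0.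
have [X X1 hX] := cost_class hL q (ltac:(lra) : 0 < e / 2).
exists (Num.max X (2 * C / e)); first by rewrite le_max X1.
move=> l; rewrite ge_max => /andP[Xl]; rewrite ler_pdivrMr // => lC.
have l1 : 1 <= l by apply: le_trans X1 Xl.
have [a [A [aL uA AF cA [A0 hA]]]] := hX l Xl.
have [s|M [/andP[M0 MA] eM hM]] :=
  hC l A (a * l - e / 2 * l) (a * l + e / 2 * l) uA AF A0.
  by move/cA; rewrite ler_norml; lra.
exists a, M; split=> //.
  by apply: ext_le eM; lra.
apply/andP; split; first by lra.
apply: (@le_trans _ _ (ln ((size EL).+1 ^ maxsize l)%:R)).
  rewrite ler_ln ?posrE ?ltr0n ?expn_gt0 // ler_nat (leq_trans MA) //.
  by apply: leq_trans (size_F u l); apply: uniq_leq_size.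
rewrite natrX lnXn ?ltr0n // -[leLHS]mulr_natl mulrC mulrCA ler_wpM2l //.
  by rewrite ln_ge0 // ler1n.
by have := maxsize_le l1; rewrite [_ * l]mulrC; lra.
Qed.

Lemma discrete_crossing (P : pred nat) m : P 0%N -> ~~ P m ->
  exists k, [/\ (k < m)%N, P k & ~~ P k.+1].
Proof.
elim: m => [-> //|m IH] P0 Pm; have [Pm'|/IH[]// k [km h1 h2]] := boolP (P m).
  by exists m.
by exists k; split=> //; apply: ltnW.
Qed.

(** Both entropies are bounded below by the same affine function of the slope, with value [D] at
    [al]. Weights that average the slopes to [al] therefore yield entropy [D], up to rounding them
    to multiples of [1 / n]. *)
Lemma ext_mix (l al D q e : R) (a1 a2 : R) (M1 M2 : nat) :
  0 < l -> 0 < e -> a2 <= al <= a1 -> (0 < M1)%N -> (0 < M2)%N ->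
  ext M1 l (l * (1 + e)) (l * (a1 - e)) (l * (a1 + e)) ->
  ext M2 l (l * (1 + e)) (l * (a2 - e)) (l * (a2 + e)) ->
  l * (D + q * (a1 - al)) <= ln M1%:R ->
  l * (D + q * (a2 - al)) <= ln M2%:R ->
  exists (n : nat) (M : nat), [/\ (0 < n)%N, (0 < M)%N,
    ext M (n%:R * l) (n%:R * l * (1 + e)) (n%:R * l * (al - 2 * e)) (n%:R * l * (al + 2 * e)) &
    n%:R * l * (D - e) <= ln M%:R].
Proof.
move=> l0 e0 /andP[a2al a1al] M10 M20 E1 E2 h1 h2.
have [a12|a12] := eqVneq a1 a2.
  have ea : a1 = al by lra.
  exists 1%N, M1; rewrite !mul1r; split=> //.
    by apply: ext_le E1; nra.
  by apply: le_trans h1; rewrite ea subrr mulr0; nra.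
have d0 : 0 < a1 - a2 by rewrite subr_gt0 lt_neqAle eq_sym a12 //=; lra.
pose lam := (al - a2) / (a1 - a2).
have lamE : lam * (a1 - a2) = al - a2 by rewrite /lam divfK // gt_eqF.
have lam01 : 0 <= lam <= 1.
  apply/andP; split; first by apply: divr_ge0; lra.
  by rewrite /lam ler_pdivrMr // mul1r; lra.
pose n := (Num.truncn ((1 + `|q|) * (a1 - a2) / e)).+1.
have n0 : (0 < n)%N by [].
have nR0 : 0 < n%:R :> R by rewrite ltr0n.
have nbig : (1 + `|q|) * (a1 - a2) < n%:R * e.
  by rewrite -ltr_pdivrMr // truncnS_gt.
have q0 := normr_ge0 q.
have nb1 : a1 - a2 <= n%:R * e by nra.
have nb2 : `|q| * (a1 - a2) <= n%:R * e by nra.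
pose m1 := Num.truncn (lam * n%:R).
have lamn0 : 0 <= lam * n%:R by rewrite mulr_ge0 //; lra.
have m1P : m1%:R <= lam * n%:R < m1%:R + 1.
  by rewrite natr1 truncnS_gt truncn_le lamn0.
have m1n : (m1 <= n)%N.
  by rewrite -(ler_nat R); apply: le_trans (_ : lam * n%:R <= _); [lra|nra].
pose m2 := (n - m1)%N.
have m2E : m2%:R = n%:R - m1%:R :> R by rewrite natrB.
have EE := ext_comp (ext_iter m1 E1) (ext_iter m2 E2).
(* [dev] is the cost error due to rounding. It is at most [a1 - a2], and [n] was chosen so that
   this, even multiplied by the absolute value of [q], is at most [n%:R * e]. *)
pose dev := n%:R * al - (m1%:R * a1 + m2%:R * a2).
have devP : 0 <= dev <= a1 - a2.
  have -> : dev = (lam * n%:R - m1%:R) * (a1 - a2).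
    have -> : (lam * n%:R - m1%:R) * (a1 - a2) = n%:R * (lam * (a1 - a2)) - m1%:R * (a1 - a2).
      by ring.
    by rewrite lamE /dev m2E; ring.
  by apply/andP; split; nra.
exists n, (M1 ^ m1 * M2 ^ m2)%N; split=> //.
- by rewrite muln_gt0 !expn_gt0 M10 M20.
- have nE : n%:R = m1%:R + m2%:R :> R by rewrite m2E; ring.
  have nea : n%:R * al = m1%:R * a1 + m2%:R * a2 + dev by rewrite /dev; ring.
  have [dev0 devle] : 0 <= dev /\ dev <= n%:R * e by case/andP: devP => ? /le_trans->.
  have ldev : l * dev <= l * (n%:R * e) by apply: ler_wpM2l => //; exact: ltW.
  have ldev0 : 0 <= l * dev by apply: mulr_ge0 => //; exact: ltW.
  have x1E : n%:R * l * al = m1%:R * l * a1 + m2%:R * l * a2 + l * dev.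
    by rewrite mulrAC nea; ring.
  apply: ext_le EE.
  + by rewrite nE; lra.
  + by rewrite nE; lra.
  + have -> : n%:R * l * (al - 2 * e) = n%:R * l * al - 2 * (l * (n%:R * e)) by ring.
    have := mulr_ge0 (ltW l0) (mulr_ge0 (ltW nR0) (ltW e0)).
    have -> : m1%:R * (l * (a1 - e)) + m2%:R * (l * (a2 - e)) =
      m1%:R * l * a1 + m2%:R * l * a2 - l * (n%:R * e) by rewrite nE; ring.
    by rewrite x1E; lra.
  + have -> : n%:R * l * (al + 2 * e) = n%:R * l * al + 2 * (l * (n%:R * e)) by ring.
    have := mulr_ge0 (ltW l0) (mulr_ge0 (ltW nR0) (ltW e0)).
    have -> : m1%:R * (l * (a1 + e)) + m2%:R * (l * (a2 + e)) =
      m1%:R * l * a1 + m2%:R * l * a2 + l * (n%:R * e) by rewrite nE; ring.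
    by rewrite x1E; lra.
- rewrite natrM !natrX lnM ?posrE ?exprn_gt0 ?ltr0n // !lnXn ?ltr0n //.
  rewrite -[X in _ <= X + _]mulr_natl -[X in _ <= _ + X]mulr_natl.
  have H1 : m1%:R * (l * (D + q * (a1 - al))) <= m1%:R * ln M1%:R by rewrite ler_wpM2l.
  have H2 : m2%:R * (l * (D + q * (a2 - al))) <= m2%:R * ln M2%:R by rewrite ler_wpM2l.
  apply: le_trans (lerD H1 H2).
  have -> : m1%:R * (l * (D + q * (a1 - al))) + m2%:R * (l * (D + q * (a2 - al))) =
    n%:R * l * D - l * (q * dev) by rewrite /dev m2E; ring.
  have -> : n%:R * l * (D - e) = n%:R * l * D - l * (n%:R * e) by ring.
  rewrite lerD2l lerN2; apply: ler_wpM2l; first exact: ltW.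
  apply: le_trans (ler_norm _) _; rewrite normrM; apply: le_trans nb2.
  by rewrite ler_wpM2l // ger0_norm; lra.
Qed.

(* Legendre duality: on a fine grid of [q]'s the optimal cost [a] crosses [al], and the two
   blocks around the crossing are mixed. *)
Lemma ext_dual (al D : R) : (forall q, D <= q * al - tau q) ->
  forall e, 0 < e -> exists l M, [/\ 1 <= l, (0 < M)%N,
    ext M l (l * (1 + e)) (l * (al - e)) (l * (al + e)) & l * (D - e) <= ln M%:R].
Proof.
move=> hD e0' e0'0; pose e := e0' / 4; have e0 : 0 < e by rewrite /e; lra.
have ee : e0' = 4 * e by rewrite /e; lra.
clearbody e; subst e0'.
have [L [B hE]] := ext_pressure.
(* If the absolute value of [q] is at least [Q] and [q * (a - al) >= 0], the entropy bound [B]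
   forces [a] to be within [e] of [al]; a single block type is then enough. *)
pose Q := (`|B| + `|D| + e) / e.
(* The mesh of the grid: for a block of slope between [0] and [al], passing from [qk k.+1] to [qk k]
   lowers the entropy bound by at most [e] per unit length. *)
pose d := e / (`|L| + `|al| + 1).
have Ll0 : 0 < `|L| + `|al| + 1 by rewrite ltr_wpDl // addr_ge0.
have d0 : 0 < d by rewrite divr_gt0.
pose m := (Num.truncn (2 * Q / d)).+1.
have mQ : 2 * Q < m%:R * d by rewrite -ltr_pdivrMr // truncnS_gt.
pose qk k := - Q + k%:R * d.
(* The grid is finite, so one block length [X] serves all its points, as mixing requires. *)
have [X X1 hX] : exists2 X, 1 <= X & forall l, X <= l -> forall k, (k <= m)%N ->
    exists a M, [/\ 0 <= a <= L, (0 < M)%N,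
    ext M l (l * (1 + e)) (l * (a - e)) (l * (a + e)) &
    l * (qk k * a - tau (qk k) - e) <= ln M%:R <= l * B].
  elim: (m) => [|n [X X1 IH]].
    have [X X1 hX] := hE (qk 0%N) e e0.
    by exists X => // l /hX[a [M h]] k; rewrite leqn0 => /eqP ->; exists a, M.
  have [X' X1' hX] := hE (qk n.+1) e e0.
  exists (Num.max X X'); first by rewrite le_max X1.
  move=> l; rewrite ge_max => /andP[h1 h2] k; rewrite leq_eqVlt ltnS => /orP[/eqP ->|].
    exact: hX.
  exact: IH.
have {}hX := hX X (lexx _).
have {}hX k : exists p : R * nat, (k <= m)%N -> [/\ 0 <= p.1 <= L, (0 < p.2)%N,
    ext p.2 X (X * (1 + e)) (X * (p.1 - e)) (X * (p.1 + e)) &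
    X * (D + qk k * (p.1 - al) - e) <= ln p.2%:R <= X * B].
  case: (leqP k m) => [/hX[a [M [h1 h2 h3 h4]]]|]; last by exists (0, 0%N).
  exists (a, M) => _; split=> //; case/andP: h4 => h4 ->; rewrite andbT.
  apply: le_trans h4; apply: ler_wpM2l; first lra.
  by have := hD (qk k); move: (qk k) => q /=; lra.
have [f fP] := choice hX.
have X0 : 0 < X by lra.
have Q0 : 0 < Q by rewrite /Q divr_gt0 // ltr_wpDl // addr_ge0.
have single k : (k <= m)%N -> Q <= `|qk k| -> 0 <= qk k * ((f k).1 - al) ->
    exists l M, [/\ 1 <= l, (0 < M)%N,
    ext M l (l * (1 + 4 * e)) (l * (al - 4 * e)) (l * (al + 4 * e)) &
    l * (D - 4 * e) <= ln M%:R].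
  move=> km Qk qk0; have [aL M0 E /andP[h1 h2]] := fP k km.
  have h3 : D + qk k * ((f k).1 - al) - e <= B by rewrite -(ler_pM2l X0) (le_trans h1).
  have h4 : `|qk k| * `|(f k).1 - al| <= Q * e.
    rewrite -normrM ger0_norm // /Q divfK ?gt_eqF //.
    by have := ler_norm B; have := ler_norm (- D); rewrite normrN; lra.
  have : `|(f k).1 - al| <= e.
    rewrite -(ler_pM2l Q0); apply: le_trans h4.
    by rewrite ler_wpM2r.
  rewrite ler_norml => /andP[h5 h6].
  exists X, (f k).2; split=> //.
    by apply: ext_le E => //; apply: ler_wpM2l; lra.
  by apply: le_trans h1; apply: ler_wpM2l; lra.
(* If the slope is already below [al] at the first grid point, or still at least [al] at the last
   one, the sign condition of [single] holds there. Otherwise the slope drops below [al] somewhere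
   in between. *)
have [a0|a0] := boolP (al <= (f 0%N).1); last first.
  rewrite -ltNge in a0; apply: (single 0%N) => //.
    by rewrite /qk mul0r addr0 normrN ger0_norm // ltW.
  by rewrite /qk mul0r addr0; nra.
have [am|am] := boolP (al <= (f m).1).
  have qm : Q <= qk m by rewrite /qk; lra.
  apply: (single m) => //; first by rewrite ger0_norm //; lra.
  by apply: mulr_ge0; lra.
have [k [km hk hk1]] := @discrete_crossing (fun k => al <= (f k).1) m a0 am.
rewrite -ltNge in hk1.
have [a1L M1 E1 /andP[h1 _]] := fP k (ltnW km).
have [/andP[a20 _] M2 E2 /andP[h2 _]] := fP k.+1 km.
have dE : d * (`|L| + `|al| + 1) = e by rewrite /d divfK // gt_eqF.
have dal : - e <= d * ((f k.+1).1 - al).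
  rewrite -dE -mulrN ler_wpM2l ?ltW //.
  by have := ler_norm al; have := normr_ge0 L; lra.
have [|||n [M [n0 M0 EM hM]]] := @ext_mix X al (D - 2 * e) (qk k) e _ _ _ _ X0 e0 _ M1 M2 E1 E2.
- by rewrite (ltW hk1).
- by apply: le_trans h1; apply: ler_wpM2l; lra.
- apply: le_trans h2; apply: ler_wpM2l; first exact: ltW.
  by move: dal; rewrite /qk -natr1; lra.
have nX0 : 0 < n%:R * X by rewrite mulr_gt0 ?ltr0n.
exists (n%:R * X), M; split=> //.
- by rewrite (le_trans X1) // ler_peMl ?ler1n // ltW.
- by apply: ext_le EM => //; apply: ler_wpM2l; lra.
- by apply: le_trans hM; apply: ler_wpM2l; lra.
Qed.

(** * Cylinders and the symbolic level sets *)

Lemma block_seq (al D : R) : (forall q, D <= q * al - tau q) ->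
  exists (l e : nat -> R) (M : nat -> nat),
  (forall k, [/\ 1 <= l k, 0 <= e k <= 1, (0 < M k)%N,
     ext (M k) (l k) (l k * (1 + e k)) (l k * (al - e k)) (l k * (al + e k)) &
     l k * (D - e k) <= ln (M k)%:R]) /\
  forall eps, 0 < eps -> exists K, forall k, (K <= k)%N ->
    l k <= eps * \sum_(j < k) l j /\
    \sum_(j < k) l j * e j <= eps * \sum_(j < k) l j.
Proof.
move=> hD.
have /choice[f fP] : forall s : nat, exists p : R * nat, let e := s.+1%:R^-1 in
    [/\ 1 <= p.1, (0 < p.2)%N,
    ext p.2 p.1 (p.1 * (1 + e)) (p.1 * (al - e)) (p.1 * (al + e)) &
    p.1 * (D - e) <= ln p.2%:R].
  move=> s; have [|l [M h]] := @ext_dual al D hD s.+1%:R^-1; last by exists (l, M).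
  by rewrite invr_gt0.
have [|sg hsg] := @slow_schedule R (fun s => (f s).1).
  by move=> s; have [] := fP s.
exists (fun k => (f (sg k)).1), (fun k => (sg k).+1%:R^-1), (fun k => (f (sg k)).2).
split=> // k; have [h1 h2 h3 h4] := fP (sg k); split=> //.
by rewrite invr_ge0 ler0n /= invf_le1 ?ltr0n // ler1n.
Qed.

Variables (zeta : seq T) (ww : T -> R).
Hypothesis zeta_lw : forall e, e \in zeta -> 0 <= lw e.
Hypothesis wwP : forall e, (e \in EL) || (e \in zeta) -> ww e = expR (- lw e).

Definition wt (s : seq T) : R := \prod_(e <- s) ww e.
Definition dist (g1 g2 : nat -> T) : R :=
  inf [set wt (mkseq g1 n) | n in [set n | mkseq g1 n = mkseq g2 n]].
Definition cyl (s : seq T) : set (nat -> T) := [set g | mkseq g (size s) = s].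
Definition tail (g : nat -> T) (n : nat) : seq T := drop (size zeta) (mkseq g n).
(** The set measured by [fL] in symbolic terms, with the quotient of logarithms cleared of its
    denominator. The tail after [zeta] is required to stay in the class throughout; [omega_pts]
    shows that this agrees with staying there eventually. *)
Definition pts (al : R) : set (nat -> T) := [set g | [/\ cyl zeta g,
  forall n, lpath u (tail g n) &
  forall eps, 0 < eps -> exists N, forall n, (N <= n)%N ->
    `|c (tail g n) - al * len (mkseq g n)| <= eps * len (mkseq g n)]].

Let good (e : T) := (e \in EL) || (e \in zeta).

Lemma wt_len s : all good s -> wt s = expR (- len s).
Proof.
elim: s => [|e s IH] /=; first by rewrite /wt /len !big_nil oppr0 expR0.
move=> /andP[ge /IH h]; rewrite /wt /len !big_cons -/(wt s) -/(len s) h wwP //.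
by rewrite opprD expRD.
Qed.

Lemma good_len_ge0 s : all good s -> 0 <= len s.
Proof.
move=> /allP gs; rewrite /len big_seq; apply: sumr_ge0 => e /gs/orP[/lwP|/zeta_lw //].
by move: lmin0; lra.
Qed.

Lemma good_path s : lpath u s -> all good (zeta ++ s).
Proof.
move=> /lpath_EL/allP ps; rewrite all_cat; apply/andP; split; apply/allP => e es.
  by rewrite /good es orbT.
by rewrite /good; have /= -> := ps e es.
Qed.

Lemma take_mkseq (g : nat -> T) n m : (n <= m)%N -> take n (mkseq g m) = mkseq g n.
Proof. by move=> nm; rewrite /mkseq -map_take take_iota (minn_idPl nm). Qed.

Lemma cyl_take s g n : cyl s g -> (n <= size s)%N -> mkseq g n = take n s.
Proof. by move=> E h; rewrite -E take_mkseq. Qed.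

Lemma cyl_prefix s t g : cyl (s ++ t) g -> cyl s g.
Proof.
move=> h; rewrite /cyl /= (cyl_take h) ?take_size_cat //.
by rewrite size_cat leq_addr.
Qed.

(** A common prefix of the two points reaching the end of the first word would make the words
    comparable. So every common prefix is a prefix of [zeta ++ s1], and its weight is at least that
    of [zeta ++ s1]. *)
Lemma dist_sep s1 s2 g1 g2 : lpath u s1 -> lpath u s2 ->
  (forall t, s2 <> s1 ++ t) -> (forall t, s1 <> s2 ++ t) ->
  cyl (zeta ++ s1) g1 -> cyl (zeta ++ s2) g2 ->
  expR (- len (zeta ++ s1)) <= dist g1 g2.
Proof.
move=> p1 p2 n12 n21 c1 c2; apply: lb_le_inf; first by exists (wt (mkseq g1 0)), 0%N.
move=> _ [n /= E <-].
have ns1 : (n < size (zeta ++ s1))%N.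
  rewrite ltnNge; apply/negP => le1.
  have [le2|/ltnW le2] := leqP (size (zeta ++ s1)) (size (zeta ++ s2)).
    have : take (size (zeta ++ s1)) (zeta ++ s2) = zeta ++ s1.
      by rewrite -(cyl_take c2) // -{2}c1 -(take_mkseq g1 le1) E take_mkseq.
    rewrite size_cat take_cat ltnNge leq_addr /= addKn => /eqP.
    rewrite eqseq_cat // eqxx /= => /eqP h.
    by apply: (n12 (drop (size s1) s2)); rewrite -{1}h cat_take_drop.
  have : take (size (zeta ++ s2)) (zeta ++ s1) = zeta ++ s2.
    have le3 := leq_trans le2 le1.
    by rewrite -(cyl_take c1) // -{2}c2 -(take_mkseq g2 le3) -E take_mkseq.
  rewrite size_cat take_cat ltnNge leq_addr /= addKn => /eqP.
  rewrite eqseq_cat // eqxx /= => /eqP h.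
  by apply: (n21 (drop (size s2) s1)); rewrite -{1}h cat_take_drop.
rewrite (cyl_take c1 (ltnW ns1)).
have := good_path p1; rewrite -{1 2}(cat_take_drop n (zeta ++ s1)) all_cat => /andP[g1' g2'].
rewrite wt_len // ler_expR lerN2 len_cat lerDl; exact: good_len_ge0.
Qed.

Lemma chain_prefix (b : nat -> seq T) : (forall k, exists t, b k.+1 = b k ++ t) ->
  forall k k', (k <= k')%N -> exists t, b k' = b k ++ t.
Proof.
move=> hb k k' /subnKC <-; elim: (k' - k)%N => [|n [t IH]].
  by exists [::]; rewrite addn0 cats0.
by have [t' E] := hb (k + n)%N; exists (t ++ t'); rewrite addnS E IH catA.
Qed.

Lemma branch_limit (b : nat -> seq T) : (forall k, exists t, b k.+1 = b k ++ t) ->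
  (forall n, exists k, (n < size (b k))%N) -> exists g, forall k, cyl (zeta ++ b k) g.
Proof.
move=> hb hn; have [K hK] := choice hn.
have [x0 _] : exists x0 : T, True.
  by case: (b (K 0%N)) (hK 0%N) => // x *; exists x.
exists (fun n => nth x0 (zeta ++ b (K n)) n) => k.
apply: (@eq_from_nth _ x0); first by rewrite size_mkseq.
move=> n; rewrite size_mkseq => nk; rewrite nth_mkseq //.
have nK : (n < size (zeta ++ b (K n)))%N.
  by rewrite size_cat; apply: leq_trans (hK n) _; rewrite leq_addl.
have [le|/ltnW le] := leqP k (K n).
  by have [t ->] := chain_prefix hb le; rewrite catA [LHS]nth_cat nk.
by have [t ->] := chain_prefix hb le; rewrite catA [RHS]nth_cat nK.
Qed.

Lemma tail_mono g m n : (m <= n)%N -> exists t, tail g n = tail g m ++ t.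
Proof.
move=> mn; rewrite /tail -(cat_take_drop m (mkseq g n)) take_mkseq // drop_cat.
case: ifP => [_|lt]; first by exists (drop m (mkseq g n)).
exists (drop (size zeta - size (mkseq g m)) (drop m (mkseq g n))).
by rewrite [drop _ (mkseq g m)]drop_oversize // leqNgt lt.
Qed.

Lemma tail_node s g : cyl (zeta ++ s) g -> tail g (size (zeta ++ s)) = s.
Proof. by rewrite /tail => E; rewrite (E : mkseq _ _ = _) drop_size_cat. Qed.

Lemma mkseq_tail g n : cyl zeta g -> (size zeta <= n)%N -> mkseq g n = zeta ++ tail g n.
Proof.
move=> zg le; rewrite -{1}(cat_take_drop (size zeta) (mkseq g n)) take_mkseq //.
by rewrite (zg : mkseq _ _ = _).
Qed.

Lemma len_mono s t : lpath u (s ++ t) -> len s <= len (s ++ t).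
Proof.
move=> /lpath_EL; rewrite all_cat => /andP[_ /len_ge0]; rewrite len_cat; lra.
Qed.

(* Between two consecutive nodes of the tree the cost is controlled by monotonicity,
   and the blocks are short compared with the past. *)
Lemma branch_pts (al : R) (b : nat -> seq T) (S E l : nat -> R) (C : R) :
  (forall k, exists t, b k.+1 = b k ++ t) -> (forall k, lpath u (b k)) ->
  (forall k, k%:R <= S k) -> (forall k, S k <= len (b k)) ->
  (forall k, len (b k) <= C + S k + E k) ->
  (forall k, `|c (b k) - al * S k| <= C + E k) -> 0 <= C ->
  (forall k, 0 <= E k) ->
  (forall k, S k.+1 = S k + l k) -> (forall k, E k.+1 <= E k + l k) -> (forall k, 0 <= l k) ->
  (forall eps, 0 < eps -> exists K, forall k, (K <= k)%N ->
     l k <= eps * S k /\ E k <= eps * S k) ->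
  exists2 g, pts al g & forall k, cyl (zeta ++ b k) g.
Proof.
move=> hb pb kS Slen lenS cS C0 E0 SS ES l0 small.
have lm0 := lmax_ge0 (base_VL bP).
have lmpos : 0 < lmax + 1 by lra.
have szb n : exists k, (n < size (b k))%N.
  exists (Num.truncn (n%:R * (lmax + 1))).+1; rewrite -(ltr_nat R).
  set k := (Num.truncn _).+1.
  have h1 : n%:R * (lmax + 1) < k%:R by rewrite truncnS_gt.
  have h2 := le_trans (kS k) (Slen k).
  have h3 := len_le (lpath_EL (pb k)).
  rewrite -(ltr_pM2r lmpos); apply: (lt_le_trans h1); apply: (le_trans h2).
  by apply: (le_trans h3); rewrite mulrDr mulr1 mulrC lerDl.
have [g gb] := branch_limit hb szb; exists g => //.
have zg : cyl zeta g := cyl_prefix (gb 0%N).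
have below n k : (n <= size (zeta ++ b k))%N -> exists t, b k = tail g n ++ t.
  by move=> h; have [t Et] := tail_mono g h; exists t; rewrite -Et tail_node.
have above n k : (size (zeta ++ b k) <= n)%N -> exists t, tail g n = b k ++ t.
  by move=> h; have [t Et] := tail_mono g h; exists t; rewrite Et tail_node.
have ptail n : lpath u (tail g n).
  have [k nk] := szb n.
  have [|t Et] := below n k; first by rewrite size_cat (leq_trans (ltnW nk)) ?leq_addl.
  by have := pb k; rewrite Et lpath_cat => /andP[].
split=> // eps eps0.
pose z := len zeta; pose A := 1 + `|al|.
have z0 : 0 <= z by apply: good_len_ge0; have := good_path (pb 0%N); rewrite all_cat => /andP[].
have A0 : 0 < A by rewrite /A ltr_wpDr.
have eA0 : 0 < eps / (6 * A) by rewrite divr_gt0 // mulr_gt0.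
have [K1 hK1] := small _ eA0.
have [K K1K Kbig] : exists2 K, (K1 <= K)%N & 2 * A * (z + C) / eps <= K%:R.
  exists (K1 + (Num.truncn (2 * A * (z + C) / eps)).+1)%N; first by rewrite leq_addr.
  by apply/ltW/(lt_le_trans (truncnS_gt _)); rewrite ler_nat leq_addl.
exists (size (zeta ++ b K)) => n Kn.
have [m hm] := szb n.
have [||k [_ h1 h2]] := @discrete_crossing (fun j => size (zeta ++ b (K + j)%N) <= n)%N m.
- by rewrite addn0.
- have [t Et] := chain_prefix hb (leq_addl K m).
  rewrite -ltnNge Et !size_cat; apply: leq_trans hm _.
  by rewrite addnCA leq_addr.
rewrite -ltnNge addnS in h2; set k' := (K + k)%N in h1 h2.
have [t Et] := above _ _ h1; have [t' Et'] := below _ _ (ltnW h2).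
have pn := ptail n; have pk := pb k'.+1.
have l1 : len (b k') <= len (tail g n) by rewrite Et; apply: len_mono; rewrite -Et.
have l2 : len (tail g n) <= len (b k'.+1) by rewrite Et'; apply: len_mono; rewrite -Et'.
have c1 : c (b k') <= c (tail g n) by rewrite Et; apply: (base_mono bP); rewrite -Et.
have c2 : c (tail g n) <= c (b k'.+1) by rewrite Et'; apply: (base_mono bP); rewrite -Et'.
have zn : (size zeta <= n)%N by apply: leq_trans h1; rewrite size_cat leq_addr.
rewrite (mkseq_tail zg zn) len_cat -/z; set x := z + _.
have Kk : (K <= k')%N by rewrite leq_addr.
have K1k := leq_trans K1K Kk.
have [sl sE] := hK1 k' K1k.
have kbig : 2 * A * (z + C) <= eps * S k'.
  rewrite [eps * _]mulrC -ler_pdivrMr //; apply: le_trans (kS k').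
  by apply: le_trans Kbig _; rewrite ler_nat.
have e6 : 6 * A * (eps / (6 * A) * S k') = eps * S k' by field; rewrite gt_eqF.
have Sl6 : 6 * A * l k' <= eps * S k' by rewrite -e6 ler_wpM2l // mulr_ge0 // ltW.
have SE6 : 6 * A * E k' <= eps * S k' by rewrite -e6 ler_wpM2l // mulr_ge0 // ltW.
have := cS k'; have := cS k'.+1; have := Slen k'; have := lenS k'.+1; have := ES k'.
rewrite SS => hE hl1 hl2 hc1 hc2.
have xS : S k' <= x by rewrite /x; lra.
have epsS : eps * S k' <= eps * x by apply: ler_wpM2l => //; exact: ltW.
(* In [A * w] the terms from [z + C], [2 * l k'] and [E k'] take the shares 1/2, 1/3 and 1/6 of
   [eps * S k']; this is the origin of the factor 6. *)
pose w := z + C + 2 * l k' + E k'.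
have [w1 w2] : `|S k' - x| <= w /\ `|S k' + l k' - x| <= w.
  by have := l0 k'; have := E0 k'; rewrite /w /x !ler_norml; lra.
have a1 : `|al * (S k' - x)| <= `|al| * w by rewrite normrM ler_wpM2l.
have a2 : `|al * (S k' + l k' - x)| <= `|al| * w by rewrite normrM ler_wpM2l.
have fin : A * w <= eps * x.
  apply: le_trans epsS; rewrite /w !mulrDr.
  have -> : A * (2 * l k') = 6 * A * l k' / 3 by field.
  have -> : A * E k' = 6 * A * E k' / 6 by field.
  by move: kbig; rewrite -!mulrA !mulrDr; lra.
apply: le_trans fin; rewrite /A mulrDl mul1r.
have wE : C + E k' + l k' <= w by have := l0 k'; rewrite /w; lra.
have wE2 : C + E k' <= w by have := l0 k'; rewrite /w; lra.
move: a1 a2 hc1 hc2; rewrite !ler_norml; clearbody w x; lra.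
Qed.

(** * Lower bound for the dimension *)

Lemma dist_le_diam (U : set (nat -> T)) (d : R) g1 g2 : U g1 -> U g2 ->
  (hdiam dist U <= d%:E)%E -> dist g1 g2 <= fine (hdiam dist U).
Proof.
move=> U1 U2 Ud.
have h : ((dist g1 g2)%:E <= hdiam dist U)%E by apply: ereal_sup_ubound; exists g1, g2.
by case: (hdiam dist U) Ud h => [r| |] //=; rewrite lee_fin.
Qed.

Lemma cover_term_ge0 s (U : set (nat -> T)) : (0 <= cover_term dist s U)%E.
Proof. by rewrite /cover_term; case: pselect => //= _; rewrite lee_fin powR_ge0. Qed.

(* [expR (- Lam k)] bounds the diameters of the nodes of level [k] from below. *)
Lemma good_tree (al D : R) : (forall q, D <= q * al - tau q) ->
  exists (ch : nat -> seq T -> seq (seq T)) (Rch : nat -> seq T -> Prop) (s0 : seq T)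
    (M : nat -> nat) (Lam : nat -> R),
  [/\ forall k, (0 < M k)%N, Rch 0%N s0,
      forall k s s', Rch k s -> s' \in ch k s -> Rch k.+1 s' &
      forall k s, Rch k s -> size (ch k s) = M k /\ uniq (ch k s)] /\
  [/\ forall k s s', Rch k s -> s' \in ch k s -> exists t, s' = s ++ t,
      forall k s a b t, Rch k s -> a \in ch k s -> b \in ch k s -> b = a ++ t -> a = b,
      forall k s, Rch k s -> lpath u s /\ len (zeta ++ s) <= Lam k,
      forall k, k%:R <= Lam k <= Lam k.+1 &
      forall b, b 0%N = s0 -> (forall k, b k.+1 \in ch k (b k)) ->
        exists2 g, pts al g & forall k, cyl (zeta ++ b k) g] /\
  forall s, 0 <= s -> s < D ->
    (exists K, forall k, (K <= k)%N -> mass R M k <= expR (- (s * Lam k.+1))) /\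
    forall eps, 0 < eps -> exists k, mass R M k <= eps.
Proof.
move=> hD; have [l [e [M [hblk hsmall]]]] := block_seq hD.
have l1 k : 1 <= l k by have [] := hblk k.
have l0 k : 0 <= l k by apply: le_trans (l1 k).
have e01 k : 0 <= e k <= 1 by have [] := hblk k.
pose S k := \sum_(j < k) l j; pose E k := \sum_(j < k) l j * e j.
have SS k : S k.+1 = S k + l k by rewrite /S big_ord_recr.
have ES k : E k.+1 = E k + l k * e k by rewrite /E big_ord_recr.
have le0 k : 0 <= l k * e k <= l k.
  by have /andP[a b] := e01 k; rewrite mulr_ge0 //= ler_piMr.
have E0 k : 0 <= E k by apply: sumr_ge0 => j _; have /andP[] := le0 j.
have kS k : k%:R <= S k.
  by rewrite -[k in k%:R]card_ord -sumr_const; apply: ler_sum => j _; exact: l1.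
have [e0 e0E se0] := VLout (base_VL bP).
(* [ext] extends nonempty paths, so the root of the tree is a single edge. *)
pose s0 := [:: e0].
have ps0 : lpath u s0 by rewrite /= e0E se0 eqxx.
pose Rch k s := [/\ lpath u s, s <> [::], S k <= len s - len s0 <= S k + E k &
  al * S k - E k <= c s - c s0 <= al * S k + E k].
have /choice[ch' chP'] : forall p : nat * seq T, exists cs : seq (seq T),
    lpath u p.2 -> p.2 <> [::] ->
    [/\ size cs = M p.1, uniq cs,
        forall s', s' \in cs -> [/\ exists t, s' = p.2 ++ t, lpath u s',
          l p.1 <= len s' - len p.2 <= l p.1 * (1 + e p.1) &
          l p.1 * (al - e p.1) <= c s' - c p.2 <= l p.1 * (al + e p.1)] &
        forall a b t, a \in cs -> b \in cs -> b = a ++ t -> a = b].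
  move=> [k s] /=; have [ps|nps] := boolP (lpath u s); last by exists [::].
  have [s0'|ns] := pselect (s = [::]); first by exists [::].
  by have [_ _ _ /(_ s ps ns)[cs h] _] := hblk k; exists cs.
pose ch k s := ch' (k, s).
have chP k s : Rch k s -> [/\ size (ch k s) = M k, uniq (ch k s),
        forall s', s' \in ch k s -> [/\ exists t, s' = s ++ t, lpath u s',
          l k <= len s' - len s <= l k * (1 + e k) &
          l k * (al - e k) <= c s' - c s <= l k * (al + e k)] &
        forall a b t, a \in ch k s -> b \in ch k s -> b = a ++ t -> a = b].
  by move=> [h1 h2 _ _]; have := chP' (k, s) h1 h2.
pose Lam k := len (zeta ++ s0) + S k + E k.
have gz : 0 <= len (zeta ++ s0) by apply: good_len_ge0; exact: good_path.
have R0 : Rch 0%N s0.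
  by split=> //; rewrite /S /E !big_ord0 ?mulr0 !subrr ?addr0 ?oppr0 lexx.
have RS k s s' : Rch k s -> s' \in ch k s -> Rch k.+1 s'.
  move=> rs /(let: And4 _ _ h _ := chP k s rs in h s')[[t Et] ps' h1 h2].
  case: rs => ps ns h3 h4; split=> //.
  - by rewrite Et; case: (s) ns.
  - by rewrite SS ES; move: h1 h3; rewrite mulrDr mulr1; move: (l k * e k) => y; lra.
  - by rewrite SS ES; move: h2 h4; lra.
have Mpos k : (0 < M k)%N by have [] := hblk k.
exists ch, Rch, s0, M, Lam; split; [|split].
- by split=> // k s /chP[].
- split.
  + by move=> k s s' /chP[_ _ h _] /h[].
  + by move=> k s a b t /chP[_ _ _ h]; apply: h.
  + move=> k s [ps _ /andP[_ h] _]; split=> //.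
    by rewrite /Lam !len_cat; lra.
  + move=> k; rewrite /Lam SS ES; have := kS k; have := E0 k.
    by have /andP[] := le0 k; have := l0 k; lra.
  + move=> b b0 bS.
    have Rb k : Rch k (b k) by elim: k => [|k IH]; [rewrite b0|exact: (RS _ _ _ IH (bS k))].
    have lens0 : 0 <= len s0 by apply: len_ge0; exact: (lpath_EL ps0).
    have cs00 : 0 <= c s0 by exact: (base_ge0 bP ps0).
    apply: (@branch_pts al b S E l (len s0 + c s0)) => //.
    * by move=> k; have [_ _ h _] := chP _ _ (Rb k); have [] := h _ (bS k).
    * by move=> k; have [] := Rb k.
    * by move=> k; have [_ _ + _] := Rb k; lra.
    * by move=> k; have [_ _ + _] := Rb k; lra.
    * by move=> k; have [_ _ _ +] := Rb k; rewrite ler_norml; have := E0 k; lra.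
    * by rewrite addr_ge0.
    * by move=> k; rewrite ES lerD2l; have /andP[] := le0 k.
- move=> s s_ge0 sD.
  have lnM k : ln (mass R M k) <= - (D * S k - E k).
    elim: k => [|k IH]; first by rewrite /mass /S /E !big_ord0 ln1 mulr0 subrr oppr0.
    have := massS R Mpos k; have m1 := mass_gt0 R Mpos k.+1.
    move=> Em; move: IH; rewrite -Em lnM ?posrE ?ltr0n // SS ES.
    have [_ _ _ _] := hblk k; rewrite mulrBr mulrDr [l k * D]mulrC; lra.
  have massle k : mass R M k <= expR (- (D * S k - E k)).
    by rewrite -[leLHS]lnK ?posrE ?mass_gt0 // ler_expR.
  pose d := D - s; have d0 : 0 < d by rewrite subr_gt0.
  pose z := len (zeta ++ s0).
  (* [Lam k.+1] exceeds [z + S k] by at most [3 * (eps * S k)], and [E k] is at most [eps * S k].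
     Half of [d * S k] pays for both, the other half for [s * z]. *)
  pose eps := d / (2 * (1 + 3 * s)).
  have s3 : 0 < 1 + 3 * s by rewrite ltr_pwDl // mulr_ge0.
  have eps0 : 0 < eps by rewrite divr_gt0 // mulr_gt0.
  have epsE : 2 * (1 + 3 * s) * eps = d by rewrite /eps mulrC divfK // gt_eqF // mulr_gt0.
  have [K1 hK1] := hsmall eps eps0.
  have main k : (K1 <= k)%N -> 2 * (s * z) <= d * S k -> s * Lam k.+1 <= D * S k - E k.
    move=> /hK1[]; rewrite -/(S k) -/(E k) => h1 h2 h3.
    have h4 : s * Lam k.+1 <= s * (z + S k + 3 * (eps * S k)).
      apply: ler_wpM2l => //; rewrite /Lam SS ES -/z.
      by have /andP[_] := le0 k; lra.
    apply: le_trans h4 _.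
    have h5 : (1 + 3 * s) * (eps * S k) = d * S k / 2 by rewrite -epsE; field.
    by move: h5 h3 h2; rewrite /d !mulrDl !mulrDr mulNr; move: (eps * S k) => y; lra.
  split.
    exists (K1 + (Num.truncn (2 * (s * z) / d)).+1)%N => k Kk.
    apply: le_trans (massle k) _; rewrite ler_expR lerN2; apply: main.
      by apply: leq_trans Kk; rewrite leq_addr.
    rewrite [leRHS]mulrC -ler_pdivrMr //; apply: le_trans (kS k).
    apply/ltW/(lt_le_trans (truncnS_gt _)); rewrite ler_nat.
    by apply: leq_trans Kk; rewrite leq_addl.
  move=> r r0.
  have [K2 hK2] := hsmall (d / 2) ltac:(lra).
  have [k Kk kbig] : exists2 k, (K2 <= k)%N & - ln r * 2 / d <= k%:R.
    exists (K2 + (Num.truncn (`|ln r| * 2 / d)).+1)%N; first by rewrite leq_addr.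
    apply: le_trans (_ : `|ln r| * 2 / d <= _).
      rewrite !ler_wpM2r ?invr_ge0 ?(ltW d0) //; have := ler_norm (- ln r); by rewrite normrN.
    by apply/ltW/(lt_le_trans (truncnS_gt _)); rewrite ler_nat leq_addl.
  exists k; apply: le_trans (massle k) _; rewrite -[leRHS]lnK ?posrE // ler_expR.
  have [_] := hK2 k Kk; rewrite -/(S k) -/(E k) => hE.
  have : - ln r * 2 <= d * S k.
    by rewrite [leRHS]mulrC -ler_pdivrMr //; apply: le_trans (kS k).
  have : 0 <= s * S k by apply: mulr_ge0 => //; apply: le_trans (kS k).
  by move: hE; rewrite /d; move: (S k) (E k) => x y; lra.
Qed.

(** Any branch of the tree gives a point; only some finite lower bound [D] of the conjugate is asked
    for. *)
Lemma pts_neq0 (al D : R) : (forall q, D <= q * al - tau q) -> pts al !=set0.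
Proof.
move=> /good_tree[ch [Rch [s0 [M [Lam [[M0 R0 RS chP] [[_ _ _ _ h] _]]]]]]].
have /choice[f fP] : forall p : nat * seq T, exists s', Rch p.1 p.2 -> s' \in ch p.1 p.2.
  move=> [k s] /=; have [rs|] := pselect (Rch k s); last by exists s.
  have [sz _] := chP _ _ rs; have := M0 k; rewrite -sz.
  by case: (ch k s) => // s' ? _; exists s' => _; rewrite mem_head.
pose b := fix b k := if k is k'.+1 then f (k', b k') else s0.
have Rb k : Rch k (b k) by elim: k => //= k IH; apply: (RS k (b k)) => //; exact: (fP (k, b k)).
have [//|k|g pg _] := h b; last by exists g.
exact: (fP (k, b k)).
Qed.

Lemma pts_lower (al D : R) : (forall q, D <= q * al - tau q) ->
  forall s, 0 <= s -> hausdorff_measure dist s (pts al) = 0%E -> D <= s.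
Proof.
move=> hD s s_ge0 H0; rewrite leNgt; apply/negP => sD.
have [ch [Rch [s0 [M [Lam [[M0 R0 RS chP] [[chext chinc RchP LamP brP] /(_ s s_ge0 sD)[]]]]]]]] :=
  good_tree hD.
move=> [K hK] msmall.
have Lam_mono k k' : (k <= k')%N -> Lam k <= Lam k'.
  move=> /subnKC <-; elim: (k' - k)%N => [|n IH]; first by rewrite addn0.
  by rewrite addnS; apply: le_trans IH _; have /andP[] := LamP (k + n)%N.
(* Cover sets of diameter at most [delta] fall below [expR (- Lam K)], so that their levels lie
   where [hK] compares mass and diameter. *)
pose delta := expR (- Lam K) / 2.
have delta0 : 0 < delta by rewrite divr_gt0 ?expR_gt0.
have deltaK : delta < expR (- Lam K).
  by rewrite /delta; have := expR_gt0 (- Lam K); lra.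
have : (hausdorff_content dist s delta (pts al) < (2^-1)%:E)%E.
  apply: le_lt_trans (_ : _ <= 0%E)%E _; last by rewrite lte_fin invr_gt0.
  by rewrite -H0; apply: ereal_sup_ubound; exists delta.
move=> /ereal_inf_lt[_ [U [Ucov Udiam ->]] Usum].
(* For positive diameter, [ki i] is the level with [expR (- Lam k.+1) <= diam < expR (- Lam k)]: the
   right inequality prevents meeting two siblings, the left one bounds the mass by the power [s] of
   the diameter. Other sets have no such level and are given one whose mass is a summable error. *)
have /choice[ki hki] : forall i, exists k,
    (U i !=set0 -> fine (hdiam dist (U i)) < expR (- Lam k)) /\
    ((mass R M k)%:E <= cover_term dist s (U i) + (2^-1 / (2 ^ i.+1)%:R)%:E)%E.
  move=> i; have ei : 0 < 2^-1 / (2 ^ i.+1)%:R :> R.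
    by rewrite divr_gt0 ?invr_gt0 // ltr0n expn_gt0.
  have triv : (U i !=set0 -> fine (hdiam dist (U i)) <= 0) -> exists k,
    (U i !=set0 -> fine (hdiam dist (U i)) < expR (- Lam k)) /\
    ((mass R M k)%:E <= cover_term dist s (U i) + (2^-1 / (2 ^ i.+1)%:R)%:E)%E.
    move=> d0; have [k hk] := msmall _ ei; exists k; split.
      by move=> /d0/le_lt_trans; apply; exact: expR_gt0.
    apply: le_trans (_ : (2^-1 / (2 ^ i.+1)%:R)%:E <= _)%E; first by rewrite lee_fin.
    by rewrite leeDr // cover_term_ge0.
  have [U0|U0] := pselect (U i !=set0); last by apply: triv => /U0.
  have [d0|d0] := leP (fine (hdiam dist (U i))) 0; first exact: triv.
  set d := fine _ in d0.
  have dK : d < expR (- Lam K).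
    apply: le_lt_trans deltaK; have := Udiam i; rewrite /d.
    by case: (hdiam dist (U i)) => [r| |] //=; rewrite ?lee_fin // => _; exact: ltW.
  pose m := (Num.truncn `|ln d|).+1.
  have [||k [_ h1 h2]] := @discrete_crossing (fun n => d < expR (- Lam (K + n)%N)) m.
  - by rewrite addn0.
  - rewrite -leNgt -[leRHS]lnK ?posrE // ler_expR lerNl.
    apply: le_trans (_ : m%:R <= _).
      by apply/ltW/(le_lt_trans _ (truncnS_gt _)); rewrite -normrN ler_norm.
    apply: le_trans (Lam_mono _ _ (leq_addl K m)); by have /andP[] := LamP m.
  exists (K + k)%N; split=> // ; apply: le_trans (_ : (d `^ s)%:E <= _)%E; last first.
    rewrite /cover_term; case: pselect => /= [E|_]; first by case: U0 => x; rewrite E.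
    by rewrite leeDl // lee_fin ltW.
  rewrite lee_fin; apply: le_trans (hK (K + k)%N (leq_addr _ _)) _.
  rewrite /powR gt_eqF // ler_expR; rewrite -leNgt addnS in h2.
  rewrite -mulrN ler_wpM2l //.
  by rewrite -ler_expR lnK.
pose meets i (x : seq T) := exists2 g, U i g & cyl (zeta ++ x) g.
have [|||b [b0 bS nm]] := @tree_cover R _ ch M Rch meets ki s0 M0 R0 RS chP.
- move=> i k x y rx yc [g Ug cg]; exists g => //.
  by have [t Et] := chext _ _ _ rx yc; move: cg; rewrite Et catA; exact: cyl_prefix.
- move=> i k x y1 y2 rx kk y1c y2c [g1 U1 c1] [g2 U2 c2].
  apply: contrapT => ne.
  have [p1 l1] := RchP _ _ (RS _ _ _ rx y1c).
  have [p2 l2] := RchP _ _ (RS _ _ _ rx y2c).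
  have h1 : expR (- len (zeta ++ y1)) <= dist g1 g2.
    apply: (dist_sep p1 p2 _ _ c1 c2) => t Et; apply: ne; last apply/esym.
      exact: (chinc _ _ _ _ _ rx y1c y2c Et).
    exact: (chinc _ _ _ _ _ rx y2c y1c Et).
  have h2 := dist_le_diam U1 U2 (Udiam i).
  have [/(_ (ex_intro _ g1 U1)) h3 _] := hki i.
  have := le_lt_trans (le_trans h1 h2) h3; rewrite ltr_expR ltrN2 ltNge => /negP; apply.
  by apply: le_trans l1 _; apply: Lam_mono.
(* The cover contributes less than one half and the errors sum to one half, which leaves a total
   below [1]. *)
- apply: le_lt_trans (_ : _ <= \sum_(i <oo) (cover_term dist s (U i) +
     (2^-1 / (2 ^ i.+1)%:R)%:E))%E _.
    apply: lee_nneseries => i *; last by have [] := hki i.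
    by rewrite lee_fin ltW // mass_gt0.
  apply: le_lt_trans (epsilon_trick _ _ _) _.
  + by move=> i; exact: cover_term_ge0.
  + by rewrite invr_ge0.
  + have -> : 1%:E = ((2^-1)%:E + (2^-1)%:E)%E :> \bar R by rewrite -EFinD; congr EFin; lra.
    by rewrite lteD2rE.
have [g pg cg] := brP b b0 bS.
have [i _ Uig] := Ucov g pg.
by apply: (nm i); exists g.
Qed.

(** * Upper bound for the dimension *)

Lemma zeta_len_ge0 : 0 <= len zeta.
Proof.
by apply: good_len_ge0; have := @good_path [::] isT; rewrite all_cat => /andP[].
Qed.

Definition near_word (al eps : R) (s : seq T) : bool :=
  `|c s - al * len (zeta ++ s)| <= eps * len (zeta ++ s).

Definition near_sum (al eps s : R) (n : nat) : R :=
  \sum_(x <- F u n%:R) (if near_word al eps x then expR (- (s * len (zeta ++ x))) else 0).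

(** For a near word at level [n], [s * len] is about [(s - q * al) * n + q * c], so the sum is
    comparable to [Y] times [expR (- ((s - q * al) * n))]. As [Y] grows at rate [- tau q], the gap
    [k] is the decay rate: a quarter of it goes to [eps], a quarter to the pressure error, and half
    remains. *)
Lemma level_sum (al q s : R) : q * al - tau q < s -> exists eps C r K,
  [/\ 0 < eps, 0 <= C, 0 < r < 1 &
   forall n, (K <= n)%N -> near_sum al eps s n <= C * r ^+ n].
Proof.
move=> hs; pose k := s - (q * al - tau q); have k0 : 0 < k by rewrite /k; lra.
have q1 : 0 < 1 + `|q| by rewrite ltr_pwDl.
pose eps := k / (4 * (1 + `|q|)).
have eps0 : 0 < eps by rewrite divr_gt0 // mulr_gt0.
have qe : `|q| * eps <= k / 4.
  have -> : k / 4 = (1 + `|q|) * eps by rewrite /eps; field; rewrite gt_eqF.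
  by apply: ler_wpM2r; [exact: ltW|rewrite lerDr].
have [X hX] := tauP bP q (ltac:(lra) : 0 < k / 4).
have lm0 := lmax_ge0 (base_VL bP); have z0 := zeta_len_ge0.
pose be := s - q * al - `|q| * eps.
pose A := `|be| * (len zeta + lmax).
exists eps, (expR A), (expR (- (k / 2))), (Num.truncn `|X|).+1; split => //.
- by rewrite expR_gt0 expR_lt1; lra.
move=> n Kn.
have nX : X <= n%:R.
  apply: le_trans (ler_norm _) _; apply/ltW/(lt_le_trans (truncnS_gt _)).
  by rewrite ler_nat.
have n0 : 0 < n%:R :> R by rewrite ltr0n; apply: leq_trans Kn.
have Y0 := Y_gt0 q bP n0.
have hn := hX _ nX.
apply: (@le_trans _ _ (\sum_(x <- F u n%:R) expR (A - be * n%:R) * expR (- (q * c x)))).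
  rewrite /near_sum big_seq [leRHS]big_seq; apply: ler_sum => x; rewrite mem_F => Fx.
  case: ifP => [nw|_]; last by rewrite mulr_ge0 ?expR_ge0.
  rewrite -expRD ler_expR.
  set y := len (zeta ++ x).
  have y0 : 0 <= y by apply: good_len_ge0; apply: good_path; exact: (Fin_path Fx).
  have qc : `|q * (c x - al * y)| <= `|q| * eps * y.
    by rewrite normrM -[leRHS]mulrA ler_wpM2l.
  have yn : `|y - n%:R| <= len zeta + lmax.
    have := Fin_ge Fx; have := Fin_le Fx; rewrite /y len_cat ler_norml.
    by move: z0 lm0; lra.
  have bn : `|be * (y - n%:R)| <= A by rewrite normrM ler_wpM2l.
  move: qc bn; rewrite !ler_norml /be; clearbody y A eps; lra.
rewrite -mulr_sumr -/(Y u c q n%:R) -[Y u c q n%:R]lnK ?posrE // -expRD -expRM_natl -expRD.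
rewrite ler_expR -addrA lerD2l.
have := hn; rewrite ler_norml => /andP[_ hn'].
have : (`|q| * eps) * n%:R <= k / 4 * n%:R by rewrite ler_wpM2r // ltW.
move: hn'; rewrite /be /k; clearbody eps; lra.
Qed.

Lemma pts_good al g m : pts al g -> all good (mkseq g m).
Proof.
move=> [zg pg _]; have h n : (size zeta <= n)%N -> all good (mkseq g n).
  by move=> le; rewrite (mkseq_tail zg le); apply: good_path.
rewrite -(@take_mkseq g m (m + size zeta)) ?leq_addr //.
have := h (m + size zeta)%N (leq_addl _ _).
by rewrite -{1}(cat_take_drop m (mkseq g (m + size zeta))) all_cat => /andP[].
Qed.

(** Nearness in [pts] is indexed by the number of edges, stopping by length. Edges have length at
    most [lmax], so a path stopped at a large length has many edges. *)
Lemma pts_word al g eps : pts al g -> 0 < eps -> exists N, forall n, (N <= n)%N ->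
  exists x, [/\ x \in F u n%:R, cyl (zeta ++ x) g & near_word al eps x].
Proof.
move=> [zg pg hg] eps0; have [N hN] := hg _ eps0.
have lm0 := lmax_ge0 (base_VL bP); have lm1 : 0 < lmax + 1 by lra.
exists (Num.truncn (N%:R * (lmax + 1))).+1 => n Nn.
have nN : N%:R * (lmax + 1) < n%:R by apply: lt_le_trans (truncnS_gt _) _; rewrite ler_nat.
have n0 : 0 < n%:R :> R by rewrite ltr0n; apply: leq_trans Nn.
pose m := (size zeta + (Num.truncn (n%:R / lmin)).+1)%N.
have szm : size (tail g m) = (Num.truncn (n%:R / lmin)).+1.
  by rewrite size_drop size_mkseq addKn.
have lm : n%:R <= len (tail g m).
  apply: le_trans (len_ge (lpath_EL (pg m))); rewrite szm mulrC -ler_pdivrMr //.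
  exact/ltW/truncnS_gt.
have [|x [t [Et Fx]]] := Fin_cut (pg m) (x := n%:R); first by rewrite n0.
have cx : cyl (zeta ++ x) g.
  apply: (@cyl_prefix _ t); rewrite -catA -Et -mkseq_tail ?leq_addr //.
  by rewrite /cyl /= size_mkseq.
exists x; split=> //; first by rewrite mem_F.
have := hN (size (zeta ++ x)); rewrite tail_node // (cx : mkseq _ _ = _); apply.
rewrite size_cat; apply: leq_trans (leq_addl _ _).
have h1 := Fin_ge Fx; have h2 := len_le (lpath_EL (Fin_path Fx)).
rewrite -(ler_nat R) -(ler_pM2r lm1); apply: le_trans (ltW nN) _; apply: le_trans h1 _.
by apply: le_trans h2 _; rewrite mulrDr mulr1 mulrC lerDl.
Qed.

Lemma expr_small (r C eps : R) : 0 < r < 1 -> 0 <= C -> 0 < eps ->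
  exists N, forall n, (N <= n)%N -> C * r ^+ n <= eps.
Proof.
move=> /andP[r0 r1] C0 e0.
have lr : 0 < - ln r by rewrite oppr_gt0 ln_lt0 // r0.
exists (Num.truncn (`|ln ((C + 1) / eps)| / - ln r)).+1 => n Nn.
have C1 : 0 < C + 1 by lra.
have h : ln ((C + 1) / eps) <= n%:R * - ln r.
  rewrite -ler_pdivrMr //; apply: le_trans (_ : _ <= `|ln ((C + 1) / eps)| / - ln r) _.
    by rewrite ler_pM2r ?invr_gt0 // ler_norm.
  by apply/ltW/(lt_le_trans (truncnS_gt _)); rewrite ler_nat.
apply: (@le_trans _ _ ((C + 1) * r ^+ n)); first by rewrite ler_wpM2r ?exprn_ge0 ?ltW //; lra.
rewrite -[r]lnK ?posrE // -expRM_natl -[C + 1]lnK ?posrE // -expRD -[leRHS]lnK ?posrE //.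
by rewrite ler_expR; move: h; rewrite ln_div ?posrE //; lra.
Qed.

(** With exponent [0], [near_sum] counts the near words of a level. A point of the level set
    provides one at every large level, which rules out geometric decay. *)
Lemma pts_conj_ge0 al q : pts al !=set0 -> 0 <= q * al - tau q.
Proof.
move=> [g pg]; rewrite leNgt; apply/negP => lt.
have [eps [C [r [K [eps0 C0 r01 hK]]]]] := level_sum lt.
have [N hN] := pts_word pg eps0.
have [N' hN'] := expr_small r01 C0 (ltac:(lra) : 0 < 2^-1 :> R).
pose n := (K + N + N')%N.
have [Kn Nn N'n] : [/\ (K <= n)%N, (N <= n)%N & (N' <= n)%N].
  by rewrite /n leq_addl -addnA leq_addr addnCA leq_addr.
have [x [xF _ nx]] := hN n Nn; have h1 := hK n Kn; have h2 := hN' n N'n.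
have : 1 <= near_sum al eps 0 n.
  rewrite /near_sum (big_rem x xF) /= nx mul0r oppr0 expR0 lerDl sumr_ge0 // => y _.
  by case: ifP => // _; exact: expR_ge0.
lra.
Qed.

Lemma geom_sum_le (r : R) n m : 0 < r < 1 ->
  \sum_(n <= i < n + m) r ^+ i <= r ^+ n / (1 - r).
Proof.
move=> /andP[r0 r1]; rewrite ler_pdivlMr ?subr_gt0 //.
have -> : (\sum_(n <= i < n + m) r ^+ i) * (1 - r) = r ^+ n - r ^+ (n + m).
  elim: m => [|m IH]; first by rewrite addn0 big_geq // mul0r subrr.
  rewrite addnS big_nat_recr ?leq_addr //= mulrDl IH exprS; ring.
by rewrite gerBl exprn_ge0 // ltW.
Qed.

Lemma cyl_diam al x : lpath u x ->
  (hdiam dist (pts al `&` cyl (zeta ++ x)) <= (expR (- len (zeta ++ x)))%:E)%E.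
Proof.
move=> px; apply: ge_ereal_sup => _ [g1 [g2 [[p1 c1] [[p2 c2] ->]]]].
rewrite lee_fin -wt_len ?good_path //; apply: ge_inf.
  by exists 0 => _ [m _ <-]; rewrite wt_len ?expR_ge0 //; apply: pts_good p1.
exists (size (zeta ++ x)) => /=; last by rewrite (c1 : mkseq _ _ = _).
by rewrite (c1 : mkseq _ _ = _) (c2 : mkseq _ _ = _).
Qed.

Lemma content_ge0 s delta E : (0 <= hausdorff_content dist s delta E)%E.
Proof.
apply: le_ereal_inf_tmp => _ [U [_ _ ->]]; apply: nneseries_ge0 => i _ _.
exact: cover_term_ge0.
Qed.

(** The level from which a point has near prefixes depends on the point, so the cover takes the near
    words of all levels from [n0] on; their sum is a geometric tail. *)
Lemma pts_upper al q s : 0 <= s -> q * al - tau q < s ->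
  hausdorff_measure dist s (pts al) = 0%E.
Proof.
move=> s0 hs; apply/eqP; rewrite eq_le; apply/andP; split; last first.
  apply: le_trans (content_ge0 s 1 (pts al)) _.
  by apply: ereal_sup_ubound; exists 1 => //=.
apply: ge_ereal_sup => _ [delta /= delta0 <-].
apply/lee_addgt0Pr => e e0; rewrite add0e.
have [eps [C [r [K [eps0 C0 r01 hK]]]]] := level_sum hs.
have r1 : 0 < 1 - r by case/andP: r01; lra.
have [N1 hN1] := @expr_small r (C / (1 - r)) e r01 (divr_ge0 C0 (ltW r1)) e0.
have [N2 hN2] := @expr_small (expR (-1)) 1 delta
  ltac:(by rewrite expR_gt0 expR_lt1 ltrN10) ler01 delta0.
(* [K] starts the decay, [N1] makes the geometric tail at most [e], and [N2] makes the diameters at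
   most [delta]. *)
pose n0 := (K + N1 + N2)%N.
pose ok (p : nat * nat) := [&& (n0 <= p.1)%N, (p.2 < size (F u p.1%:R))%N &
  near_word al eps (nth [::] (F u p.1%:R) p.2)].
pose wd (p : nat * nat) := nth [::] (F u p.1%:R) p.2.
(* The cover must be a sequence: pairs (level, position in [F]) are numbered by [pickle], and
   numbers that code no admissible word give the empty set. *)
pose cv k : set (nat -> T) := if pickle_inv k is Some p then
   if ok p then pts al `&` cyl (zeta ++ wd p) else set0 else set0.
pose h (p : nat * nat) : R := if ok p then expR (- (s * len (zeta ++ wd p))) else 0.
pose hk k : R := if pickle_inv k is Some p then h p else 0.
have h0 p : 0 <= h p by rewrite /h; case: ifP => // _; exact: expR_ge0.
have okF p : ok p -> Fin u p.1%:R (wd p).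
  by case/and3P => _ lt _; rewrite -mem_F mem_nth.
have diam0 : (hdiam dist (@set0 (nat -> T)) <= 0%E)%E.
  by apply: ge_ereal_sup => t [x [y []]].
have diamcv k : (hdiam dist (cv k) <= delta%:E)%E.
  have set0d : (hdiam dist (@set0 (nat -> T)) <= delta%:E)%E.
    by apply: le_trans diam0 _; rewrite lee_fin ltW.
  rewrite /cv; case: (pickle_inv k) => [p|//]; case: ifP => // okp.
  have Fp := okF _ okp; apply: le_trans (cyl_diam al (Fin_path Fp)) _.
  rewrite lee_fin; apply: le_trans (hN2 p.1 _); last first.
    by case/and3P: okp => np _ _; apply: leq_trans np; rewrite /n0 leq_addl.
  rewrite mul1r -expRM_natl ler_expR mulrN mulr1 lerN2 len_cat.
  by have := Fin_ge Fp; have := zeta_len_ge0; lra.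
have termcv k : (cover_term dist s (cv k) <= (hk k)%:E)%E.
  rewrite /cover_term; case: pselect => [E|ne] /=.
    by rewrite lee_fin /hk; case: (pickle_inv k) => [p|]; [exact: h0|].
  rewrite lee_fin /hk; move: ne; rewrite /cv; case: (pickle_inv k) => [p|//].
  rewrite /h; case: ifP => [okp ne|_ //].
  have := cyl_diam al (Fin_path (okF _ okp)).
  have : ((-oo) < hdiam dist (pts al `&` cyl (zeta ++ wd p)))%E.
    have [g gP] : (pts al `&` cyl (zeta ++ wd p)) !=set0 by apply/set0P/eqP.
    by apply: lt_le_trans (ltNyr (dist g g)) _; apply: ereal_sup_ubound; exists g, g.
  have dg0 : (0 <= hdiam dist (pts al `&` cyl (zeta ++ wd p)))%E.
    have [g gP] : (pts al `&` cyl (zeta ++ wd p)) !=set0 by apply/set0P/eqP.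
    apply: le_trans (_ : (dist g g)%:E <= _)%E; last first.
      by apply: ereal_sup_ubound; exists g, g.
    rewrite lee_fin; apply: lb_le_inf; first by exists (wt (mkseq g 0)), 0%N.
    by move=> _ [m _ <-]; rewrite wt_len ?expR_ge0 //; apply: pts_good (gP.1).
  move: dg0; case: (hdiam dist _) => [d| |] //= d0 _; rewrite !lee_fin in d0 *.
  move=> dle; rewrite -mulrN mulrC expRM.
  by apply: ge0_ler_powR; rewrite ?nnegrE ?expR_ge0.
have tot m : \sum_(k < m) hk k <= e.
  pose f k := odflt (0%N, 0%N) (pickle_inv k : option (nat * nat)).
  pose P k := if pickle_inv k is Some p then ok p else false.
  pose Nm := (\max_(k < m) (f k).1)%N.
  have -> : \sum_(k < m) hk k = \sum_(k <- [seq k <- iota 0 m | P k]) hk k.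
    rewrite -(big_mkord xpredT) big_filter /index_iota subn0 [RHS]big_mkcond /=.
    apply: eq_bigr => k _; rewrite /P /hk; case: (pickle_inv k) => // p.
    by rewrite /h; case: ifP.
  apply: (@le_trans _ _ (\sum_(p <- [seq (n, i) | n <- index_iota n0 (n0 + Nm.+1),
      i <- index_iota 0 (size (F u n%:R))]) h p)).
    apply: (@ler_sum_inj _ _ _ _ _ f) => //.
    - by rewrite filter_uniq // iota_uniq.
    - move=> k k'; rewrite !mem_filter /P /f => /andP[Pk _] /andP[Pk' _].
      have := @pickle_invK (nat * nat)%type k; have := @pickle_invK (nat * nat)%type k'.
      case: (pickle_inv k) Pk => // p _; case: (pickle_inv k') Pk' => // p' _ /= <- <-.
      by move=> ->.
    - move=> k; rewrite mem_filter mem_iota /= add0n => /andP[Pk km].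
      have fm : ((f k).1 <= Nm)%N.
        exact: (@leq_bigmax _ (fun k : 'I_m => (f k).1) (Ordinal km)).
      apply/allpairsPdep; exists (f k).1, (f k).2; rewrite -surjective_pairing.
      move: Pk fm; rewrite /P /f; case: (pickle_inv k) => // p /= okp fm.
      case/and3P: okp => a1 a2 _; rewrite !mem_index_iota a1 a2; split=> //=.
      by rewrite addnS ltnS (leq_trans fm) // leq_addl.
    - by move=> k _; rewrite /hk /f; case: (pickle_inv k) => //=; exact: h0.
  rewrite big_allpairs_dep /=.
  apply: (@le_trans _ _ (\sum_(n0 <= n < n0 + Nm.+1) C * r ^+ n)).
    rewrite big_seq [leRHS]big_seq; apply: ler_sum => n.
    rewrite mem_index_iota => /andP[n0n _].
    apply: le_trans (hK n _); last by apply: leq_trans n0n; rewrite /n0 -addnA leq_addr.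
    rewrite /near_sum (big_nth [::]) big_seq [leRHS]big_seq; apply: ler_sum => i.
    by rewrite mem_index_iota /= => lt; rewrite /h /ok /= n0n lt.
  rewrite -mulr_sumr; apply: (@le_trans _ _ (C * (r ^+ n0 / (1 - r)))).
    by rewrite ler_wpM2l // geom_sum_le.
  by rewrite mulrCA mulrC hN1 // /n0 -addnA addnCA leq_addr.
apply: ge_ereal_inf; exists (\sum_(k <oo) cover_term dist s (cv k))%E.
  exists cv; split=> //; first move=> g pg.
  have [N hN] := pts_word pg eps0.
  have [x [xF cx nx]] := hN (n0 + N)%N (leq_addl _ _).
  pose p := ((n0 + N)%N, index x (F u (n0 + N)%:R)).
  have wdp : wd p = x by rewrite /wd /p /= nth_index.
  exists (pickle p) => //; rewrite /cv (@pickleK_inv (nat * nat)%type).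
  have -> : ok p by rewrite /ok -/(wd p) wdp nx leq_addr index_mem xF.
  by rewrite wdp.
apply: lime_le; first by apply: is_cvg_nneseries => k _ _; exact: cover_term_ge0.
apply: nearW => m; rewrite big_mkord.
apply: le_trans (_ : \sum_(k < m) (hk k)%:E <= _)%E; first by apply: lee_sum => k _.
by rewrite sumEFin lee_fin.
Qed.

(** By [pts_neq0] an empty level set forces the conjugate to be [-oo], matching the convention for
    the empty set. For a nonempty one, every exponent above some [q * al - tau q] is admissible,
    being nonnegative by [pts_conj_ge0]. *)
Lemma pts_dim al : hausdorff_dim dist (pts al) = concave_conj tau al.
Proof.
rewrite /hausdorff_dim /concave_conj; case: pselect => /= [p0|/eqP/set0P pn0].
  apply/esym/eqP; rewrite eq_le leNye andbT leNgt; apply/negP => lt.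
  set m := ereal_inf _ in lt.
  have mle q : (m <= (al * q - tau q)%:E)%E by apply: ereal_inf_lbound; exists q.
  have [D Dm] : exists D, m = D%:E.
    by move: lt (mle 0); case: m {mle} => [D| |] // _ _; exists D.
  have [|g pg] := @pts_neq0 al D; last by rewrite p0 in pg.
  by move=> q; have := mle q; rewrite Dm lee_fin [al * q]mulrC.
apply/eqP; rewrite eq_le; apply/andP; split.
  apply: le_ereal_inf_tmp => _ [q _ <-].
  apply/lee_addgt0Pr => e e0; rewrite -EFinD; apply: ereal_inf_lbound.
  exists (al * q - tau q + e) => //=; have h := pts_conj_ge0 q pn0.
  have h1 : 0 <= al * q - tau q + e by rewrite [al * q]mulrC; lra.
  by split=> //; apply: (@pts_upper al q) => //; rewrite [al * q]mulrC; lra.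
apply: le_ereal_inf_tmp => _ [s [s0 Hs] <-].
set m := ereal_inf _.
have mle q : (m <= (al * q - tau q)%:E)%E by apply: ereal_inf_lbound; exists q.
move: (mle 0) (mle) => {mle}; case: m => [D| |] // _ mle; last by rewrite leNye.
rewrite lee_fin; apply: (@pts_lower al D) => // q.
by have := mle q; rewrite lee_fin [al * q]mulrC.
Qed.

End Paths.

(** * The self-similar measure *)

Local Notation acomp := Defs.comp.

Section AffineMaps.
Variable R : realType.
Implicit Types (f g h : aff R) (D J : R * R).

Lemma app_comp f g x : app (acomp f g) x = app f (app g x).
Proof. by rewrite /app /acomp /=; ring. Qed.

Lemma comp_assoc f g h : acomp f (acomp g h) = acomp (acomp f g) h.
Proof. by rewrite /acomp /=; congr pair; ring. Qed.

Lemma comp_idl f : acomp (aff_id R) f = f.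
Proof. by case: f => a b; rewrite /acomp /aff_id /=; congr pair; ring. Qed.

Lemma comp_invK f g : f.1 != 0 -> acomp f (acomp (aff_inv f) g) = g.
Proof.
by move=> f0; case: g => a b; rewrite /acomp /aff_inv /=; congr pair; field.
Qed.

Lemma comp_Kinv f g : f.1 != 0 -> acomp (aff_inv f) (acomp f g) = g.
Proof.
by move=> f0; case: g => a b; rewrite /acomp /aff_inv /=; congr pair; field.
Qed.

Lemma Tint_image D J : Tint (image_int D J) = acomp (Tint D) (Tint J).
Proof. by rewrite /Tint /image_int /acomp /app /=; congr pair; ring. Qed.

Lemma image_int_id D : image_int D (0, 1) = D.
Proof. by case: D => a b; rewrite /image_int /app /Tint /=; congr pair; ring. Qed.

Lemma width_image D J : width (image_int D J) = width D * width J.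
Proof. by rewrite /width /image_int /app /Tint /=; ring. Qed.

Lemma app_Tint_lt D x y : D.1 < D.2 -> (app (Tint D) x < app (Tint D) y) = (x < y).
Proof. by move=> D12; rewrite /app /Tint /= ltrD2r ltr_pM2l // subr_gt0. Qed.

Lemma measurable_app f : measurable_fun [set: R] (app f).
Proof.
apply: continuous_measurable_fun => x; apply: cvgD; last exact: cvg_cst.
exact: mulrl_continuous.
Qed.

End AffineMaps.

Section SelfSimilarMeasure.
Variables (R : realType) (I : finType) (r d p : I -> R).
Variables (K : set R) (mu : probability R R).
Hypothesis r01 : forall i, 0 < `|r i| < 1.
Hypothesis p0 : forall i, 0 < p i.
Hypothesis p1 : \sum_(i : I) p i = 1.
Hypothesis Kcomp : compact K.
Hypothesis Kinv : K = \bigcup_(i in [set: I]) (app (Smap r d i) @` K).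
Hypothesis muE : forall E, measurable E ->
  mu E = (\sum_(i : I) (p i)%:E * mu (app (Smap r d i) @^-1` E))%E.
Hypothesis K01 : K `<=` [set x | 0 <= x <= 1].
Hypothesis K0 : K 0.
Hypothesis K1 : K 1.

Notation Sw := (Sw r d).
Notation pw := (pw p).

Definition pre (f : aff R) (E : set R) : set R := app f @^-1` E.
Definition m (E : set R) : R := fine (mu E).

Lemma measurable_pre f E : measurable E -> measurable (pre f E).
Proof. by move=> mE; rewrite /pre -[_ @^-1` _]setTI; apply: measurable_app. Qed.

Lemma pre_comp f g E : pre (acomp f g) E = pre g (pre f E).
Proof. by apply/seteqP; split=> x; rewrite /pre /= app_comp. Qed.

Lemma mE E : measurable E -> mu E = (m E)%:E.
Proof. by move=> h; rewrite /m fineK // fin_num_measure. Qed.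

Lemma m_ge0 E : 0 <= m E.
Proof. by rewrite /m fine_ge0. Qed.

Lemma m_le A B : measurable A -> measurable B -> A `<=` B -> m A <= m B.
Proof. by move=> a b AB; rewrite -lee_fin -!mE // le_measure // inE. Qed.

Lemma mT : m [set: R] = 1.
Proof. by rewrite /m probability_setT. Qed.

Lemma mU A B : measurable A -> measurable B -> [disjoint A & B]%classic -> m (A `|` B) = m A + m B.
Proof.
move=> a b /disj_set2P AB; apply: EFin_inj; rewrite EFinD -!mE //; last exact: measurableU.
by rewrite measureU // inE.
Qed.

Lemma m1 E : measurable E -> m E = \sum_(i : I) p i * m (pre (Smap r d i) E).
Proof.
move=> h; apply: EFin_inj; rewrite -mE // muE // -sumEFin; apply: eq_bigr => i _.
by rewrite EFinM -mE //; apply: measurable_pre.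
Qed.

Fixpoint lwords (n : nat) : seq (seq I) :=
  if n is n'.+1 then [seq i :: w | i <- enum I, w <- lwords n'] else [:: [::]].

Lemma size_lwords n w : (w \in lwords n) = (size w == n).
Proof.
elim: n w => [|n IH] [|i w] //=.
- by apply/negP => /allpairsP[[? ?] []].
- rewrite eqSS -IH; apply/allpairsP/idP => [[[a b] /= [_ bn [_ ->]]] //|wn].
  by exists (i, w); rewrite mem_enum.
Qed.

Lemma pw_gt0 w : 0 < pw w.
Proof. by apply: prodr_gt0 => i _. Qed.

Lemma pw_cons i w : pw (i :: w) = p i * pw w.
Proof. by rewrite /Defs.pw big_cons. Qed.

Lemma m_lwords n E : measurable E -> m E = \sum_(w <- lwords n) pw w * m (pre (Sw w) E).
Proof.
elim: n E => [|n IH] E hE /=.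
  rewrite big_seq1 /Defs.pw big_nil mul1r; congr m.
  by apply/seteqP; split=> x; rewrite /pre /= /app /= mul1r addr0.
rewrite big_allpairs_dep /= m1 // big_enum /=; apply: eq_bigr => i _.
rewrite (IH (pre _ E)); last exact: measurable_pre.
rewrite mulr_sumr; apply: eq_bigr => w _; rewrite pw_cons mulrA; congr (_ * m _).
by rewrite -pre_comp.
Qed.

Lemma m_prefix t n E : measurable E -> (size t <= n)%N ->
  \sum_(w <- lwords n | take (size t) w == t) pw w * m (pre (Sw w) E) = pw t * m (pre (Sw t) E).
Proof.
elim: t n E => [|i t IH] n E hE tn.
  under eq_bigl do rewrite take0 eqxx.
  rewrite -m_lwords // /Defs.pw big_nil mul1r; congr m.
  by apply/seteqP; split=> x; rewrite /pre /= /app /= mul1r addr0.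
case: n tn => // n tn; rewrite big_mkcond /= big_allpairs_dep /= big_enum /=.
rewrite (bigD1 i) //= [X in _ + X]big1 ?addr0 => [|j ji].
  rewrite -big_mkcond /=.
  under eq_bigl do rewrite eqseq_cons eqxx /=.
  under eq_bigr do rewrite pw_cons -mulrA (pre_comp (Smap r d i)).
  rewrite -mulr_sumr IH //; last exact: measurable_pre.
  by rewrite pw_cons mulrA -pre_comp.
by apply: big1 => w _; rewrite eqseq_cons (negPf ji).
Qed.

(** Iterate self-similarity to a common large word length and group the words by their unique prefix
    in [C]. This is the form adapted to the sets chosen by [Phi]. *)
Lemma m_section (C : seq (seq I)) E : measurable E -> uniq C ->
  (exists N, forall n, (N <= n)%N -> forall w : seq I, size w = n ->
     exists! s, s \in C /\ take (size s) w = s) ->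
  m E = \sum_(t <- C) pw t * m (pre (Sw t) E).
Proof.
move=> hE uC [N hN].
pose n := (N + \max_(t <- C) size t)%N.
have szC t : t \in C -> (size t <= n)%N.
  by move=> tC; rewrite /n (leq_trans _ (leq_addl _ _)) // (@leq_bigmax_seq _ C xpredT size).
transitivity (\sum_(t <- C) \sum_(w <- lwords n | take (size t) w == t) pw w * m (pre (Sw w) E)).
  rewrite (m_lwords n hE); under [RHS]eq_bigr do rewrite big_mkcond /=.
  rewrite exchange_big /= big_seq [RHS]big_seq; apply: eq_bigr => w.
  rewrite size_lwords => /eqP wn.
  have [s [[sC sw] us]] := hN n (leq_addr _ _) w wn.
  rewrite (bigD1_seq s) //= sw eqxx big_seq_cond big1 ?addr0 // => t /andP[tC ts].
  case: eqP => // tw; move: ts; rewrite (us t) ?eqxx //.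
by rewrite big_seq [RHS]big_seq; apply: eq_bigr => t tC; rewrite m_prefix // szC.
Qed.

Lemma KSw k w : K k -> K (app (Sw w) k).
Proof.
move=> Kk; elim: w => [|i w IH] /=; first by rewrite /app /= mul1r addr0.
by rewrite app_comp Kinv; exists i => //; exists (app (Sw w) k).
Qed.

Lemma K_Sw n k : K k -> exists w k', [/\ size w = n, K k' & k = app (Sw w) k'].
Proof.
elim: n k => [|n IH] k Kk; first by exists [::], k; rewrite /app /= mul1r addr0.
have := Kk; rewrite {1}Kinv => -[i _ [k1 Kk1 E]].
have [w [k' [sw Kk' Ek]]] := IH k1 Kk1.
by exists (i :: w), k'; rewrite /= sw app_comp -Ek.
Qed.

Lemma Sw_dist w x y : app (Sw w) x - app (Sw w) y = (Sw w).1 * (x - y).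
Proof. by rewrite /app; ring. Qed.

Lemma contraction : exists2 a, 0 < a < 1 & forall w, `|(Sw w).1| <= a ^+ size w.
Proof.
have [a a01 ha] : exists2 a, 0 < a < 1 & forall i, `|r i| <= a.
  have h (s : seq I) : exists2 a, 0 < a < 1 & forall i, i \in s -> `|r i| <= a.
    elim: s => [|i s [a a01 IH]]; first by exists (2^-1) => //; lra.
    exists (Num.max a `|r i|) => [|j]; first by have := r01 i; rewrite lt_max gt_max; lra.
    by rewrite inE le_max => /orP[/eqP ->|/IH -> //]; rewrite lexx orbT.
  by have [a a01 ha] := h (enum I); exists a => // i; apply: ha; rewrite mem_enum.
exists a => //; elim=> [|i w IH] /=; first by rewrite normr1.
by rewrite normrM exprS ler_pM.
Qed.

Lemma expr_lt_small (a e : R) : 0 < a < 1 -> 0 < e -> exists n, a ^+ n < e.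
Proof.
move=> /andP[a0 a1] e0.
have : (fun n => a ^+ n) @ \oo --> (0 : R) by apply: cvg_expr; rewrite ger0_norm // ltW.
move=> /cvgrPdist_lt/(_ e e0)[N _ /(_ N (leqnn _))] /=.
by rewrite sub0r normrN ger0_norm ?exprn_ge0 ?(ltW a0) // => ?; exists N.
Qed.

Lemma measurable_oo (a b : R) : measurable [set x : R | a < x < b].
Proof. by rewrite -set_itvoo; exact: measurable_itv. Qed.

Lemma measurable_cc (a b : R) : measurable [set x : R | a <= x <= b].
Proof. by rewrite -set_itvcc; exact: measurable_itv. Qed.

Lemma measurable_tail (a : R) : measurable [set x : R | a <= `|x|].
Proof.
have -> : [set x : R | a <= `|x|] = ~` [set x | - a < x < a].
  apply/seteqP; split=> x; rewrite /= -ltr_norml; first by rewrite leNgt => /negP.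
  by move=> /negP; rewrite -leNgt.
by apply: measurableC; exact: measurable_oo.
Qed.

Lemma m_tail (e : R) : 0 < e -> exists N : nat, m [set x | N%:R <= `|x|] <= e.
Proof.
move=> e0; pose F (n : nat) := [set x : R | n%:R <= `|x|].
have F0 : \bigcap_n F n = set0.
  apply/seteqP; split=> // x /(_ (Num.truncn `|x|).+1 Logic.I).
  by rewrite /F /= leNgt truncnS_gt.
have h : (mu \o F) @ \oo --> (0 : R)%:E.
  have -> : (0 : R)%:E = mu (\bigcap_n F n) by rewrite F0 measure0.
  apply: nonincreasing_cvg_mu.
  - by apply: le_lt_trans (probability_le1 _ _) _; rewrite ?ltry //; apply: measurable_tail.
  - by move=> n; apply: measurable_tail.
  - by rewrite F0.
  - move=> n k nk; apply/subsetPset => x; rewrite /F /=; apply: le_trans.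
    by rewrite ler_nat.
have /fine_cvgP[_ /cvgrPdist_le/(_ e e0)[N _ /(_ N (leqnn _))]] := h.
by rewrite /= sub0r normrN ger0_norm ?m_ge0 // => le; exists N.
Qed.

Lemma Sw0_neq0 w : (Sw w).1 != 0.
Proof.
elim: w => [|i w IH] /=; first exact: oner_neq0.
by rewrite mulf_neq0 // -normr_gt0; have /andP[] := r01 i.
Qed.

Definition far (e : R) : set R := [set x | forall k, K k -> e <= `|x - k|].

Lemma measurable_far e : measurable (far e).
Proof.
have -> : far e = ~` \bigcup_(k in K) [set x | k - e < x < k + e].
  apply/seteqP; split=> x /= h.
    by move=> [k Kk /= xk]; have := h k Kk; rewrite leNgt ltr_distl xk.
  move=> k Kk; rewrite leNgt; apply/negP => xk; apply: h; exists k => //=.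
  by rewrite -ltr_distl.
apply: measurableC; apply: open_measurable; apply: bigcup_open => k _.
by rewrite -set_itvoo; exact: interval_open.
Qed.

(** [mu] is not assumed to be carried by [K]. Long words bring every point of a bounded set close to
    [K], so the preimages of [far e] under them lie in a tail of small mass. *)
Lemma m_far e : 0 < e -> m (far e) = 0.
Proof.
move=> e0; apply/eqP; rewrite eq_le m_ge0 andbT; apply/ler_addgt0Pr => eps eps0.
rewrite add0r; have [N hN] := m_tail eps0.
have [a a01 ha] := contraction.
have N1 : 0 < N%:R + 1 :> R by rewrite ltr_wpDl.
have [n hn] := @expr_lt_small a (e / (N%:R + 1)) a01 (divr_gt0 e0 N1).
rewrite (m_lwords n (measurable_far e)).
apply: (@le_trans _ _ (\sum_(w <- lwords n) pw w * m [set x | N%:R <= `|x|])).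
  rewrite big_seq [leRHS]big_seq; apply: ler_sum => w; rewrite size_lwords => /eqP wn.
  apply: ler_wpM2l; first exact/ltW/pw_gt0.
  apply: m_le; [by apply: measurable_pre; exact: measurable_far|exact: measurable_tail|].
  move=> x /(_ _ (KSw w K0)); rewrite Sw_dist subr0 normrM => h.
  have h2 : e <= a ^+ n * `|x|.
    by apply: le_trans h _; rewrite ler_wpM2r // -wn.
  rewrite /= leNgt; apply/negP => xN; move: h2; rewrite leNgt => /negP; apply.
  have an0 : 0 <= a ^+ n by apply: exprn_ge0; lra.
  have : a ^+ n * (N%:R + 1) < e by rewrite -ltr_pdivlMr.
  have : a ^+ n * `|x| <= a ^+ n * N%:R by rewrite ler_wpM2l // ltW.
  by rewrite mulrDr; lra.
rewrite -mulr_suml; have -> : \sum_(w <- lwords n) pw w = 1; last by rewrite mul1r.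
rewrite -[RHS]mT (m_lwords n (@measurableT _ R)); apply: eq_bigr => w _.
by rewrite /pre preimage_setT mT mulr1.
Qed.

Lemma m_notK E : measurable E -> E `&` K = set0 -> m E = 0.
Proof.
move=> mEm EK; apply/eqP; rewrite eq_le m_ge0 andbT -lee_fin -mE //.
have cl : closed K by apply: compact_closed => //; exact: Rhausdorff.
have sub : E `<=` \bigcup_n far (n.+1%:R^-1).
  move=> x Ex; have nKx : ~ K x by move=> Kx; suff : set0 x by []; rewrite -EK.
  have /nbhs_ballP[e /= e0 he] : nbhs x (~` K).
    by apply: open_nbhs_nbhs; split=> //; exact: closed_openC.
  exists (Num.truncn e^-1) => // k Kk; rewrite leNgt; apply/negP => lt; apply: (he k) => //.
  rewrite /ball /=; apply: lt_le_trans lt _.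
  by rewrite invf_ple ?posrE ?ltr0n //; exact/ltW/truncnS_gt.
have mf n : measurable (far n.+1%:R^-1) by exact: measurable_far.
have mb : measurable (\bigcup_n far (n.+1%:R^-1)) by exact: bigcupT_measurable.
apply: le_trans (_ : mu (\bigcup_n far (n.+1%:R^-1)) <= _)%E.
  by apply: le_measure; rewrite ?inE.
have : mu.-negligible (\bigcup_n far (n.+1%:R^-1)).
  apply: negligible_bigcup => n; apply/negligibleP; first exact: measurable_far.
  by apply: etrans (mE (mf n)) _; rewrite m_far // invr_gt0.
by move=> /(negligibleP _ mb) h; rewrite (h : mu _ = _).
Qed.

Lemma mK : m K = 1.
Proof.
have mKm : measurable K.
  by apply: closed_measurable; apply: compact_closed => //; exact: Rhausdorff.
have := mU mKm (measurableC mKm); rewrite setUCr mT (@m_notK (~` K)) ?addr0.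
- by move=> -> //; apply/disj_set2P; exact: setICr.
- exact: measurableC.
- exact: setICl.
Qed.

(** A deep enough copy of [K] containing [k] fits into [U], and it contributes mass at least [pw w]
    because [m K = 1]. *)
Lemma m_open_gt0 (U : set R) k : measurable U -> K k -> nbhs k U -> 0 < m U.
Proof.
move=> mUm Kk /nbhs_ballP[e /= e0 he].
have [a a01 ha] := contraction; have [n hn] := expr_lt_small a01 e0.
have [w [k' [wn Kk' E]]] := K_Sw n Kk.
have mKm : measurable K.
  by apply: closed_measurable; apply: compact_closed => //; exact: Rhausdorff.
have KU : K `<=` pre (Sw w) U.
  move=> x Kx; apply: he; rewrite /ball /= E Sw_dist normrM.
  apply: le_lt_trans hn; rewrite -wn -[leRHS]mulr1; apply: ler_pM => //.
  by have := K01 Kx; have := K01 Kk'; rewrite /= ler_norml; lra.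
apply: (@lt_le_trans _ _ (pw w * m (pre (Sw w) U))).
  apply: mulr_gt0; first exact: pw_gt0.
  by apply: (@lt_le_trans _ _ 1) => //; rewrite -mK; apply: m_le => //; exact: measurable_pre.
rewrite (m_lwords n mUm) (big_rem w) /= ?size_lwords ?wn //.
by rewrite lerDl sumr_ge0 // => v _; rewrite mulr_ge0 ?m_ge0 // ltW // pw_gt0.
Qed.

Lemma seq_argmax (A : eqType) (f : A -> R) (s : seq A) : s != [::] ->
  exists2 z, z \in s & forall y, y \in s -> f y <= f z.
Proof.
elim: s => // x s IH _; have [->|/IH[z zs hz]] := eqVneq s [::].
  by exists x => [|y]; rewrite !inE // => /eqP ->.
have [xz|zx] := leP (f x) (f z).
  by exists z => [|y]; rewrite inE ?zs ?orbT // => /orP[/eqP ->|/hz].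
exists x => [|y]; first by rewrite mem_head.
by rewrite inE => /orP[/eqP -> //|/hz/le_trans->] //; exact: ltW.
Qed.

Lemma m_points (s : seq R) : uniq s -> \sum_(y <- s) m [set y] <= 1.
Proof.
move=> us; have ms (t : seq R) : measurable [set` t].
  apply: countable_measurable => //; apply: finite_set_countable; exact: finite_seq.
have -> : \sum_(y <- s) m [set y] = m [set` s].
  elim: s us => [|y s IH] /=; first by rewrite big_nil set_nil /m measure0.
  move=> /andP[ys us]; rewrite big_cons IH //.
  rewrite (_ : [set` y :: s] = [set y] `|` [set` s]) ?mU //; last first.
    apply/seteqP; split=> z /=; rewrite inE; first by case/orP => [/eqP|]; [left|right].
    by case=> [->|->]; rewrite ?eqxx ?orbT.
  by apply/disj_set2P/seteqP; split=> // z [/= ->] /=; rewrite (negPf ys).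
by rewrite -mT; apply: m_le.
Qed.

(* The atoms of maximal mass would form a finite set invariant under every inverse map,
   hence a common fixed point of all the contractions. *)
Lemma m_atom x : m [set x] = 0.
Proof.
pose a y := m [set y].
apply/eqP; apply: contraT => ax0'.
have ax0 : 0 < a x by rewrite lt_neqAle m_ge0 eq_sym ax0'.
pose P n := `[< exists s : seq R, [/\ uniq s, size s = n & forall y, y \in s -> a x <= a y] >].
have exP : exists n, P n by exists 0%N; apply/asboolP; exists [::].
have ubP n : P n -> (n <= Num.truncn (a x)^-1)%N.
  move=> /asboolP[s [us <- hs]]; rewrite -ltnS -(ltr_nat R).
  apply: le_lt_trans (truncnS_gt _); rewrite -[leRHS]mul1r ler_pdivlMr //.
  apply: le_trans (m_points us); rewrite mulr_natl -[leLHS]iter_addr_0.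
  by rewrite -count_predT -big_const_seq big_seq [leRHS]big_seq; apply: ler_sum.
case: (ex_maxnP exP ubP) => n /asboolP[s [us sn hs]] nmax.
have ins y : a x <= a y -> y \in s.
  move=> ay; apply: contraT => ys.
  have : P n.+1.
    apply/asboolP; exists (y :: s); rewrite /= ys us sn; split=> // z.
    by rewrite inE => /orP[/eqP ->|/hs].
  by move=> /nmax; rewrite ltnn.
have [|z zs zmax] := @seq_argmax _ a s.
  by apply: contraTneq (ins x (lexx _)) => ->.
have tmax y : a y <= a z.
  have [/ins/zmax //|/ltW lt] := leP (a x) (a y).
  by apply: le_trans lt _; exact: hs.
pose L := [seq y <- s | a y == a z].
have zL : z \in L by rewrite mem_filter eqxx zs.
have inL y : (y \in L) = (a y == a z).
  rewrite mem_filter; case: eqP => //= ay; apply: ins; rewrite ay; exact: hs.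
pose g i y := (y - d i) / r i.
have r0 i : r i != 0 by rewrite -normr_gt0; have /andP[] := r01 i.
(* The mass at [y] is a convex combination, with positive weights, of the masses at the [g j y].
   None exceeds the maximum, so all of them attain it. *)
have gL i y : y \in L -> g i y \in L.
  rewrite !inL => /eqP ay; apply/eqP.
  have : \sum_(j : I) p j * (a z - a (g j y)) = 0.
    under eq_bigr do rewrite mulrBr.
    rewrite sumrB -mulr_suml p1 mul1r -ay /a [X in X - _]m1 //; apply/eqP.
    rewrite subr_eq0; apply/eqP; apply: eq_bigr => j _; congr (_ * m _).
    apply/seteqP; split=> v; rewrite /pre /g /= /app /=.
      by move=> <-; field.
    by move=> ->; field.
  move=> /psumr_eq0P/(_ i isT) H; apply/esym/eqP; rewrite -subr_eq0.
  have /eqP := H (fun j _ => mulr_ge0 (ltW (p0 j)) (eq_ind_r is_true (tmax (g j y)) (subr_ge0 _ _))).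
  by rewrite mulf_eq0 gt_eqF //= p0.
(* [g i] expands distances to the fixed point [q] of the contraction and preserves [L]; the point of
   [L] farthest from [q] is therefore [q] itself, and [L] reduces to it. *)
have fixz i : app (Smap r d i) z = z.
  pose q := d i / (1 - r i).
  have r1 : 1 - r i != 0.
    rewrite subr_eq0 eq_sym; apply/eqP => ri.
    by have /andP[_] := r01 i; rewrite ri normr1 ltxx.
  have [|y yL ymax] := @seq_argmax _ (fun y => `|y - q|) L; first by case: (L) zL.
  have /ymax := gL i y yL.
  have -> : g i y - q = (y - q) / r i by rewrite /g /q; field; rewrite r0 r1.
  rewrite normrM normfV ler_pdivrMr ?normr_gt0 // => yq.
  have y0 : `|y - q| <= 0.
    by have /andP[_ ri1] := r01 i; have := normr_ge0 (y - q); nra.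
  have := le_trans (ymax z zL) y0; rewrite normr_le0 subr_eq0 => /eqP ->.
  by rewrite /app /= /q; field.
have fixw w : app (Sw w) z = z.
  by elim: w => [|i w IH] /=; rewrite ?app_comp ?IH // /app /= mul1r addr0.
have Kz k : K k -> k = z.
  move=> Kk; apply/eqP; rewrite -subr_eq0 -normr_le0; apply/ler_addgt0Pr => e e0.
  have [b b01 hb] := contraction.
  have z1 : 0 < 1 + `|z| by rewrite ltr_wpDr.
  have [N hN] := expr_lt_small b01 (divr_gt0 e0 z1).
  have [w [k' [wN Kk' ->]]] := K_Sw N Kk.
  rewrite add0r -{1}(fixw w) Sw_dist normrM; apply: (@le_trans _ _ (b ^+ N * (1 + `|z|))).
    apply: ler_pM => //; first by rewrite -wN.
    apply: le_trans (ler_normB _ _) _; rewrite lerD2r.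
    by have := K01 Kk'; rewrite /= ler_norml; lra.
  by rewrite -ler_pdivlMr // ltW.
by have := Kz 0 K0; rewrite -(Kz 1 K1) => /eqP; rewrite eq_sym oner_eq0.
Qed.

(** [rho] measures closed intervals while [Inv] describes the interior; the absence of atoms bridges
    the two. *)
Lemma m_cc (a b : R) : m [set x | a <= x <= b] = m [set x | a < x < b].
Proof.
apply/eqP; rewrite eq_le; apply/andP; split; last first.
  apply: m_le; [exact: measurable_oo|exact: measurable_cc|].
  by move=> x /= /andP[/ltW -> /ltW ->].
have mo := measurable_oo a b.
apply: (@le_trans _ _ (m ([set x | a < x < b] `|` ([set a] `|` [set b])))).
  apply: m_le; [exact: measurable_cc|by do 2! apply: measurableU => //|].
  move=> x /= /andP[ax xb]; have [->|xa] := eqVneq x a; first by right; left.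
  have [->|xb'] := eqVneq x b; first by right; right.
  by left; rewrite !lt_neqAle eq_sym xa ax xb' xb.
have mle (A B : set R) : measurable A -> measurable B -> m (A `|` B) <= m A + m B.
  move=> hA hB; rewrite -lee_fin EFinD -!mE //; last exact: measurableU.
  exact: measureU2.
apply: le_trans (mle _ _ _ _) _ => //; first exact: measurableU.
rewrite gerDl; apply: le_trans (mle _ _ _ _) _ => //.
by rewrite !m_atom addr0.
Qed.

(** * Net intervals and transition matrices *)

Variables (ltA : rel (aff R)) (Phi : seq (aff R) -> seq (seq (seq I))).
Hypothesis ltAP : strict_total_order ltA.
Hypothesis PhiP : iteration_rule r d K ltA Phi.

Notation fmu := (Defs.fmu mu).
Notation rawM := (Defs.rawM r d p mu Phi).
Notation trivM := (Defs.trivM r d p mu Phi).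
Notation edgeM := (Defs.edgeM r d p mu Phi).
Notation pathM := (Defs.pathM r d p mu Phi).
Notation inY := (Defs.inY r d Phi).
Notation raw_child := (Defs.raw_child r d K ltA Phi).
Notation triv := (Defs.triv r d K ltA Phi).
Notation triv_chain := (Defs.triv_chain r d K ltA Phi).
Notation net := (Defs.net r d K ltA Phi).
Notation is_edge := (Defs.is_edge r d K ltA Phi).
Notation step := (Defs.step r d K ltA Phi).
Notation at_ v i := (nth (aff_id R) v i).

Definition oint (D : R * R) : set R := [set x | D.1 < x < D.2].

(* [mu] restricted to the interior of the net interval [D] decomposes along the
   neighbours, with (normalised) coefficients [y]; transition matrices act on [y]. *)
Record Inv (D : R * R) (v : seq (aff R)) (y : nat -> R) : Prop := MkInv {
  inv_lt : D.1 < D.2;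
  inv_sorted : sorted ltA v;
  inv_slope : all (fun f => f.1 != 0) v;
  inv_meet : forall f, f \in v -> exists2 k, K k & 0 < app f k < 1;
  inv_size : (0 < size v)%N;
  inv_pos : forall i, (i < size v)%N -> 0 < y i;
  inv_m : forall E, measurable E -> E `<=` oint D ->
    m E = \sum_(i < size v) y i * fmu (at_ v i) * m (pre (acomp (Tint D) (at_ v i)) E) }.

Definition vec (n : nat) (y : nat -> R) (A : mat R) : nat -> R :=
  fun j => \sum_(i < n) y i * A i j.

Lemma vec_mulm n k y A B j : vec n y (mulm k A B) j = vec k (vec n y A) B j.
Proof.
rewrite /vec /mulm; under eq_bigr do rewrite mulr_sumr.
rewrite exchange_big /=; apply: eq_bigr => l _; rewrite mulr_suml.
by apply: eq_bigr => i _; rewrite mulrA.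
Qed.

Lemma vec_idm n y j : (j < n)%N -> vec n y (idm R) j = y j.
Proof.
move=> jn; rewrite /vec (bigD1 (Ordinal jn)) //= /idm eqxx mulr1 big1 ?addr0 // => i ij.
by rewrite (_ : (_ == _) = false) ?mulr0 //; apply: contraNF ij => /eqP ij; apply/eqP/val_inj.
Qed.

Lemma Inv_ext D v y y' : (forall i, (i < size v)%N -> y i = y' i) -> Inv D v y -> Inv D v y'.
Proof.
move=> E [h1 h2 h3 h4 h5 h6 h7]; split=> // [i iv|S mS SD]; first by rewrite -E // h6.
by rewrite h7 //; apply: eq_bigr => i _; rewrite E.
Qed.

Lemma fmu_ge0 f : 0 <= fmu f.
Proof. exact: m_ge0. Qed.

Lemma fmu_gt0 f k : K k -> 0 < app f k < 1 -> 0 < fmu f.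
Proof.
move=> Kk fk; have mo := measurable_pre f (measurable_oo 0 1).
apply: (m_open_gt0 mo Kk).
have cf : {for k, continuous (app f)}.
  apply: cvgD; last exact: cvg_cst.
  exact: mulrl_continuous.
apply: (cf); have -> : [set x : R | 0 < x < 1] = `]0, 1[%classic by rewrite set_itvoo.
by apply: open_nbhs_nbhs; split; [exact: interval_open|rewrite /= in_itv].
Qed.

Lemma rawM_ge0 v J v' i j : 0 <= rawM v J v' i j.
Proof.
rewrite /Defs.rawM mulr_ge0 //; first by rewrite mulr_ge0 ?invr_ge0 ?fmu_ge0.
by apply: sumr_ge0 => w _; exact/ltW/pw_gt0.
Qed.

Lemma trivM_ge0 w c i j : 0 <= trivM w c i j.
Proof.
elim: c w i j => [|w' c IH] w i j /=; first by rewrite /idm ler0n.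
by apply: sumr_ge0 => k _; rewrite mulr_ge0 ?rawM_ge0.
Qed.

Lemma edgeM_ge0 e i j : 0 <= edgeM e i j.
Proof.
rewrite /Defs.edgeM; case: (echain e) => [|w c]; first by rewrite /idm ler0n.
by apply: sumr_ge0 => k _; rewrite mulr_ge0 ?rawM_ge0 ?trivM_ge0.
Qed.

Lemma pathM_ge0 es i j : 0 <= pathM es i j.
Proof.
elim: es i j => [|e es IH] i j /=; first by rewrite /idm ler0n.
by apply: sumr_ge0 => k _; rewrite mulr_ge0 ?edgeM_ge0.
Qed.

Lemma ltA_sorted_eq (v v' : seq (aff R)) : sorted ltA v -> sorted ltA v' -> v =i v' -> v = v'.
Proof. by case: ltAP => irr tr _; apply: irr_sorted_eq. Qed.

Lemma ltA_sorted_uniq (v : seq (aff R)) : sorted ltA v -> uniq v.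
Proof. by case: ltAP => irr tr _; apply: sorted_uniq. Qed.

Lemma Phi_section v : sorted ltA v -> all (fun f => f.1 != 0) v ->
  forall i, (i < size v)%N -> forall E, measurable E ->
  m E = \sum_(t <- nth [::] (Phi v) i) pw t * m (pre (Sw t) E).
Proof.
move=> sv av i iv E hE; case: PhiP => /(_ v sv av)[_ /(_ i iv)[uC hC]] _ _.
exact: m_section.
Qed.

Lemma acomp_inj (f g h : aff R) : f.1 != 0 -> acomp f g = acomp f h -> g = h.
Proof. by move=> f0 E; rewrite -(comp_Kinv g f0) E comp_Kinv. Qed.

Lemma cutpt_in D v z : D.1 < D.2 -> cutpt r d Phi D v z -> D.1 <= z <= D.2.
Proof.
by move=> D12 [->|[->|[g [w [_ _ h ->]]]]] //; rewrite lexx ltW.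
Qed.

Lemma child_pos D v J v' : D.1 < D.2 -> raw_child (D, v) (image_int D J, v') ->
  [/\ 0 <= J.1, J.1 < J.2 & J.2 <= 1].
Proof.
move=> D12 [[/= c1 c2 lt _] _].
have := cutpt_in D12 c1; have := cutpt_in D12 c2; move: lt.
rewrite /app /Tint /=; have D0 : 0 < D.2 - D.1 by rewrite subr_gt0.
by move=> h1 /andP[_ h2] /andP[h3 _]; split; nra.
Qed.

(** In coordinates relative to [D] the description of the neighbours no longer mentions [D], which
    expresses that they depend on [v] and the position [J] alone. *)
Lemma child_nbr D v J v' : D.1 < D.2 -> raw_child (D, v) (image_int D J, v') ->
  forall h, h \in v' <-> exists i t, [/\ (i < size v)%N, t \in nth [::] (Phi v) i,
    exists2 k, K k & J.1 < app (acomp (at_ v i) (Sw t)) k < J.2 &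
    acomp (Tint J) h = acomp (at_ v i) (Sw t)].
Proof.
move=> D12 rc; have [_ J12 _] := child_pos D12 rc.
case: rc => _ [_ _ hv'] h; apply: iff_trans (hv' h) _ => /=.
have D0 : (Tint D).1 != 0 by rewrite /= subr_eq0 gt_eqF.
have J0 : (Tint J).1 != 0 by rewrite /= subr_eq0 gt_eqF.
have DJ0 : (Tint (image_int D J)).1 != 0 by rewrite Tint_image /= mulf_neq0.
split=> [[g [[i [iv [t tC ->]]] [k Kk kP] ->]]|[i [t [iv tC [k Kk kP] E]]]].
  exists i, t; split=> //.
    by exists k => //; move: kP; rewrite app_comp /image_int /= !app_Tint_lt.
  apply: (acomp_inj D0); by rewrite (comp_assoc (Tint D) (Tint J)) -Tint_image comp_invK.
exists (acomp (Tint D) (acomp (at_ v i) (Sw t))); split.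
- by exists i; split=> //; exists t.
- by exists k => //; rewrite app_comp /image_int /= !app_Tint_lt.
- by rewrite -E (comp_assoc (Tint D) (Tint J)) -Tint_image comp_Kinv.
Qed.

Lemma pre_oint (D J : R * R) f x : D.1 < D.2 -> oint (image_int D J) (app (acomp (Tint D) f) x) =
  (J.1 < app f x < J.2).
Proof. by move=> D12; rewrite /oint /= app_comp !app_Tint_lt. Qed.

Lemma image_lt (D J : R * R) : D.1 < D.2 -> J.1 < J.2 -> (image_int D J).1 < (image_int D J).2.
Proof. by move=> D12 J12; rewrite /image_int /= app_Tint_lt. Qed.

Lemma image_sub (D J : R * R) : D.1 < D.2 -> 0 <= J.1 -> J.2 <= 1 ->
  D.1 <= (image_int D J).1 /\ (image_int D J).2 <= D.2.
Proof. by rewrite -subr_gt0 /image_int /app /Tint /= => h1 h2 h3; split; nra. Qed.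

(** The child is witnessed at [D0], but the decomposition is wanted at [D]; the link is the common
    neighbour set [v], through [child_nbr]. Each neighbour is split along its section and the pieces
    are regrouped by the neighbour of the child that they equal. Pieces missing the interior carry
    no mass there, since [mu] lives on [K]. *)
Lemma Inv_raw D v y D0 y0 J v' : Inv D v y -> Inv D0 v y0 ->
  raw_child (D0, v) (image_int D0 J, v') -> Inv (image_int D J) v' (vec (size v) y (rawM v J v')).
Proof.
move=> iD iD0 rc; have D12 := inv_lt iD; have D012 := inv_lt iD0.
have [J0 J12 J1] := child_pos D012 rc; have nbr := child_nbr D012 rc.
have sv' : sorted ltA v' by case: rc => _ [].
have uv' := ltA_sorted_uniq sv'.
have TJ0 : (Tint J).1 != 0 by rewrite /= subr_eq0 gt_eqF.
have av' : all (fun f => f.1 != 0) v'.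
  apply/allP => h /nbr[i [t [iv _ _ E]]]; move: (congr1 fst E) => /= E1.
  have : (J.2 - J.1) * h.1 != 0.
    by rewrite E1 mulf_neq0 ?Sw0_neq0 // (allP (inv_slope iD)) // mem_nth.
  by rewrite mulf_eq0 negb_or => /andP[].
have meet' h : h \in v' -> exists2 k, K k & 0 < app h k < 1.
  move=> /nbr[i [t [_ _ [k Kk kP] E]]]; exists k => //.
  move: kP; rewrite -E app_comp.
  have {1}-> : J.1 = app (Tint J) 0 by rewrite /app /= mulr0 add0r.
  have {1}-> : J.2 = app (Tint J) 1 by rewrite /app /= mulr1 subrK.
  by rewrite !app_Tint_lt.
have fpos h : h \in v' -> fmu h != 0.
  by move=> /meet'[k Kk kP]; rewrite gt_eqF // (fmu_gt0 Kk kP).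
have formula E : measurable E -> E `<=` oint (image_int D J) ->
  m E = \sum_(j < size v') vec (size v) y (rawM v J v') j * fmu (at_ v' j) *
     m (pre (acomp (Tint (image_int D J)) (at_ v' j)) E).
  move=> hE EJ; have [s1 s2] := image_sub D12 J0 J1.
  rewrite (inv_m iD) //; last first.
    by move=> x /EJ /andP[h1 h2]; rewrite /oint /= (le_lt_trans s1) // (lt_le_trans h2).
  transitivity (\sum_(i < size v) \sum_(j < size v') y i * rawM v J v' i j * fmu (at_ v' j) *
     m (pre (acomp (Tint (image_int D J)) (at_ v' j)) E)); last first.
    rewrite exchange_big /=; apply: eq_bigr => j _; rewrite /vec !mulr_suml.
    by apply: eq_bigr => i _.
  apply: eq_bigr => i _; have iv := ltn_ord i.
  rewrite (@Phi_section v (inv_sorted iD) (inv_slope iD) i iv); last exact: measurable_pre.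
  rewrite mulr_sumr.
  under [RHS]eq_bigr => j _.
    (* The factor [fmu] of the new neighbour cancels the denominator in [rawM], so that normalised
       coefficients are mapped to normalised coefficients. *)
    have -> : y i * rawM v J v' i j * fmu (at_ v' j) = y i * fmu (at_ v i) *
       \sum_(w <- nth [::] (Phi v) i | acomp (at_ v i) (Sw w) == acomp (Tint J) (at_ v' j)) pw w.
      rewrite /Defs.rawM; move: (\sum_(w <- _ | _) _) => S.
      by field; apply: fpos; rewrite mem_nth.
    rewrite -mulrA mulr_suml mulr_sumr big_mkcond /=.
    over.
  rewrite exchange_big /= big_seq [RHS]big_seq; apply: eq_bigr => t tC.
  pose g0 := acomp (at_ v i) (Sw t).
  have -> : pre (Sw t) (pre (acomp (Tint D) (at_ v i)) E) = pre (acomp (Tint D) g0) E.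
    by rewrite -pre_comp /g0 comp_assoc.
  have [[k Kk kP]|nk] := pselect (exists2 k, K k & J.1 < app g0 k < J.2); last first.
    have -> : m (pre (acomp (Tint D) g0) E) = 0.
      apply: m_notK; first exact: measurable_pre.
      apply/seteqP; split=> // x [/EJ Ex Kx]; apply: nk; exists x => //.
      by move: Ex; rewrite pre_oint.
    rewrite !mulr0 big1 // => j _; case: eqP => // E1; exfalso; apply: nk.
    have [|i' [t' [_ _ kk E2]]] := (nbr (at_ v' j)).1; first by rewrite mem_nth.
    by case: kk => k Kk kP; exists k => //; rewrite /g0 E1 E2.
  pose h := acomp (aff_inv (Tint J)) g0.
  have hE' : acomp (Tint J) h = g0 by rewrite comp_invK.
  have hv' : h \in v' by apply/nbr; exists i, t; split=> //; exists k.
  have hi : (index h v' < size v')%N by rewrite index_mem.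
  rewrite (bigD1 (Ordinal hi)) //= nth_index // hE' eqxx big1 ?addr0 => [|j jh].
    by rewrite Tint_image -comp_assoc hE'.
  case: eqP => // E1; exfalso; move/eqP: jh; apply; apply/val_inj => /=.
  by rewrite (acomp_inj TJ0 (etrans hE' E1)) index_uniq.
(* At [D0] the interior of the child meets [K], hence has positive mass; the decomposition [iD0] can
   account for it only through some neighbour. *)
have size' : (0 < size v')%N.
  rewrite lt0n; apply/negP => /eqP /size0nil v'0.
  case: (rc) => _ [[k Kk kP] _ _].
  have mo := measurable_oo (image_int D0 J).1 (image_int D0 J).2.
  have : 0 < m (oint (image_int D0 J)).
    apply: (m_open_gt0 mo Kk); rewrite /oint -set_itvoo; apply: open_nbhs_nbhs.
    by split; [exact: interval_open|rewrite /= in_itv].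
  have [s1 s2] := image_sub D012 J0 J1.
  rewrite (inv_m iD0) //; last first.
    by move=> x /andP[h1 h2]; rewrite /oint /= (le_lt_trans s1) // (lt_le_trans h2).
  rewrite big1 ?ltxx // => i _; have iv := ltn_ord i.
  rewrite (@Phi_section v (inv_sorted iD) (inv_slope iD) i iv); last exact: measurable_pre.
  rewrite [X in _ * X]big_seq [X in _ * X]big1 ?mulr0 // => t tC.
  rewrite -pre_comp -comp_assoc m_notK ?mulr0 //; first exact: measurable_pre.
  apply/seteqP; split=> // x [+ Kx]; rewrite /pre /preimage /= pre_oint // => kx.
  have : acomp (aff_inv (Tint J)) (acomp (at_ v i) (Sw t)) \in v'.
    by apply/nbr; exists i, t; split=> //; [exists x|rewrite comp_invK].
  by rewrite v'0.
split=> //; first exact: image_lt.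
move=> j jv'; rewrite /vec.
(* Every neighbour of the child comes from some piece, so each column of the matrix has a positive
   entry and the new coefficients stay positive. *)
have [i [t [iv tC _ E]]] := (nbr (at_ v' j)).1 (mem_nth _ jv').
have h1 i' : (i' < size v)%N -> 0 <= y i' * rawM v J v' i' j.
  by move=> iv'; rewrite mulr_ge0 ?rawM_ge0 // ltW // (inv_pos iD).
rewrite (bigD1 (Ordinal iv)) //= ltr_pwDl //; last first.
  by apply: sumr_ge0 => i' _; exact: h1.
rewrite mulr_gt0 ?(inv_pos iD) // /Defs.rawM mulr_gt0 //.
  have vi : at_ v i \in v by rewrite mem_nth.
  have [k1 K1' kP1] := inv_meet iD vi.
  have [k2 K2' kP2] := meet' _ (mem_nth (aff_id R) jv').
  by rewrite divr_gt0 ?(fmu_gt0 K1' kP1) ?(fmu_gt0 K2' kP2).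
rewrite (big_rem t tC) /= E eqxx ltr_pwDl ?pw_gt0 // sumr_ge0 // => w _.
exact/ltW/pw_gt0.
Qed.

Lemma Inv_child (x z : pair_t R) y : Inv x.1 x.2 y -> raw_child x z ->
  exists y', Inv z.1 z.2 y'.
Proof.
case: x z => [D v] [D' v'] /= iD rc; have D12 := inv_lt iD.
have w0 : D.2 - D.1 != 0 by rewrite subr_eq0 gt_eqF.
pose J := ((D'.1 - D.1) / (D.2 - D.1), (D'.2 - D.1) / (D.2 - D.1)).
have DJ : D' = image_int D J.
  by rewrite [LHS]surjective_pairing /image_int /app /Tint /=; congr pair; field.
by exists (vec (size v) y (rawM v J v')); rewrite DJ; apply: (Inv_raw iD iD); rewrite -DJ.
Qed.

Lemma Inv_triv_chain (x : pair_t R) c y : Inv x.1 x.2 y -> triv_chain x c ->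
  exists y', Inv (last x c).1 (last x c).2 y'.
Proof.
elim: c x y => [|z c IH] x y /= ix; first by exists y.
by move=> [[rc _ _] tc]; have [y' iz] := Inv_child ix rc; apply: (IH z y').
Qed.

(** The images of [0] and [1] under one contraction are distinct points of [K] less than [1] apart,
    so one of them lies inside. *)
Lemma K_inner : exists2 k, K k & 0 < k < 1.
Proof.
have [i _] : exists i : I, True.
  apply: contrapT => nI; move: p1; rewrite big1 => [/eqP|i _]; last by case: nI; exists i.
  by rewrite eq_sym oner_eq0.
have Ka : K (app (Smap r d i) 0) by rewrite Kinv; exists i => //; exists 0.
have Kb : K (app (Smap r d i) 1) by rewrite Kinv; exists i => //; exists 1.
have := K01 Ka; have := K01 Kb; rewrite /= /app /= mulr0 add0r mulr1 => b01 a01.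
have [/eqP d0|dn0] := boolP (d i == 0).
  exists (r i + d i); first by move: Kb; rewrite /app /= mulr1.
  move: b01 (r01 i); rewrite d0 addr0 => /andP[r0 _]; rewrite normr_gt0 ger0_norm //.
  by move=> /andP[rn0 ->]; rewrite lt_neqAle eq_sym rn0 r0.
have [/eqP d1|dn1] := boolP (d i == 1).
  exists (r i + d i); first by move: Kb; rewrite /app /= mulr1.
  move: b01 (r01 i); rewrite d1 => /andP[h1 h2] /andP[h3 h4]; move: h4.
  have r0 : r i <= 0 by lra.
  rewrite normr_gt0 in h3; rewrite ler0_norm // => h4; have : r i < 0 by rewrite lt_neqAle h3.
  by lra.
exists (d i); first by move: Ka; rewrite /app /= mulr0 add0r.
by case/andP: a01 => a0 a1; rewrite !lt_neqAle eq_sym dn0 a0 dn1 a1.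
Qed.

Lemma Inv_root : Inv (0, 1) [:: aff_id R] (fun=> (fmu (aff_id R))^-1).
Proof.
have [k Kk kP] := K_inner.
have kid : 0 < app (aff_id R) k < 1 by rewrite /app /= mul1r addr0.
have f0 := fmu_gt0 Kk kid.
split=> //=.
- by rewrite oner_neq0.
- by move=> f; rewrite inE => /eqP ->; exists k.
- by move=> i _; rewrite invr_gt0.
- move=> E hE _; rewrite big_ord1 mulVf ?gt_eqF // mul1r; congr m.
  apply/seteqP; split=> x; rewrite /pre /preimage /= app_comp /app /=.
    by rewrite subr0 !mul1r !addr0.
  by rewrite subr0 !mul1r !addr0.
Qed.

Lemma Inv_net n x : net n x -> exists y, Inv x.1 x.2 y.
Proof.
elim=> [c tc|{}n {}x c _ [y ix] [z [c' [-> [rc tc]]]]].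
  exact: (@Inv_triv_chain (root_pair R) c _ Inv_root tc).
by have [y1 iz] := Inv_child ix rc; exact: (Inv_triv_chain iz tc).
Qed.

Lemma triv_chain_normal x c : triv_chain x c -> normal r d K ltA Phi (last x c).
Proof. by elim: c x => [|z c IH] x //= [_ /IH]. Qed.

Lemma net_normal n x : net n x -> normal r d K ltA Phi x.
Proof.
case=> [c /triv_chain_normal //|{}n {}x c _ [z [c' [-> [_ tc]]]]].
exact: (triv_chain_normal tc).
Qed.

Lemma triv_chain_uniq x c c' : triv_chain x c -> triv_chain x c' -> c = c'.
Proof.
elim: c c' x => [|z c IH] [|z' c'] x //=.
- by move=> nx [t _]; case: nx; exists z'.
- by move=> [t _] nx; case: nx; exists z.
- move=> [t tc] [t' tc']; have e : z = z'.
    by case: t' => _ _; apply; case: t.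
  by rewrite -e in tc' *; rewrite (IH c' z).
Qed.

Lemma root_uniq D v v' : net 0 (D, v) -> net 0 (D, v') -> v = v'.
Proof.
have h x : net 0 x -> exists2 c, triv_chain (root_pair R) c & x = last (root_pair R) c.
  move E : 0%N => n hx; case: hx E => [c tc _|//]; by exists c.
by move=> /h[c tc e] /h[c' tc' e']; move: e e'; rewrite (triv_chain_uniq tc tc') => <- [].
Qed.

(** A child filling the whole interval leaves no interior cut point, so it is the only child,
    against normality. This makes edge weights smaller than [1] and their logarithmic lengths
    positive. *)
Lemma raw_child_lt x z : raw_child x z -> x.1.1 < x.1.2 -> normal r d K ltA Phi x -> z.1 <> x.1.
Proof.
move=> rc x12 nx zx; apply: nx; exists z; split=> // z' rc'.
case: x z z' rc rc' x12 zx => [D v] [D1 v1] [D2 v2] /= rc rc' D12 E; subst D1.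
case: rc => -[/= _ _ _ nocut] [_ s1 h1]; case: rc' => -[/= c1 c2 lt _] [_ s2 h2].
have end_ z : cutpt r d Phi D v z -> z = D.1 \/ z = D.2.
  move=> cz; have /andP[a b] := cutpt_in D12 cz.
  have := nocut z cz; move: a b; rewrite !le_eqVlt => /orP[/eqP|a] ; first by left.
  by move=> /orP[/eqP|b]; [right|rewrite a b => /(_ isT)].
have ED : D2 = D.
  rewrite [LHS]surjective_pairing [RHS]surjective_pairing.
  case: (end_ _ c1) lt => ->; case: (end_ _ c2) => -> //; rewrite ?ltxx //.
  by move=> /(lt_trans D12); rewrite ltxx.
subst D2; congr pair; apply: ltA_sorted_eq => // h.
by apply/idP/idP => [/h2/h1|/h1/h2].
Qed.

Lemma edge_data e : is_edge e -> exists n D0 w ws,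
  [/\ net n (D0, esrc e), echain e = w :: ws,
      raw_child (D0, esrc e) (image_int D0 (epos e), w) &
      triv_chain (image_int D0 (epos e), w) [seq (image_int D0 (epos e), x) | x <- ws]].
Proof.
move=> [n [D [c [hn [z [c' [Ec [rc tc]]]] E]]]]; exists n, D.
case Ech : (echain e) E => [|w ws] /=; first by rewrite Ec.
by rewrite Ec => -[Ez Ec']; exists w, ws; rewrite -Ez -Ec'.
Qed.

Lemma Inv_triv_at D D0 w ws y y0 : Inv D w y -> Inv D0 w y0 ->
  triv_chain (D0, w) [seq (D0, x) | x <- ws] ->
  Inv D (last w ws) (vec (size w) y (trivM w ws)).
Proof.
elim: ws w y y0 => [|w' ws IH] w y y0 iD iD0 /=.
  by move=> _; apply: Inv_ext iD => i iw; rewrite vec_idm.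
move=> [[rc _ _] tc].
have rc' : raw_child (D0, w) (image_int D0 (0, 1), w') by rewrite image_int_id.
have := Inv_raw iD iD0 rc'; have := Inv_raw iD0 iD0 rc'; rewrite !image_int_id => i0 i1.
apply: (@Inv_ext _ _ (vec (size w') (vec (size w) y (rawM w (0, 1) w')) (trivM w' ws))).
  by move=> i _; rewrite vec_mulm.
exact: (IH _ _ _ i1 i0 tc).
Qed.

Lemma Inv_edge D e y : is_edge e -> Inv D (esrc e) y ->
  Inv (image_int D (epos e)) (etgt e) (vec (size (esrc e)) y (edgeM e)).
Proof.
move=> /edge_data[n [D0 [w [ws [hn Ech rc tc]]]]] iD.
have [y0 /= iD0] := Inv_net hn.
have i1 := Inv_raw iD iD0 rc; have i0 := Inv_raw iD0 iD0 rc.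
have := Inv_triv_at i1 i0 tc; rewrite /etgt -/(esrc e) -/(echain e) Ech /=.
by apply: Inv_ext => i _; rewrite /Defs.edgeM Ech vec_mulm.
Qed.

Lemma edge_pos e : is_edge e -> [/\ 0 <= (epos e).1, (epos e).2 <= 1 &
  0 < edge_weight e < 1].
Proof.
move=> /edge_data[n [D0 [w [ws [hn Ech rc tc]]]]].
have [y0 /= iD0] := Inv_net hn; have D12 := inv_lt iD0.
have [h1 h2 h3] := child_pos D12 rc; split=> //.
rewrite /edge_weight /width subr_gt0 h2 /= lt_neqAle; apply/andP; split; last by lra.
apply/eqP => E; apply: (raw_child_lt rc D12 (net_normal hn)) => /=.
rewrite -[RHS]image_int_id; congr image_int; rewrite [LHS]surjective_pairing.
by congr pair; lra.
Qed.

Lemma edge_src e : is_edge e -> is_vertex r d K ltA Phi (esrc e).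
Proof. by move=> [n [D [c [hn _ _]]]]; exists n, D. Qed.

Lemma edge_tgt e : is_edge e -> is_vertex r d K ltA Phi (etgt e).
Proof.
move=> [n [D [c [hn hs E]]]]; exists n.+1, (last (D, esrc e) c).1.
have -> : ((last (D, esrc e) c).1, etgt e) = last (D, esrc e) c.
  rewrite [RHS]surjective_pairing; congr pair; rewrite E /etgt -/(esrc e) -/(echain e).
  case: (echain e) => //= w ws; elim: ws w => //=.
exact: (netS hn).
Qed.

(** [is_path] gives the empty path no starting vertex; fixing one makes concatenation and induction
    uniform. *)
Fixpoint epath (v : seq (aff R)) (s : seq (edge R)) : Prop :=
  if s is e :: s' then [/\ is_edge e, esrc e = v & epath (etgt e) s'] else True.

Notation eend v s := (lend (@etgt R) v s).

Lemma epath_cat v s t : epath v (s ++ t) <-> epath v s /\ epath (eend v s) t.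
Proof.
elim: s v => [|e s IH] v /=; first by rewrite /lend /=; split=> [|[]].
split=> [[he <- /IH[h1 h2]] //|[[he <- h1] h2]]; split=> //; exact/IH.
Qed.

Lemma is_pathP e s : is_path r d K ltA Phi (e :: s) <-> epath (esrc e) (e :: s).
Proof.
elim: s e => [|e' s IH] e.
  rewrite /is_path /=; split=> [[h _]|[h _ _]]; first by split=> //; apply: h; rewrite inE.
  by split=> // x; rewrite inE => /eqP ->.
split=> [[h /= /andP[/eqP ee' hp]]|[he _ hp]].
  split=> //; first by apply: h; rewrite mem_head.
  rewrite ee'; apply/IH; split=> // x xs; apply: h; by rewrite inE xs orbT.
case: (hp) => he' E _; rewrite -E in hp; have [h1 h2] := (IH e').2 hp.
split=> /=; last by rewrite E eqxx.
by move=> x; rewrite inE => /orP[/eqP ->|/h1].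
Qed.

Definition imgs (D : R * R) (s : seq (edge R)) : R * R :=
  foldl (fun J e => image_int J (epos e)) D s.

Lemma Inv_path D v y s : epath v s -> Inv D v y ->
  Inv (imgs D s) (eend v s) (vec (size v) y (pathM s)).
Proof.
elim: s D v y => [|e s IH] D v y /=.
  by move=> _ iD; apply: Inv_ext iD => i iv; rewrite vec_idm.
move=> [he <- ps] iD; have := IH _ _ _ ps (Inv_edge he iD).
by apply: Inv_ext => i _; rewrite vec_mulm.
Qed.

Lemma width_imgs D s : width (imgs D s) = width D * \prod_(e <- s) edge_weight e.
Proof.
elim: s D => [|e s IH] D /=; first by rewrite big_nil mulr1.
by rewrite IH width_image big_cons /edge_weight mulrA.
Qed.

Lemma imgs_sub D v s : D.1 < D.2 -> epath v s ->
  [/\ D.1 <= (imgs D s).1, (imgs D s).2 <= D.2 & (imgs D s).1 < (imgs D s).2].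
Proof.
elim: s D v => [|e s IH] D v D12 /=; first by rewrite !lexx.
move=> [he _ ps]; have [h1 h2 /andP[h3 _]] := edge_pos he.
have J12 : (epos e).1 < (epos e).2 by rewrite -subr_gt0.
have [s1 s2 s3] := IH (image_int D (epos e)) _ (image_lt D12 J12) ps.
have [h4 h5] := image_sub D12 h1 h2; split=> //; lra.
Qed.

(** One factor [fmu] undoes the normalisation of [y]; the other is the mass that the corresponding
    copy of [mu] gives to the interior. *)
Lemma m_Inv D v y : Inv D v y ->
  m [set x | D.1 <= x <= D.2] = \sum_(j < size v) y j * fmu (at_ v j) * fmu (at_ v j).
Proof.
move=> iD; rewrite m_cc -/(oint D) (inv_m iD) //; last exact: measurable_oo.
apply: eq_bigr => j _; congr (_ * m _); apply/funext => x.
by rewrite -[X in oint X](image_int_id D) /pre /preimage /mkset pre_oint // (inv_lt iD).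
Qed.

Lemma pos_min (A : eqType) (s : seq A) (f : A -> R) : (forall a, a \in s -> 0 < f a) ->
  exists2 b, 0 < b & forall a, a \in s -> b <= f a.
Proof.
elim: s => [|x s IH] h; first by exists 1.
have [|b b0 hb] := IH; first by move=> a as_; apply: h; rewrite inE as_ orbT.
exists (Num.min b (f x)); first by rewrite lt_min b0 h // mem_head.
by move=> a; rewrite inE ge_min => /orP[/eqP ->|/hb -> //]; rewrite lexx orbT.
Qed.

(** A quantitative form of the absence of zero columns. A fixed decomposition [y0] has a positive
    image, and any [y] bounded below by [t] dominates [t / B] times [y0]; nonnegativity of the
    matrix transfers this to the images. *)
Lemma edge_lower e : is_edge e -> exists2 b, 0 < b & forall y t, 0 <= t ->
  (forall i, (i < size (esrc e))%N -> t <= y i) ->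
  forall j, (j < size (etgt e))%N -> b * t <= vec (size (esrc e)) y (edgeM e) j.
Proof.
move=> he; have [n [D0 [w [ws [hn _ _ _]]]]] := edge_data he.
have [y0 /= i0] := Inv_net hn; have i1 := Inv_edge he i0.
pose z j := vec (size (esrc e)) y0 (edgeM e) j.
have [|b b0 hb] := @pos_min _ (iota 0 (size (etgt e))) z.
  by move=> j; rewrite mem_iota /= add0n; exact: (inv_pos i1).
pose B := 1 + \sum_(i < size (esrc e)) y0 i.
have yB i : (i < size (esrc e))%N -> y0 i <= B.
  move=> iv; rewrite /B (bigD1 (Ordinal iv)) //=.
  have : 0 <= \sum_(i0 < size (esrc e) | i0 != Ordinal iv) y0 i0.
    by apply: sumr_ge0 => k _; exact/ltW/(inv_pos i0).
  lra.
have B0 : 0 < B.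
  by apply: lt_le_trans (yB 0%N (inv_size i0)); exact: (inv_pos i0 (inv_size i0)).
exists (b / B); first by rewrite divr_gt0.
move=> y t t0 hy j jt; rewrite mulrAC ler_pdivrMr //.
apply: (@le_trans _ _ (t * z j)).
  by rewrite mulrC ler_wpM2l // hb // mem_iota.
rewrite /z /vec mulr_sumr mulr_suml; apply: ler_sum => i _.
rewrite mulrA [leRHS]mulrAC ler_wpM2r ?edgeM_ge0 // ler_pM //.
- exact/ltW/(inv_pos i0).
- exact: hy.
- exact: yB.
Qed.

(** * Loop classes *)

Variable Lv : set (seq (aff R)).
Notation inL := (Defs.inL r d K ltA Phi Lv).
Notation pathL := (Defs.pathL r d K ltA Phi Lv).
Notation is_vertex := (Defs.is_vertex r d K ltA Phi).
Notation pnorm := (Defs.pnorm r d p mu Phi).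
Hypothesis fnc : FNC r d K ltA Phi.
Hypothesis loopL : loop_class r d K ltA Phi Lv.

Lemma connectsP es v w : is_path r d K ltA Phi es -> connects es v w ->
  epath v es /\ eend v es = w.
Proof.
case: es => [|e es] //= /is_pathP pe [<- <-]; split=> //.
by rewrite /lend /= last_map.
Qed.

Lemma epath_is_path v es : epath v es -> is_path r d K ltA Phi es.
Proof. by case: es => [|e es] // h; apply/is_pathP; case: h => h1 _ h2. Qed.

Lemma epath_connects v es : epath v es -> connects es v (eend v es).
Proof. by case: es => [|e es] //= [_ <- _]; rewrite /lend /= last_map. Qed.

Lemma eend_vertex v s : is_vertex v -> epath v s -> is_vertex (eend v s).
Proof.
by elim: s v => [|e s IH] v //= hv [he _ ps]; apply: (IH (etgt e)) => //; exact: edge_tgt.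
Qed.

Lemma eend_cat v s t : eend v (s ++ t) = eend (eend v s) t.
Proof. by rewrite /lend map_cat last_cat. Qed.

Definition reach v w := exists2 s, epath v s & eend v s = w.

Lemma reach_trans u v w : reach u v -> reach v w -> reach u w.
Proof.
move=> [s ps es] [t pt et]; exists (s ++ t); last by rewrite eend_cat es.
by apply/epath_cat; rewrite es.
Qed.

(* [Lv] together with all vertices on paths from [Lv] to [Lv] is again strongly connected,
   so maximality applies. *)
Lemma loop_closed v s : Lv v -> epath v s -> Lv (eend v s) -> forall e, e \in s -> inL e.
Proof.
pose L' := [set v | (exists2 a, Lv a & reach a v) /\ (exists2 b, Lv b & reach v b)].
case: loopL => [[Lvert Lsc [e0 he0]] Lmax].
have mid v1 s1 : L' v1 -> epath v1 s1 -> L' (eend v1 s1) ->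
    forall e, e \in s1 -> Defs.inL r d K ltA Phi L' e.
  move=> [[a La av] _] ps1 [_ [b Lb wb]] e es1.
  case/splitPr: es1 ps1 wb => t1 t2 /epath_cat[pt1 /= [he Ee pt2]] wb.
  have r1 : reach a (esrc e) by apply: reach_trans av _; exists t1.
  have r2 : reach (etgt e) b.
    by apply: reach_trans wb; exists t2 => //; rewrite eend_cat.
  have re : reach (esrc e) (etgt e) by exists [:: e].
  split=> //; split.
  - by exists a.
  - by exists b => //; apply: reach_trans r2.
  - by exists a => //; apply: reach_trans re.
  - by exists b.
have LL' : Lv `<=` L' by move=> x Lx; split; exists x => //; exists [::].
have cand : loop_cand r d K ltA Phi L'.
  split.
  - by move=> x [[a La [t pt <-]] _]; apply: eend_vertex pt; exact: Lvert.
  - move=> x y Lx Ly; have [_ [b Lb [t1 pt1 e1]]] := Lx; have [[a La [t2 pt2 e2]] _] := Ly.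
    have [es [[pes _] ces]] := Lsc _ _ Lb La; have [pt3 e3] := connectsP pes ces.
    have pall : epath x (t1 ++ es ++ t2).
      by apply/epath_cat; rewrite e1; split=> //; apply/epath_cat; rewrite e3.
    have eall : eend x (t1 ++ es ++ t2) = y by rewrite !eend_cat e1 e3.
    exists (t1 ++ es ++ t2); split.
      split; first exact: epath_is_path pall.
      by apply: mid pall _ => //; rewrite eall.
    by have := epath_connects pall; rewrite eall.
  - by exists e0; case: he0 => h1 h2 h3; split=> //; apply: LL'.
have E := Lmax _ LL' cand; rewrite -E in mid *; exact: mid.
Qed.

Lemma LEL : exists EL : seq (edge R), uniq EL /\ forall e, (e \in EL) <-> inL e.
Proof.
case: fnc => _ /finite_seqP[s Es]; exists (undup [seq e <- s | `[< inL e >]]).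
split; first exact: undup_uniq.
move=> e; rewrite mem_undup mem_filter; split=> [/andP[/asboolP //]|he].
apply/andP; split; first exact/asboolP.
have : [set e | is_edge e] e by case: he.
by rewrite [X in X e]Es.
Qed.

Lemma L_out v : Lv v -> exists2 e, inL e & esrc e = v.
Proof.
move=> Lv_v; case: loopL => [[_ Lsc [e0 he0]] _].
have [_ Ls _] := he0; have [es [[_ pL] ces]] := Lsc _ _ Lv_v Ls.
case: es pL ces => [|e es] pL /= ces; first by exists e0.
by exists e; [apply: pL; rewrite mem_head|case: ces].
Qed.

Lemma fmin : exists2 b, 0 < b & forall v f, is_vertex v -> f \in v -> b <= fmu f <= 1.
Proof.
case: fnc => /finite_seqP[s Es] _.
have vs v : is_vertex v <-> v \in s.
  by have := congr1 (fun S : set _ => S v) Es => /= ->.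
have [|b b0 hb] := @pos_min _ (flatten s) fmu.
  move=> f /flattenP[v /vs[n [D hn]] fv]; have [y iv] := Inv_net hn.
  by have [k Kk kP] := inv_meet iv fv; exact: fmu_gt0 Kk kP.
exists b => // v f /vs vv fv; rewrite hb; last by apply/flattenP; exists v.
rewrite /= -mT; apply: m_le => //; exact: measurable_pre (measurable_oo 0 1).
Qed.

Lemma emin : exists2 b, 0 < b <= 1 & forall e, is_edge e -> forall y t, 0 <= t ->
  (forall i, (i < size (esrc e))%N -> t <= y i) ->
  forall j, (j < size (etgt e))%N -> b * t <= vec (size (esrc e)) y (edgeM e) j.
Proof.
case: fnc => _ /finite_seqP[s Es].
have vs e : is_edge e <-> e \in s.
  by have := congr1 (fun S : set _ => S e) Es => /= ->.
have /choice[f fP] : forall e, exists b, is_edge e -> 0 < b /\ forall y t, 0 <= t ->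
  (forall i, (i < size (esrc e))%N -> t <= y i) ->
  forall j, (j < size (etgt e))%N -> b * t <= vec (size (esrc e)) y (edgeM e) j.
  move=> e; have [he|] := pselect (is_edge e); last by exists 0.
  by have [b b0 hb] := edge_lower he; exists b.
have [|b b0 hb] := @pos_min _ s f; first by move=> e /vs/fP[].
exists (Num.min b 1); first by rewrite lt_min b0 ltr01 ge_min lexx orbT.
move=> e he y t t0 hy j jt; have [_ h] := fP e he.
apply: le_trans (h y t t0 hy j jt); apply: ler_wpM2r => //.
by rewrite ge_min hb //; apply/vs.
Qed.

Lemma path_lower b v s : 0 < b <= 1 -> (forall e, is_edge e -> forall y t, 0 <= t ->
  (forall i, (i < size (esrc e))%N -> t <= y i) ->
  forall j, (j < size (etgt e))%N -> b * t <= vec (size (esrc e)) y (edgeM e) j) ->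
  epath v s -> forall y t, 0 <= t -> (forall i, (i < size v)%N -> t <= y i) ->
  forall j, (j < size (eend v s))%N -> b ^+ size s * t <= vec (size v) y (pathM s) j.
Proof.
move=> /andP[b0 _] hb; elim: s v => [|e s IH] v /=.
  by move=> _ y t _ h j jv; rewrite expr0 mul1r vec_idm // h.
move=> [he <- ps] y t t0 hy j jv; rewrite vec_mulm exprSr -mulrA.
apply: (IH _ ps) => //; first by rewrite mulr_ge0 // ltW.
by move=> i it; apply: hb.
Qed.

Definition rho_int (D : R * R) : R := m [set x | D.1 <= x <= D.2].

Lemma rho_gt0 D v y : Inv D v y -> 0 < rho_int D.
Proof.
move=> iD; rewrite /rho_int (m_Inv iD) (bigD1 (Ordinal (inv_size iD))) //=.
have pos j : (j < size v)%N -> 0 < y j * fmu (at_ v j) * fmu (at_ v j).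
  move=> jv; have [k Kk kP] := inv_meet iD (mem_nth (aff_id R) jv).
  by rewrite !mulr_gt0 ?(inv_pos iD) // (fmu_gt0 Kk kP).
rewrite ltr_pwDl // ?pos ?(inv_size iD) // sumr_ge0 // => j _; exact/ltW/pos.
Qed.

(** Once the starting coefficients lie in [[a, b]] and the factors [fmu] in [[f0, 1]], the measure
    is the sum of the matrix entries up to constants independent of the path. The square of [f0]
    reflects the two factors in [m_Inv]. *)
Lemma rho_pnorm f0 D v y a b e s : 0 < f0 ->
  (forall v f, is_vertex v -> f \in v -> f0 <= fmu f <= 1) -> is_vertex v ->
  Inv D v y -> 0 <= a -> (forall i, (i < size v)%N -> a <= y i <= b) -> epath v (e :: s) ->
  a * f0 ^+ 2 * pnorm e s <= rho_int (imgs D (e :: s)) <= b * pnorm e s.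
Proof.
move=> f00 hf vv iD a0 hy pes; rewrite /rho_int (m_Inv (Inv_path pes iD)).
have Ev : esrc e = v by case: pes.
have vend := eend_vertex vv pes.
have Eend : eend v (e :: s) = etgt (last e s) by rewrite /lend /= last_map.
have fz j : (j < size (eend v (e :: s)))%N -> f0 <= fmu (at_ (eend v (e :: s)) j) <= 1.
  by move=> jv; apply: (hf _ _ vend); exact: mem_nth.
rewrite /Defs.pnorm Ev -Eend; have := @pathM_ge0 (e :: s).
move: (pathM (e :: s)) => A A0.
rewrite exchange_big /= !mulr_sumr.
have S0 j : 0 <= \sum_(i < size v) A i j by apply: sumr_ge0 => i _; exact: A0.
have zb j : a * \sum_(i < size v) A i j <= vec (size v) y A j <= b * \sum_(i < size v) A i j.
  rewrite /vec !mulr_sumr; apply/andP; split; apply: ler_sum => i _.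
    by apply: ler_wpM2r; [exact: A0|have /andP[] := hy i (ltn_ord i)].
  by apply: ler_wpM2r; [exact: A0|have /andP[] := hy i (ltn_ord i)].
apply/andP; split; apply: ler_sum => j _; have /andP[f1 f2] := fz j (ltn_ord j);
  have /andP[] := zb j; move: (S0 j); move: (\sum_(i < _) _) (vec _ _ _ _) => S z S0' z1 z2.
- rewrite -[leRHS]mulrA mulrAC expr2; apply: ler_pM => //.
  + by apply: mulr_ge0.
  + by apply: mulr_ge0; exact: ltW.
  + by apply: ler_pM => //; exact: ltW.
- apply: le_trans z2; rewrite -mulrA ler_piMr //; first by apply: le_trans z1; apply: mulr_ge0.
  by apply: mulr_ile1 => //; exact: fmu_ge0.
Qed.

(** At any net interval with the right neighbour set, the upper half of [rho_pnorm] bounds a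
    positive measure by a multiple of the norm. *)
Lemma pnorm_gt0 e s : epath (esrc e) (e :: s) -> 0 < pnorm e s.
Proof.
move=> pes; have he : is_edge e by case: pes.
have [n [D hn]] := edge_src he; have [y /= iD] := Inv_net hn.
have [f0 f00 hf] := fmin.
pose b := \sum_(i < size (esrc e)) y i.
have yb i : (i < size (esrc e))%N -> 0 <= y i <= b.
  move=> iv; rewrite (ltW (inv_pos iD iv)) /b (bigD1 (Ordinal iv)) //= lerDl.
  by apply: sumr_ge0 => k _; exact/ltW/(inv_pos iD).
have vv : is_vertex (esrc e) by exists n, D.
have /andP[_ h] := rho_pnorm f00 hf vv iD (lexx 0) yb pes.
have h1 := lt_le_trans (rho_gt0 (Inv_path pes iD)) h.
have b0 : 0 <= b by apply: sumr_ge0 => k _; exact/ltW/(inv_pos iD).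
rewrite ltNge; apply/negP => /(mulr_ge0_le0 b0) h2.
by have := lt_le_trans h1 h2; rewrite ltxx.
Qed.

(** * Translation to the symbolic setting *)

Hypothesis irrL : irreducible r d p K mu ltA Phi Lv.
Variable EL : seq (edge R).
Hypothesis uEL : uniq EL.
Hypothesis ELP : forall e, (e \in EL) <-> inL e.

Notation lp := (lpath (@esrc R) (@etgt R) EL).
Notation rho := (Defs.rho mu).
Notation adm_prefix := (Defs.adm_prefix r d K ltA Phi Lv).

Lemma lpP v (s : seq (edge R)) : lp v s <-> epath v s /\ forall e, e \in s -> inL e.
Proof.
elim: s v => [|e s IH] v //=; split=> [/and3P[/ELP he /eqP <- /IH[h1 h2]]|[[he <- ps] h]].
  split; first by split=> //; case: he.
  by move=> x; rewrite inE => /orP[/eqP ->|/h2].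
rewrite eqxx /=; apply/andP; split; first by apply/ELP/h; rewrite mem_head.
by apply/IH; split=> // x xs; apply: h; rewrite inE xs orbT.
Qed.

Lemma lp_closed v s : Lv v -> epath v s -> Lv (eend v s) -> lp v s.
Proof. by move=> h1 h2 h3; apply/lpP; split=> //; exact: loop_closed h3. Qed.

Lemma lp_end v s : Lv v -> lp v s -> Lv (eend v s).
Proof.
elim: s v => [|e s IH] v //= hv /and3P[/ELP[_ _ he] _ ps].
exact: (IH (etgt e) he ps).
Qed.

Definition log_norm (s : seq (edge R)) : R :=
  if s is e :: s' then - ln (pnorm e s') else 0.

Lemma irr_log : exists (H : seq (seq (edge R))) (CH : R), forall u v s1 s2, Lv u -> Lv v -> lp u s1 -> lp v s2 ->
  s1 <> [::] -> s2 <> [::] -> exists2 g, g \in H &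
    lp u (s1 ++ g ++ s2) /\ `|log_norm (s1 ++ g ++ s2) - log_norm s1 - log_norm s2| <= CH.
Proof.
case: irrL => H [C [C1 _ hC]]; exists H, (ln C) => u v [//|e1 s1] [//|e2 s2] Lu Lv' l1 l2 _ _.
have [q1 a1] := (lpP _ _).1 l1; have [q2 a2] := (lpP _ _).1 l2.
have [g gH [pg hg]] := hC e1 s1 e2 s2 (conj (epath_is_path q1) a1) (conj (epath_is_path q2) a2).
exists g => //; have Eu : esrc e1 = u by case: q1.
have Ev : esrc e2 = v by case: q2.
have pu : epath u ((e1 :: s1) ++ g ++ e2 :: s2) by move/is_pathP: pg; rewrite Eu.
split.
  (* The connector is only known to be a path of the graph; the joined path starts and ends in [Lv],
     so it stays in the class. *)
  apply: lp_closed => //; rewrite !eend_cat.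
  have := lp_end Lv' l2; rewrite /lend /=.
  by case: (s2).
have C0 : 0 < C by lra.
have n1 : 0 < pnorm e1 s1 by apply: pnorm_gt0; rewrite Eu.
have n2 : 0 < pnorm e2 s2 by apply: pnorm_gt0; rewrite Ev.
have n3 : 0 < pnorm e1 (s1 ++ g ++ e2 :: s2) by apply: pnorm_gt0; rewrite Eu.
move: hg => /= /andP[h1 h2]; rewrite /log_norm /= ler_norml.
have Ci : 0 < C^-1 by rewrite invr_gt0.
have : ln (C^-1 * pnorm e1 s1 * pnorm e2 s2) <= ln (pnorm e1 (s1 ++ g ++ e2 :: s2)).
  by rewrite ler_ln ?posrE ?mulr_gt0.
have : ln (pnorm e1 (s1 ++ g ++ e2 :: s2)) <= ln (C * pnorm e1 s1 * pnorm e2 s2).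
  by rewrite ler_ln ?posrE ?mulr_gt0.
rewrite !lnM ?posrE ?mulr_gt0 // lnV ?posrE //.
move: (ln _) (ln (pnorm e1 s1)) (ln (pnorm e2 s2)) (ln C) => x y z w; lra.
Qed.

Definition lw (e : edge R) : R := - ln (edge_weight e).

Lemma edge_weight_lw e : is_edge e -> edge_weight e = expR (- lw e).
Proof. by move=> /edge_pos[_ _ /andP[h _]]; rewrite /lw opprK lnK. Qed.

Lemma lw_gt0 e : is_edge e -> 0 < lw e.
Proof. by move=> /edge_pos[_ _ h]; rewrite /lw oppr_gt0 ln_lt0. Qed.

Lemma lw_bounds : exists lmin lmax, 0 < lmin /\ forall e, e \in EL -> lmin <= lw e <= lmax.
Proof.
have [|b b0 hb] := @pos_min _ EL lw; first by move=> e /ELP[/lw_gt0].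
exists b, (\sum_(e <- EL) `|lw e|); split=> // e eE; rewrite hb //= (big_rem e eE) /=.
apply: le_trans (ler_norm _) _; rewrite lerDl; exact: sumr_ge0.
Qed.

Lemma Wt_wt s : Wt s = wt (@edge_weight R) s.
Proof. by rewrite /Wt -/(imgs (0, 1) s) width_imgs /width /= subr0 mul1r. Qed.

Lemma admP zeta : adm_prefix zeta -> exists v0 u,
  [/\ net 0 ((0, 1), v0), epath v0 zeta, eend v0 zeta = u & Lv u].
Proof.
move=> [[pz rz] [u Lu eu]]; case: zeta pz rz eu => [|e s] pz rz /= eu.
  by exists u, u.
exists (esrc e), u; split=> //; first exact: rz.
  exact/is_pathP.
by rewrite -eu /lend /= last_map.
Qed.

Definition cost (zeta s : seq (edge R)) : R := - ln (rho (zeta ++ s)).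

Lemma rhoE es : rho es = rho_int (imgs (0, 1) es).
Proof. by []. Qed.

Lemma imgs_cat (D : R * R) (s t : seq (edge R)) : imgs D (s ++ t) = imgs (imgs D s) t.
Proof. exact: foldl_cat. Qed.

Lemma rho_path_gt0 v0 es : net 0 ((0, 1), v0) -> epath v0 es -> 0 < rho es.
Proof.
move=> hn pes; have [y iy] := Inv_net hn; rewrite rhoE.
exact: rho_gt0 (Inv_path pes iy).
Qed.

Lemma rho_mono v0 s t : net 0 ((0, 1), v0) -> epath v0 (s ++ t) -> rho (s ++ t) <= rho s.
Proof.
move=> hn /epath_cat[ps pt]; rewrite !rhoE imgs_cat.
have [_ _ h] := imgs_sub (ltr01 : ((0 : R), (1 : R)).1 < (0, 1).2) ps.
have [h1 h2 _] := imgs_sub h pt.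
apply: m_le; [exact: measurable_cc|exact: measurable_cc|].
by move=> x /= /andP[a b]; rewrite (le_trans h1 a) (le_trans b h2).
Qed.

Lemma rho_le1 es : rho es <= 1.
Proof. by rewrite -mT; apply: m_le => //; exact: measurable_cc. Qed.

(** The analysis of [mu] enters the symbolic part here: comparability with [log_norm] comes from
    [rho_pnorm], monotonicity from nested intervals, and linear growth from [path_lower]. *)
Lemma base_rho zeta v0 u : net 0 ((0, 1), v0) -> epath v0 zeta -> eend v0 zeta = u ->
  Lv u -> base (@esrc R) (@etgt R) EL Lv log_norm u (cost zeta).
Proof.
move=> hn pz ez Lu.
have pall s : lp u s -> epath v0 (zeta ++ s).
  by move=> /lpP[ps _]; apply/epath_cat; rewrite ez.
have [y0 i0] := Inv_net hn; have iz := Inv_path pz i0; rewrite ez /= in iz.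
set y := vec _ _ _ in iz.
have [a a0 ha] : exists2 a, 0 < a & forall i, i \in iota 0 (size u) -> a <= y i.
  by apply: pos_min => i; rewrite mem_iota /= add0n; exact: (inv_pos iz).
pose b := \sum_(i < size u) y i.
have yb i : (i < size u)%N -> a <= y i <= b.
  move=> iv; rewrite ha ?mem_iota // /b (bigD1 (Ordinal iv)) //= lerDl.
  by apply: sumr_ge0 => k _; exact/ltW/(inv_pos iz).
have b0 : 0 < b.
  by have /andP[h1 h2] := yb 0%N (inv_size iz); apply: lt_le_trans h2; exact: lt_le_trans h1.
have [f0 f00 hf] := fmin.
have vu : is_vertex u by case: loopL => [[Lvert _ _] _]; exact: Lvert.
have rpos s : lp u s -> 0 < rho (zeta ++ s) by move/pall; exact: rho_path_gt0.
have af0 : 0 < a * f0 ^+ 2 by rewrite mulr_gt0 // exprn_gt0.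
split=> //.
- exists (`|ln (a * f0 ^+ 2)| + `|ln b|) => -[//|e s] ls _.
  have [ps _] := (lpP _ _).1 ls.
  have Eu : esrc e = u by case: ps.
  have pn : 0 < pnorm e s by apply: pnorm_gt0; rewrite Eu.
  have := rho_pnorm f00 hf vu iz (ltW a0) yb ps.
  rewrite -imgs_cat -rhoE => /andP[h1 h2].
  have r1 : ln (a * f0 ^+ 2) + ln (pnorm e s) <= ln (rho (zeta ++ e :: s)).
    by rewrite -lnM ?posrE // ler_ln ?posrE ?mulr_gt0 // rpos.
  have r2 : ln (rho (zeta ++ e :: s)) <= ln b + ln (pnorm e s).
    by rewrite -lnM ?posrE // ler_ln ?posrE ?mulr_gt0 // rpos.
  have := ler_norm (- ln (a * f0 ^+ 2)); have := ler_norm (ln b).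
  have := normr_ge0 (ln (a * f0 ^+ 2)); have := normr_ge0 (ln b).
  rewrite normrN /cost /log_norm ler_norml; lra.
- by move=> s ls; rewrite /cost oppr_ge0 ln_le0 // rho_le1.
- move=> s t ls; rewrite /cost lerN2 ler_ln ?posrE ?rpos //; last first.
    by move: ls; rewrite lpath_cat => /andP[].
  by rewrite catA; apply: (rho_mono hn); rewrite -catA; exact: pall.
- have [g g01 hg] := emin; have [g0 g1] := andP g01.
  pose A := a * f0 ^+ 2.
  exists (`|ln g| + `|ln A|) => s ls; have [ps _] := (lpP _ _).1 ls.
  have iv := Inv_path ps iz; have sv := inv_size iv.
  have yu i : (i < size u)%N -> a <= y i by move=> /yb/andP[].
  have low := path_lower g01 hg ps (ltW a0) yu sv.
  have vend := eend_vertex vu ps.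
  have h : g ^+ size s * A <= rho (zeta ++ s).
    rewrite rhoE imgs_cat /rho_int (m_Inv iv) (bigD1 (Ordinal sv)) //=.
    have fz j : (j < size (eend u s))%N -> f0 <= fmu (at_ (eend u s) j) <= 1.
      by move=> jv; apply: (hf _ _ vend); exact: mem_nth.
    have /andP[fa _] := fz 0%N sv.
    rewrite -[leLHS]addr0 lerD //; last first.
      apply: sumr_ge0 => j _; rewrite !mulr_ge0 ?fmu_ge0 // ltW //.
      exact: (inv_pos iv).
    rewrite /A mulrA -[leRHS]mulrA expr2; apply: ler_pM => //.
    + by apply: mulr_ge0; [apply: exprn_ge0; exact: ltW|exact: ltW].
    + by apply: mulr_ge0; exact: ltW.
    + by apply: ler_pM => //; exact: ltW.
  have gA : 0 < g ^+ size s * A by rewrite mulr_gt0 // exprn_gt0.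
  have : ln (g ^+ size s * A) <= ln (rho (zeta ++ s)) by rewrite ler_ln ?posrE // rpos.
  rewrite lnM ?posrE ?exprn_gt0 // lnXn // -mulr_natl /cost.
  have := ler_norm (- ln A); have n1 := ler_norm (- ln g); rewrite !normrN in n1 *.
  have : (size s)%:R * - ln g <= (size s)%:R * `|ln g| by rewrite ler_wpM2l.
  have : 0 <= `|ln A| * (size s)%:R by rewrite mulr_ge0.
  have := normr_ge0 (ln g); lra.
Qed.

Lemma epath_edge v (s : seq (edge R)) e : epath v s -> e \in s -> is_edge e.
Proof.
elim: s v => //= x s IH v [hx _ ps]; rewrite inE => /orP[/eqP -> //|]; exact: (IH (etgt x)).
Qed.

Lemma Wt_len v s : epath v s -> Wt s = expR (- len lw s).
Proof.
rewrite Wt_wt /wt /len; elim: s v => [|e s IH] v /=; first by rewrite !big_nil oppr0 expR0.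
by move=> [he _ ps]; rewrite !big_cons (IH _ ps) edge_weight_lw // opprD expRD.
Qed.

Lemma rooted_epath v0 es : net 0 ((0, 1), v0) -> es <> [::] ->
  rooted r d K ltA Phi es -> epath v0 es.
Proof.
case: es => // e es hn _ [pe /(_ e es erefl) he].
by rewrite (root_uniq hn he); apply/is_pathP.
Qed.

Section Admissible.
Variables (zeta : seq (edge R)) (v0 u : seq (aff R)).
Hypothesis hn : net 0 ((0, 1), v0).
Hypothesis pz : epath v0 zeta.
Hypothesis ez : eend v0 zeta = u.
Hypothesis Lu : Lv u.

Lemma lp_epath s : lp u s -> epath v0 (zeta ++ s).
Proof. by move=> /lpP[ps _]; apply/epath_cat; rewrite ez. Qed.

Lemma take_zeta (s : seq (edge R)) : s <> [::] ->
  take (size (zeta ++ s)).-1 (zeta ++ s) = zeta ++ take (size s).-1 s.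
Proof.
case: s => // e s _; rewrite size_cat /= addnS /= take_cat ltnNge leq_addr /=.
by rewrite addKn.
Qed.

Lemma inFL_set t lmin lmax : 0 < lmin -> (forall e, e \in EL -> lmin <= lw e <= lmax) ->
  0 < t -> t < Wt zeta ->
  inFL r d K ltA Phi Lv zeta t =
  [set` [seq zeta ++ s | s <- F (@esrc R) (@etgt R) EL lw lmin u (- ln t - len lw zeta)]].
Proof.
move=> l0 hl t0 tz; set x := - ln t - len lw zeta.
have key s : s <> [::] -> lp u s ->
   (Wt (zeta ++ s) <= t < Wt (take (size (zeta ++ s)).-1 (zeta ++ s))) =
   (len lw (take (size s).-1 s) < x <= len lw s).
  move=> ns ls; rewrite take_zeta // -{1 2}[t]lnK ?posrE //.
  have lt : lp u (take (size s).-1 s).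
    by move: ls; rewrite -{1}[s](cat_take_drop (size s).-1) lpath_cat => /andP[].
  rewrite (Wt_len (lp_epath ls)) (Wt_len (lp_epath lt)) ler_expR ltr_expR !len_cat.
  by rewrite andbC /x; congr andb; apply/idP/idP; lra.
apply/seteqP; split=> es /=.
  move=> [[ro sz hW] [s [E hs]]]; have nes : es <> [::] by case: (es) sz.
  have pes := rooted_epath hn nes ro.
  (* [zeta] alone is not a stopped path, because [t < Wt zeta]. *)
  have ns : s <> [::].
    by move=> s0; move: hW; rewrite E s0 cats0 => /andP[/le_lt_trans/(_ tz)]; rewrite ltxx.
  have ls : lp u s.
    by apply/lpP; split=> //; move: pes; rewrite E => /epath_cat[_]; rewrite ez.
  rewrite E; apply/mapP; exists s => //.
  by rewrite (mem_F _ _ l0 hl) /Fin ls -key // -E.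
move=> /mapP[s]; rewrite (mem_F _ _ l0 hl) => Fs ->.
have ns := Fin_neq0 Fs; have ls := Fin_path Fs; have pes := lp_epath ls.
split; last by exists s; split=> //; have [_] := (lpP _ _).1 ls.
split.
- split; first exact: epath_is_path pes.
  by move=> e0 es' E; move: pes; rewrite E => -[_ -> _].
- by case: (s) ns => // e s' _; rewrite size_cat addnS.
- by rewrite key //; case/andP: Fs.
Qed.

Lemma sumFL_Y q t lmin lmax : 0 < lmin -> (forall e, e \in EL -> lmin <= lw e <= lmax) ->
  0 < t -> t < Wt zeta ->
  fine (sumFL r d K mu ltA Phi Lv zeta q t) =
  Y (@esrc R) (@etgt R) EL lw lmin u (cost zeta) q (- ln t - len lw zeta).
Proof.
move=> l0 hl t0 tz; rewrite /sumFL (inFL_set l0 hl t0 tz).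
rewrite esum_fset; [|exact: finite_seq|by move=> es _; rewrite lee_fin powR_ge0].
rewrite -fsbig_seq; last first.
  rewrite map_inj_uniq; first by apply: uniq_F.
  by move=> s s' /(congr1 (drop (size zeta))); rewrite !drop_size_cat.
rewrite big_map sumEFin /= /Y big_seq [RHS]big_seq; apply: eq_bigr => s.
rewrite (mem_F _ _ l0 hl) => Fs; have rp := rho_path_gt0 hn (lp_epath (Fin_path Fs)).
by rewrite /powR gt_eqF // /cost mulrN opprK.
Qed.

(** A path through [zeta] might leave the class before settling in it; since [zeta] ends in [Lv] and
    the path is eventually back there, [loop_closed] excludes such an excursion. *)
Lemma omega_pts al : [set g | [/\ in_OmegaL r d K ltA Phi Lv g,
     Defs.prefix g (size zeta) = zeta & has_locdim mu g al]] =
  pts (@esrc R) (@etgt R) EL lw u (cost zeta) zeta al.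
Proof.
have edge_len g n : epath v0 (mkseq g n) -> (0 < n)%N -> 0 < len lw (mkseq g n).
  case: n => // n pg _; have : forall e, e \in mkseq g n.+1 -> 0 < lw e.
    by move=> e /(epath_edge pg)/lw_gt0.
  rewrite /mkseq /len /=; move: (g 0%N) (map g _) => x s h.
  rewrite big_cons ltr_pwDl ?h ?mem_head // big_seq; apply: sumr_ge0 => e es.
  by apply/ltW/h; rewrite inE es orbT.
have epath_mkseq g : (forall n, is_edge (g n)) -> (forall n, etgt (g n) = esrc (g n.+1)) ->
    forall n, epath (esrc (g 0%N)) (mkseq g n).
  move=> he hs n; rewrite /mkseq; have : forall k, epath (esrc (g k)) [seq g i | i <- iota k n].
    elim: n => //= n IH k; split=> //; rewrite hs; exact: IH.
  exact.
have lim g : cyl zeta g -> (forall n, epath v0 (mkseq g n)) ->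
   has_locdim mu g al <-> (forall eps, 0 < eps -> exists N, forall n, (N <= n)%N ->
   `|cost zeta (tail zeta g n) - al * len lw (mkseq g n)| <= eps * len lw (mkseq g n)).
  move=> zg pg.
  have E n : (size zeta < n)%N -> forall eps,
      (`|al - ln (rho (mkseq g n)) / ln (Wt (mkseq g n))| <= eps) =
      (`|cost zeta (tail zeta g n) - al * len lw (mkseq g n)| <= eps * len lw (mkseq g n)).
    move=> nz eps; have n0 : (0 < n)%N by apply: leq_ltn_trans nz.
    have L0 := edge_len g n (pg n) n0.
    rewrite (Wt_len (pg n)) expRK /cost -mkseq_tail ?(ltnW nz) //.
    move: (ln (rho _)) (len lw _) L0 => x L L0.
    have -> : - x - al * L = - (al - x / - L) * L by field; rewrite gt_eqF.
    by rewrite normrM normrN (gtr0_norm L0) ler_pM2r.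
  split=> [/cvgrPdist_le h eps eps0|h].
    have [N _ hN] := h eps eps0; exists (maxn N (size zeta).+1) => n.
    by rewrite geq_max => /andP[Nn zn]; rewrite -E //; exact: (hN n Nn).
  apply/cvgrPdist_le => eps eps0; have [N hN] := h eps eps0.
  exists (maxn N (size zeta).+1) => // n /=.
  by rewrite geq_max => /andP[Nn zn]; rewrite E // hN.
apply/seteqP; split=> g /=.
  move=> [[[he hs hr] [N hN]] zg hd].
  have pg n : epath v0 (mkseq g n) by rewrite (root_uniq hn hr); exact: epath_mkseq.
  split=> //; last exact/(lim g zg pg).
  (* An index beyond [n], beyond [zeta] and beyond the time from which the edges lie in the class:
     the path then ends in [Lv], and the tail at [n] is a prefix of the tail at [k]. *)
  move=> n; pose k := (maxn n (maxn N (size zeta))).+1.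
  have zk : (size zeta <= k)%N by rewrite /k; lia.
  have [|t Et] := @tail_mono _ zeta g n k; first by rewrite /k; lia.
  have pk := pg k; rewrite (mkseq_tail zg zk) in pk.
  have [_] := (epath_cat _ _ _).1 pk; rewrite ez => pt.
  have Lend : Lv (eend u (tail zeta g k)).
    have : eend v0 (mkseq g k) = eend u (tail zeta g k).
      by rewrite [in LHS](mkseq_tail zg zk) eend_cat ez.
    move=> <-; rewrite /k mkseqS /lend map_rcons last_rcons.
    by have [|_ _] := hN (maxn n (maxn N (size zeta))); first by lia.
  by have := lp_closed Lu pt Lend; rewrite Et lpath_cat => /andP[].
move=> [zg pg hd].
have pe n : epath v0 (mkseq g n).
  have h k : (size zeta <= k)%N -> epath v0 (mkseq g k).
    by move=> zk; rewrite (mkseq_tail zg zk); exact: lp_epath.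
  rewrite -(@take_mkseq _ g n (n + size zeta)) ?leq_addr //.
  have := h (n + size zeta)%N (leq_addl _ _).
  by rewrite -{1}(cat_take_drop n (mkseq g (n + size zeta))) => /epath_cat[].
have ed n : is_edge (g n).
  by apply: (epath_edge (pe n.+1)); apply: map_f; rewrite mem_iota /= add0n.
split=> //; last exact/(lim g zg pe).
split.
  split=> //.
    move=> n; have := pe n.+2; rewrite mkseqS -cats1 => /epath_cat[_ [_ -> _]].
    by rewrite mkseqS /lend map_rcons last_rcons.
  by have [_ -> _] := pe 1%N.
exists (size zeta) => k zk.
have [_ h] := (lpP _ _).1 (pg k.+1); apply: h.
rewrite /tail mkseqS drop_rcons ?size_mkseq // mem_rcons mem_head //.
Qed.

End Admissible.

Lemma pdist_dist : pdist (R := R) = dist (@edge_weight R).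
Proof.
apply/funext => g1; apply/funext => g2; rewrite /pdist /dist; congr inf.
by apply/seteqP; split=> _ [n h <-]; exists n; rewrite ?Wt_wt.
Qed.

Lemma multifractal : exists tau : R -> R,
  (forall zeta (q : R), adm_prefix zeta ->
     tau_approx r d K mu ltA Phi Lv zeta q t @[t --> 0^'+] --> tau q) /\
  (forall zeta (alpha : R), adm_prefix zeta ->
     fL r d K mu ltA Phi Lv zeta alpha = concave_conj tau alpha).
Proof.
have [lmin [lmax [l0 hl]]] := lw_bounds; have [H [CH irr]] := irr_log.
have VLtgt e : e \in EL -> Lv (etgt e) by move=> /ELP[].
have VLout v : Lv v -> exists2 e, e \in EL & esrc e = v.
  by move=> /L_out[e /ELP]; exists e.
have [tau tauP] := pressure l0 hl uEL VLtgt VLout irr.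
exists tau; split=> zeta q /admP[v0 [u [hn pz ez Lu]]]; have b := base_rho hn pz ez Lu.
  apply/cvgrPdist_le => e e0; pose z := len lw zeta.
  have [X hX] := tauP u _ b q (e / 2) ltac:(lra).
  (* For [t < expR (- M)], [zeta] is not yet stopped, the reduced threshold [- ln t - z] is at least
     [X], and the shift error [tau q * z] is at most [e / 2] times [- ln t] in absolute value. *)
  pose M := `|z| + `|X| + 1 + 2 * `|tau q * z| / e.
  have M0 : 0 <= 2 * `|tau q * z| / e by rewrite divr_ge0 ?mulr_ge0 // ltW.
  near=> t.
  have t0 : 0 < t by near: t; exact: nbhs_right_gt.
  have tM : t < expR (- M) by near: t; apply: nbhs_right_lt; exact: expR_gt0.
  have LM : M < - ln t by rewrite ltrNr -ltr_expR lnK.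
  have zW : t < Wt zeta.
    rewrite (Wt_len pz); apply: lt_trans tM _; rewrite ltr_expR ltrN2 -/z /M.
    by have := ler_norm z; have := normr_ge0 X; move: (2 * _ / e) M0 => w; lra.
  rewrite /tau_approx (sumFL_Y hn pz ez q l0 hl t0 zW) -/z.
  have x1 : X <= - ln t - z.
    move: LM; rewrite /M; have := ler_norm z; have := ler_norm X.
    by move: (2 * _ / e) M0 => w; lra.
  have := hX _ x1; move: (ln (Y _ _ _ _ _ _ _ _ _)) => lY.
  have L0 : 0 < - ln t.
    by apply: le_lt_trans LM; rewrite /M !addr_ge0.
  have tz : 2 * `|tau q * z| <= e * - ln t.
    rewrite [leRHS]mulrC -ler_pdivrMr //; apply: le_trans (ltW LM); rewrite /M.
    by rewrite lerDr !addr_ge0.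
  move=> hY.
  have -> : tau q - lY / ln t = (lY + tau q * (- ln t - z) + tau q * z) / - ln t.
    by field; rewrite lt_eqF // -oppr_gt0.
  rewrite normrM normfV (gtr0_norm L0) ler_pdivrMr //.
  apply: le_trans (ler_normD _ _) _.
  have z0 : 0 <= z.
    by rewrite /z /len big_seq; apply: sumr_ge0 => e' /(epath_edge pz)/lw_gt0/ltW.
  have ez0 : 0 <= e / 2 * z by rewrite mulr_ge0 // divr_ge0 // ltW.
  by move: hY tz ez0; move: (ln t) (`|tau q * z|) (`|lY + _|) => a w v; lra.
rewrite /fL (omega_pts hn pz ez Lu) pdist_dist.
apply: (pts_dim l0 hl uEL VLtgt VLout irr tauP b).
  by move=> e ez'; exact/ltW/lw_gt0/(epath_edge pz).
move=> e /orP[/ELP[he _ _]|ee]; apply: edge_weight_lw => //; exact: (epath_edge pz).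
Unshelve. all: by end_near.
Qed.

End SelfSimilarMeasure.

Unset Implicit Arguments.

Theorem theorem5p8 (R : realType) (I : finType) (r d p : I -> R)
  (K : set R) (mu : probability R R) (ltA : rel (aff R))
  (Phi : seq (aff R) -> seq (seq (seq I))) (Lv : set (seq (aff R))) :
  (* the WIFS *)
  (forall i, 0 < `|r i| < 1) ->
  (forall i, 0 < p i) ->
  \sum_(i : I) p i = 1 ->
  (* K is the self-similar set *)
  K !=set0 -> compact K ->
  K = \bigcup_(i in [set: I]) (app (Smap r d i) @` K) ->
  (* mu is the self-similar measure *)
  (forall E, measurable E ->
     mu E = (\sum_(i : I) (p i)%:E * mu (app (Smap r d i) @^-1` E))%E) ->
  (* standing assumptions: K not a singleton, convex hull of K is [0,1] *)
  ~ (exists x, K = [set x]) ->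
  K `<=` [set x | 0 <= x <= 1] -> K 0 -> K 1 ->
  (* the fixed total order on affine maps *)
  strict_total_order ltA ->
  (* Phi is an iteration rule and the WIFS satisfies the Phi-FNC *)
  iteration_rule r d K ltA Phi ->
  FNC r d K ltA Phi ->
  (* L is an irreducible loop class *)
  loop_class r d K ltA Phi Lv ->
  irreducible r d p K mu ltA Phi Lv ->
  exists tau : R -> R,
    (* tau_L(q) = lim_{t -> 0} log sum_{F_{L,zeta}(t)} rho^q / log t,
       for every admissible zeta *)
    (forall zeta (q : R), adm_prefix r d K ltA Phi Lv zeta ->
       tau_approx r d K mu ltA Phi Lv zeta q t @[t --> 0^'+] --> tau q) /\
    (* f_L = tau_L^* *)
    (forall zeta (alpha : R), adm_prefix r d K ltA Phi Lv zeta ->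
       fL r d K mu ltA Phi Lv zeta alpha = concave_conj tau alpha).
Proof.
move=> r01 p0 p1 _ Kcomp Kinv muE _ K01 K0 K1 ltAP PhiP fnc loopL irrL.
have [EL [uEL ELP]] := LEL Lv fnc.
exact: (multifractal r01 p0 p1 Kcomp Kinv muE K01 K0 K1 ltAP PhiP fnc loopL irrL uEL ELP).
Qed.
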